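(* Let $D\subset\mathbb{H}$ be a definite quaternion division algebra over $\mathbb{Q}$ (with $D\otimes\mathbb{R}\cong\mathbb{H}$), $\mathcal{O}\subset D$ a maximal order, and $L\subset D$ a left ideal of $\mathcal{O}$ which is a full-rank lattice in $\mathbb{H}$, with $\mathbb{Z}$-basis $\lambda={}^t(\lambda_1,\dots,\lambda_4)$ such that $\det\Lambda>0$. For $a\in\mathcal{O}$ let $U_a\in M_4(\mathbb{Z})$ be defined by $a\lambda=U_a\lambda$. Let $\eta={}^t(\eta_1,\dots,\eta_4)$ with $\eta_h=\zeta(q+\lambda_h)-\zeta(q)$. Then for every $a\in\mathcal{O}$, $${}^t\widehat\lambda\cdot U_a\cdot\eta=2\pi^2\,\bar a .$$ (For $a=1$ this is ${}^t\widehat\lambda\cdot\eta=2\pi^2$.)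
   Context: $q=t+e_1x_1+e_2x_2+e_3x_3$ ($e_0=1$). $\lambda_h=\sum_{\alpha=0}^3\lambda_h^\alpha e_\alpha$, $\Lambda=(\lambda_h^\alpha)$ (rows $h=1..4$, columns $\alpha=0..3$); $\widehat\lambda_h=\sum_\alpha c_{h\alpha}e_\alpha$ where $c_{h\alpha}$ is the cofactor of the entry $\lambda_h^\alpha$ in $\Lambda$, i.e. $\widehat\lambda=\det(\Lambda)\,{}^t(\Lambda^{-1})\,{}^t(1,e_1,e_2,e_3)$. $G(q)=\bar q/|q|^4$, $G_{(j)}=\partial G/\partial x_j$, $z_j(q)=te_j-x_j$. The Weierstrass $\zeta$-function of $L$ is $\zeta(q)=G(q)+\sum_{\lambda\in L\setminus\{0\}}\big(G(q+\lambda)-G(\lambda)+\sum_{j=1}^3G_{(j)}(\lambda)z_j(q)\big)$ on $\mathbb{H}\setminus L$; it is left- and right-regular, has simple poles on $L$ with residue $1$, and $\zeta(q+\lambda_h)-\zeta(q)$ is independent of $q$. Products ${}^t\widehat\lambda\cdot U_a\cdot\eta=\sum_{i,j}\widehat\lambda_i(U_a)_{ij}\eta_j$. *)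

(* Defs.v *)
From Stdlib Require Import Reals ZArith ClassicalEpsilon.
Open Scope R_scope.

Record quat := mkQ { q0 : R; q1 : R; q2 : R; q3 : R }.

Definition qcomp (a : nat) (x : quat) : R :=
  match a with 0%nat => q0 x | 1%nat => q1 x | 2%nat => q2 x | _ => q3 x end.

Definition qzero : quat := mkQ 0 0 0 0.
Definition qone  : quat := mkQ 1 0 0 0.
Definition qe (a : nat) : quat :=
  match a with
  | 0%nat => mkQ 1 0 0 0 | 1%nat => mkQ 0 1 0 0
  | 2%nat => mkQ 0 0 1 0 | _ => mkQ 0 0 0 1 end.

Definition qadd (x y : quat) : quat :=
  mkQ (q0 x + q0 y) (q1 x + q1 y) (q2 x + q2 y) (q3 x + q3 y).
Definition qopp (x : quat) : quat := mkQ (- q0 x) (- q1 x) (- q2 x) (- q3 x).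
Definition qsub (x y : quat) : quat := qadd x (qopp y).
Definition qscale (r : R) (x : quat) : quat :=
  mkQ (r * q0 x) (r * q1 x) (r * q2 x) (r * q3 x).
(* Hamilton product, e1 e2 = e3, e2 e3 = e1, e3 e1 = e2, e_i^2 = -1 *)
Definition qmul (x y : quat) : quat :=
  mkQ (q0 x * q0 y - q1 x * q1 y - q2 x * q2 y - q3 x * q3 y)
      (q0 x * q1 y + q1 x * q0 y + q2 x * q3 y - q3 x * q2 y)
      (q0 x * q2 y - q1 x * q3 y + q2 x * q0 y + q3 x * q1 y)
      (q0 x * q3 y + q1 x * q2 y - q2 x * q1 y + q3 x * q0 y).
Definition qconj (x : quat) : quat := mkQ (q0 x) (- q1 x) (- q2 x) (- q3 x).
Definition qnorm2 (x : quat) : R := q0 x ^ 2 + q1 x ^ 2 + q2 x ^ 2 + q3 x ^ 2.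

(* f 0 + f 1 + f 2 + f 3 (indices alpha = 0..3, or h = 1..4 shifted to 0..3) *)
Definition qsum4 (f : nat -> quat) : quat :=
  qadd (qadd (qadd (f 0%nat) (f 1%nat)) (f 2%nat)) (f 3%nat).
Fixpoint qsumn (n : nat) (f : nat -> quat) : quat :=
  match n with 0%nat => qzero | S m => qadd (qsumn m f) (f m) end.

Definition lim_seq (u : nat -> R) : R := epsilon (inhabits 0) (fun l => Un_cv u l).
Definition qlim (u : nat -> quat) : quat :=
  mkQ (lim_seq (fun n => q0 (u n))) (lim_seq (fun n => q1 (u n)))
      (lim_seq (fun n => q2 (u n))) (lim_seq (fun n => q3 (u n))).
Definition deriv0 (g : R -> R) : R :=
  epsilon (inhabits 0) (fun l => derivable_pt_lim g 0 l).
Definition qpartial (f : quat -> quat) (j : nat) (q : quat) : quat :=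
  let g := fun k t => qcomp k (f (qadd q (qscale t (qe j)))) in
  mkQ (deriv0 (g 0%nat)) (deriv0 (g 1%nat)) (deriv0 (g 2%nat)) (deriv0 (g 3%nat)).

Definition Gq (q : quat) : quat := qscale (/ (qnorm2 q ^ 2)) (qconj q).
Definition Gj (j : nat) (q : quat) : quat := qpartial Gq j q.
Definition zj (j : nat) (q : quat) : quat :=
  qsub (qscale (q0 q) (qe j)) (qscale (qcomp j q) qone).

Definition latpt (lam : nat -> quat) (n : nat -> Z) : quat :=
  qsum4 (fun i => qscale (IZR (n i)) (lam i)).

Definition zeta_term (q l : quat) : quat :=
  qadd (qsub (Gq (qadd q l)) (Gq l))
       (qadd (qadd (qmul (Gj 1 l) (zj 1 q)) (qmul (Gj 2 l) (zj 2 q)))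
             (qmul (Gj 3 l) (zj 3 q))).

Definition zsum (N : nat) (f : Z -> quat) : quat :=
  qsumn (2 * N + 1) (fun k => f (Z.of_nat k - Z.of_nat N)%Z).

Definition zeta_partial (lam : nat -> quat) (q : quat) (N : nat) : quat :=
  zsum N (fun n1 => zsum N (fun n2 => zsum N (fun n3 => zsum N (fun n4 =>
    if (Z.eqb n1 0 && Z.eqb n2 0 && Z.eqb n3 0 && Z.eqb n4 0)%bool then qzero
    else zeta_term q (latpt lam (fun i => match i with
        0%nat => n1 | 1%nat => n2 | 2%nat => n3 | _ => n4 end)))))).

Definition zeta (lam : nat -> quat) (q : quat) : quat :=
  qadd (Gq q) (qlim (zeta_partial lam q)).

Definition eta (lam : nat -> quat) (q : quat) (h : nat) : quat :=
  qsub (zeta lam (qadd q (lam h))) (zeta lam q).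

Definition Lam (lam : nat -> quat) (h a : nat) : R := qcomp a (lam h).
Definition det3 (M : nat -> nat -> R) : R :=
  M 0%nat 0%nat * (M 1%nat 1%nat * M 2%nat 2%nat - M 1%nat 2%nat * M 2%nat 1%nat)
  - M 0%nat 1%nat * (M 1%nat 0%nat * M 2%nat 2%nat - M 1%nat 2%nat * M 2%nat 0%nat)
  + M 0%nat 2%nat * (M 1%nat 0%nat * M 2%nat 1%nat - M 1%nat 1%nat * M 2%nat 0%nat).
Definition skip (i k : nat) : nat := if Nat.ltb k i then k else S k.
Definition cof4 (M : nat -> nat -> R) (h a : nat) : R :=
  (-1) ^ (h + a) * det3 (fun i j => M (skip h i) (skip a j)).
Definition det4 (M : nat -> nat -> R) : R :=
  M 0%nat 0%nat * cof4 M 0 0 + M 0%nat 1%nat * cof4 M 0 1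
  + M 0%nat 2%nat * cof4 M 0 2 + M 0%nat 3%nat * cof4 M 0 3.
Definition hatlam (lam : nat -> quat) (h : nat) : quat :=
  qsum4 (fun a => qscale (cof4 (Lam lam) h a) (qe a)).

Definition is_rat (x : R) : Prop := exists (p : Z) (d : positive), x = IZR p / IZR (Zpos d).
Definition in_Qspan (d : nat -> quat) (x : quat) : Prop :=
  exists r : nat -> R, (forall i, (i < 4)%nat -> is_rat (r i)) /\
    x = qsum4 (fun i => qscale (r i) (d i)).
Definition in_Zspan (d : nat -> quat) (x : quat) : Prop :=
  exists n : nat -> Z, x = latpt d n.
Definition R_indep (d : nat -> quat) : Prop :=
  forall r : nat -> R, qsum4 (fun i => qscale (r i) (d i)) = qzero ->
    forall i, (i < 4)%nat -> r i = 0.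

(* D subset H is a quaternion algebra over Q with D (x) R = H:
   the Q-span of an R-basis of H, containing 1 and closed under products
   (such D is automatically a definite division algebra). *)
Definition is_definite_quat_alg (D : quat -> Prop) : Prop :=
  (exists d, R_indep d /\ forall x, D x <-> in_Qspan d x) /\
  D qone /\ (forall x y, D x -> D y -> D (qmul x y)).

Definition is_order (D O : quat -> Prop) : Prop :=
  (forall x, O x -> D x) /\ O qone /\
  (forall x y, O x -> O y -> O (qadd x y)) /\ (forall x, O x -> O (qopp x)) /\
  (forall x y, O x -> O y -> O (qmul x y)) /\
  (exists o, (forall x, O x <-> in_Zspan o x) /\ (forall x, D x <-> in_Qspan o x)).

Definition is_maximal_order (D O : quat -> Prop) : Prop :=
  is_order D O /\
  forall O', is_order D O' -> (forall x, O x -> O' x) -> forall x, O' x -> O x.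

(* Main.v *)
(** Left multiplication by [a] has matrix [U] in the basis [lam], so its adjoint, left
    multiplication by [qconj a], has matrix [U^T] in the dual basis [hatlam / det]; this
    factors [qconj a] out of the sum and leaves the case [a = 1].

    For [a = 1], regularity of G gives [sum_h hatlam_h * dG_l(lam_h) = 0], hence
    [sum_h hatlam_h * eta_h] is the absolutely convergent sum over the lattice of
    [sum_h hatlam_h * (G(q + lam_h + l) - G(q + l))].  Summed over a box it telescopes to sums
    of G over the faces.  Over boxes much shorter in the first direction than in the others
    only the two faces [n_1 = N + 1] and [n_1 = - N] matter.  On such a face the lattice is
    recentred so that its base point is orthogonal to the face; the tangential part of G
    then cancels by symmetry, and the normal part is a positive triple sum that converges to
    the integral of [1 / (1 + |u|^2)^2] over R^3, which is [PI^2], computed one variable at a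
    time.  The two faces contribute [2 * PI^2]. *)

Require Import Defs.
From Stdlib Require Import Reals ZArith Lra Lia Psatz ClassicalEpsilon.
From Coquelicot Require Import Coquelicot.
Open Scope R_scope.


(** The value 2 * PI^2 is the volume of the unit 3-sphere: on a hyperplane the normal part of [Gq]
    is the density of solid angle seen from the origin, so a whole hyperplane counts for half the
    sphere whatever its distance. The covolume of the face lattice times its height is the
    determinant, so no trace of the lattice survives. The obstacle is that a single difference of
    [Gq] decays like |l|^(-4), the borderline of summability in rank four, and sums of such
    differences depend on the shape of the boxes; only the combination with [hatlam] gains another
    power. The freedom thus won is spent on sides of order N, N^5, N^6, N^7: the side faces subtend
    a vanishing angle, and each range exceeds, by a factor of order N, the shear that the outer
    indices cause when squares are completed, so that the three sums can be evaluated one inside the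
    other. Summability is measured by the weights (1+|k|)^(-5/4); what they leave over is a power of
    the fourth root of N, hence the common rate [/ rootN N]. *)

(** * Quaternion arithmetic and the Euclidean norm *)

Lemma quat_ext (x y : quat) :
  q0 x = q0 y -> q1 x = q1 y -> q2 x = q2 y -> q3 x = q3 y -> x = y.
Proof. destruct x, y; simpl; intros; subst; reflexivity. Qed.

Ltac qunf := unfold qsum4, qsub, qadd, qopp, qscale, qmul, qconj, qzero, qone in *; cbn [q0 q1 q2 q3] in *.
Ltac qring := intros; apply quat_ext;
  unfold qsum4, qsub, qadd, qopp, qscale, qmul, qconj, qzero, qone; cbn [q0 q1 q2 q3]; ring.

Definition qdot (x y : quat) : R := q0 x * q0 y + q1 x * q1 y + q2 x * q2 y + q3 x * q3 y.
Definition qn (x : quat) : R := sqrt (qnorm2 x).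

Lemma qnorm2_ge0 x : 0 <= qnorm2 x.
Proof. unfold qnorm2; nra. Qed.

Lemma qn_ge0 x : 0 <= qn x.
Proof. apply sqrt_pos. Qed.

Lemma qn_sqr x : qn x ^ 2 = qnorm2 x.
Proof. unfold qn; rewrite pow2_sqrt; auto using qnorm2_ge0. Qed.

Lemma qnorm2_dot x : qnorm2 x = qdot x x.
Proof. unfold qnorm2, qdot; ring. Qed.

Lemma qn_mul x y : qn (qmul x y) = qn x * qn y.
Proof.
  unfold qn; rewrite <- sqrt_mult by apply qnorm2_ge0.
  f_equal; unfold qnorm2; qunf; ring.
Qed.

Lemma qn_conj x : qn (qconj x) = qn x.
Proof. unfold qn; f_equal; unfold qnorm2; qunf; ring. Qed.

Lemma qn_opp x : qn (qopp x) = qn x.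
Proof. unfold qn; f_equal; unfold qnorm2; qunf; ring. Qed.

Lemma qn_scale r x : qn (qscale r x) = Rabs r * qn x.
Proof.
  unfold qn; rewrite <- sqrt_Rsqr_abs, <- sqrt_mult;
    [f_equal; unfold qnorm2, Rsqr; qunf; ring | apply Rle_0_sqr | apply qnorm2_ge0].
Qed.

Lemma qn_zero : qn qzero = 0.
Proof. unfold qn, qnorm2; qunf. replace (_ + _ + _ + _) with 0 by ring. apply sqrt_0. Qed.

Lemma qn_eq0 x : qn x = 0 -> x = qzero.
Proof.
  intros H; assert (H2 := qn_sqr x); rewrite H in H2; unfold qnorm2 in H2.
  apply quat_ext; simpl; nra.
Qed.

Lemma qdot_abs x y : Rabs (qdot x y) <= qn x * qn y.
Proof.
  rewrite <- (Rabs_pos_eq (qn x * qn y)) by (apply Rmult_le_pos; apply qn_ge0).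
  apply Rsqr_le_abs_0. unfold Rsqr.
  replace (qn x * qn y * (qn x * qn y)) with (qn x ^ 2 * qn y ^ 2) by ring.
  rewrite !qn_sqr.
  (* Lagrange's identity: the defect in the Cauchy-Schwarz inequality is the sum of the squared 2x2
     minors. *)
  assert (qnorm2 x * qnorm2 y - qdot x y * qdot x y =
    (q0 x * q1 y - q1 x * q0 y)^2 + (q0 x * q2 y - q2 x * q0 y)^2 + (q0 x * q3 y - q3 x * q0 y)^2
    + (q1 x * q2 y - q2 x * q1 y)^2 + (q1 x * q3 y - q3 x * q1 y)^2 + (q2 x * q3 y - q3 x * q2 y)^2)
    by (unfold qnorm2, qdot; ring).
  assert (Hp := fun a b : nat => pow2_ge_0 (qcomp a x * qcomp b y - qcomp b x * qcomp a y)).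
  assert (H1 := Hp 0%nat 1%nat); assert (H2 := Hp 0%nat 2%nat); assert (H3 := Hp 0%nat 3%nat).
  assert (H4 := Hp 1%nat 2%nat); assert (H5 := Hp 1%nat 3%nat); assert (H6 := Hp 2%nat 3%nat).
  cbn [qcomp] in *; lra.
Qed.

Lemma qnorm2_add x y : qnorm2 (qadd x y) = qnorm2 x + 2 * qdot x y + qnorm2 y.
Proof. unfold qnorm2, qdot; qunf; ring. Qed.

Lemma qn_add x y : qn (qadd x y) <= qn x + qn y.
Proof.
  assert (Hx := qn_ge0 x); assert (Hy := qn_ge0 y).
  apply Rsqr_incr_0_var; [|lra]. unfold Rsqr.
  replace (qn (qadd x y) * qn (qadd x y)) with (qn (qadd x y) ^ 2) by ring.
  rewrite qn_sqr, qnorm2_add, <- !qn_sqr.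
  assert (H := qdot_abs x y). apply Rabs_le_between in H. nra.
Qed.

Lemma qn_sub x y : qn (qsub x y) <= qn x + qn y.
Proof. unfold qsub; rewrite <- (qn_opp y); apply qn_add. Qed.

Lemma qn_sub_sym x y : qn (qsub x y) = qn (qsub y x).
Proof. rewrite <- qn_opp; f_equal; qring. Qed.

Lemma qn_sub_tri x y z : qn (qsub x z) <= qn (qsub x y) + qn (qsub y z).
Proof. replace (qsub x z) with (qadd (qsub x y) (qsub y z)) by qring. apply qn_add. Qed.

Lemma qn_add_lower x y : qn x - qn y <= qn (qadd x y).
Proof.
  assert (H := qn_sub (qadd x y) y).
  replace (qsub (qadd x y) y) with x in H by qring. lra.
Qed.

Lemma qcomp_abs_le x k : Rabs (qcomp k x) <= qn x.
Proof.
  rewrite <- (Rabs_pos_eq (qn x)) by apply qn_ge0.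
  apply Rsqr_le_abs_0. unfold Rsqr.
  replace (qn x * qn x) with (qn x ^ 2) by ring. rewrite qn_sqr; unfold qnorm2.
  destruct k as [|[|[|k]]]; simpl; nra.
Qed.

(** * The kernel and its Taylor expansion *)

(** The differential of [Gq] at [l] in the direction [h]; the second term comes from differentiating
    |l|^(-4). *)
Definition dGq (l h : quat) : quat :=
  qsub (qscale (/ qnorm2 l ^ 2) (qconj h)) (qscale (4 * qdot l h / qnorm2 l ^ 3) (qconj l)).

Lemma deriv0_eq g d : derivable_pt_lim g 0 d -> deriv0 g = d.
Proof.
  intros H; unfold deriv0.
  assert (Hs := epsilon_spec (inhabits 0) (fun l => derivable_pt_lim g 0 l) (ex_intro _ d H)).
  exact (uniqueness_limite _ _ _ _ Hs H).
Qed.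

Lemma Gq_deriv l h k : qnorm2 l <> 0 ->
  derivable_pt_lim (fun t => qcomp k (Gq (qadd l (qscale t h)))) 0 (qcomp k (dGq l h)).
Proof.
  intros Hl; apply is_derive_Reals.
  destruct l as [l0 l1 l2 l3], h as [h0 h1 h2 h3]; unfold dGq, Gq, qdot, qnorm2 in *; qunf.
  assert (HP : ((l0 + 0 * h0) ^ 2 + (l1 + 0 * h1) ^ 2 + (l2 + 0 * h2) ^ 2 + (l3 + 0 * h3) ^ 2) ^ 2 <> 0).
  { apply pow_nonzero. intros H; apply Hl; rewrite <- H; ring. }
  destruct k as [|[|[|k]]]; cbn [qcomp q0 q1 q2 q3]; auto_derive; auto.
  all: try (simpl in HP |- *; rewrite ?Rmult_0_l, ?Rplus_0_r in *; exact HP).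
  all: field_simplify_eq; [| auto].
  all: simpl; try ring.
  all: try (split; auto; intros H; apply Hl; rewrite <- H; ring).
Qed.

Lemma Gj_eq j l : qnorm2 l <> 0 -> Gj j l = dGq l (qe j).
Proof.
  intros Hl; unfold Gj, qpartial.
  rewrite !(deriv0_eq _ _ (Gq_deriv l (qe j) _ Hl)).
  apply quat_ext; reflexivity.
Qed.

(* Right regularity of G turns [sum_j G_(j) z_j] into minus the differential of G. *)
Lemma zeta_term_eq q l : qnorm2 l <> 0 ->
  zeta_term q l = qsub (qsub (Gq (qadd l q)) (Gq l)) (dGq l q).
Proof.
  intros Hl; unfold zeta_term. rewrite !Gj_eq by auto.
  replace (qadd q l) with (qadd l q) by qring.
  replace (qadd (qadd (qmul (dGq l (qe 1)) (zj 1 q)) (qmul (dGq l (qe 2)) (zj 2 q)))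
             (qmul (dGq l (qe 3)) (zj 3 q))) with (qopp (dGq l q)); [reflexivity|].
  assert (HP : qnorm2 l * / qnorm2 l ^ 3 = / qnorm2 l ^ 2) by (field; auto).
  destruct l as [l0 l1 l2 l3], q as [t x1 x2 x3].
  unfold dGq, Rdiv. rewrite <- HP. generalize (/ qnorm2 (mkQ l0 l1 l2 l3) ^ 3); intros w.
  unfold zj, qe, qdot, qnorm2; qunf; cbn [qcomp q0 q1 q2 q3].
  apply quat_ext; cbn [q0 q1 q2 q3]; ring.
Qed.

(** The decay |l|^(-5) is what a rank-four lattice needs for absolute convergence. The condition on
    [h] keeps |l+h|^2 between |l|^2/4 and 9|l|^2/4; the numerical constant is crude. *)
Lemma Gq_taylor l h : 0 < qn l -> 2 * qn h <= qn l ->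
  qn (qsub (qsub (Gq (qadd l h)) (Gq l)) (dGq l h)) <= 700 * qn h ^ 2 / qn l ^ 5.
Proof.
  intros Hl Hh.
  set (P' := qnorm2 (qadd l h)). set (r := qn l) in *. set (e := qn h) in *.
  assert (He : 0 <= e) by apply qn_ge0.
  set (s := qdot l h).
  assert (Hs : - (r * e) <= s <= r * e) by (apply Rabs_le_between, qdot_abs).
  assert (HP : qnorm2 l = r ^ 2) by (symmetry; apply qn_sqr).
  assert (HP' : P' = r ^ 2 + 2 * s + e ^ 2).
  { unfold P'; rewrite qnorm2_add, HP; unfold e; rewrite qn_sqr; reflexivity. }
  assert (HP1 : r ^ 2 / 4 <= P') by (rewrite HP'; nra).
  assert (HP2 : P' <= 9 / 4 * r ^ 2) by (rewrite HP'; nra).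
  assert (Hr2 : 0 < r ^ 2) by (apply pow_lt; auto).
  assert (HP0 : 0 < P') by lra.
  set (d := 2 * s + e ^ 2).
  assert (Hd : Rabs d <= 5 / 2 * (r * e)) by (apply Rabs_le; unfold d; nra).
  assert (HI : / P' ^ 2 <= 16 / r ^ 4).
  { replace (16 / r ^ 4) with (/ (r ^ 2 / 4) ^ 2) by (field; lra).
    apply Rinv_le_contravar; [apply pow_lt; lra | apply pow_incr; lra]. }
  assert (HI0 : 0 < / P' ^ 2) by (apply Rinv_0_lt_compat, pow_lt; lra).
  (* The remainder is an exact combination of [qconj l] and [qconj h]. With [d] = |l+h|^2 - |l|^2
     factored out, [al] is visibly quadratic in [h], and [be] is linear but multiplies [qconj h]. *)
  set (al := d ^ 2 * (2 * P' + r ^ 2) * / P' ^ 2 * / r ^ 6 - 2 * e ^ 2 * / r ^ 6).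
  set (be := - (d * (r ^ 2 + P') * / P' ^ 2 * / r ^ 4)).
  assert (HE : qsub (qsub (Gq (qadd l h)) (Gq l)) (dGq l h)
    = qadd (qscale al (qconj l)) (qscale be (qconj h))).
  { assert (Ha : al = / P' ^ 2 - / (r ^ 2) ^ 2 + 4 * s / (r ^ 2) ^ 3).
    { unfold al, d. rewrite HP'. field. rewrite <- HP'. lra. }
    assert (Hb : be = / P' ^ 2 - / (r ^ 2) ^ 2).
    { unfold be, d. rewrite HP'. field. rewrite <- HP'. lra. }
    rewrite Ha, Hb. unfold Gq, dGq. fold P' s. rewrite HP.
    generalize (/ P' ^ 2) (/ (r ^ 2) ^ 2) (4 * s / (r ^ 2) ^ 3); intros. qring. }
  rewrite HE. eapply Rle_trans; [apply qn_add|].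
  rewrite !qn_scale, !qn_conj. fold r e.
  assert (Hr4 : 0 < / r ^ 4) by (apply Rinv_0_lt_compat, pow_lt; auto).
  assert (Hr6 : 0 < / r ^ 6) by (apply Rinv_0_lt_compat, pow_lt; auto).
  assert (Hd2 : d ^ 2 <= 25 / 4 * (r * e) ^ 2).
  { rewrite <- pow2_abs. replace (25 / 4 * (r * e) ^ 2) with ((5 / 2 * (r * e)) ^ 2) by field.
    apply pow_incr; split; [apply Rabs_pos|auto]. }
  assert (Hal : Rabs al <= 552 * e ^ 2 * / r ^ 6).
  { unfold al. eapply Rle_trans; [apply Rabs_triang|].
    rewrite Rabs_Ropp, !Rabs_pos_eq.
    - assert (d ^ 2 * (2 * P' + r ^ 2) * / P' ^ 2 <= 550 * e ^ 2).
      { replace (550 * e ^ 2) with (25 / 4 * (r * e) ^ 2 * (11 / 2 * r ^ 2) * (16 / r ^ 4)) by (field; lra).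
        apply Rmult_le_compat; try lra.
        - apply Rmult_le_pos; [apply pow2_ge_0|lra].
        - apply Rmult_le_compat; try lra. apply pow2_ge_0. }
      nra.
    - apply Rmult_le_pos; [|lra]. assert (0 <= e^2) by apply pow2_ge_0. lra.
    - assert (0 <= d ^ 2) by apply pow2_ge_0.
      apply Rmult_le_pos; [apply Rmult_le_pos; [apply Rmult_le_pos|]|]; lra. }
  assert (Hbe : Rabs be <= 130 * e * / r ^ 5).
  { unfold be. rewrite Rabs_Ropp, !Rabs_mult, (Rabs_pos_eq (/ r ^ 4)), (Rabs_pos_eq (/ P' ^ 2)), (Rabs_pos_eq (r ^ 2 + P')) by lra.
    replace (130 * e * / r ^ 5) with (5 / 2 * (r * e) * (13 / 4 * r ^ 2) * (16 / r ^ 4) * / r ^ 4) by (field; lra).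
    apply Rmult_le_compat_r; [lra|].
    apply Rmult_le_compat; try lra.
    - apply Rmult_le_pos; [apply Rabs_pos|lra].
    - apply Rmult_le_compat; try lra. apply Rabs_pos. }
  replace (700 * e ^ 2 / r ^ 5) with (570 * e ^ 2 * / r ^ 6 * r + 130 * e * / r ^ 5 * e) by (field; lra).
  apply Rplus_le_compat; apply Rmult_le_compat_r; try lra.
  eapply Rle_trans; [apply Hal|]. apply Rmult_le_compat_r; [lra|]. assert (0 <= e^2) by apply pow2_ge_0. lra.
Qed.

Lemma dGq_bound l h : 0 < qn l -> qn (dGq l h) <= 5 * qn h / qn l ^ 4.
Proof.
  intros Hl; unfold dGq. eapply Rle_trans; [apply qn_sub|].
  rewrite !qn_scale, !qn_conj, <- qn_sqr. set (r := qn l) in *.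
  assert (Hs := qdot_abs l h). fold r in Hs.
  assert (0 < / r ^ 4) by (apply Rinv_0_lt_compat, pow_lt; auto).
  assert (0 < / r ^ 6) by (apply Rinv_0_lt_compat, pow_lt; auto).
  replace (/ (r ^ 2) ^ 2) with (/ r ^ 4) by (field; lra).
  replace (4 * qdot l h / (r ^ 2) ^ 3) with (4 * / r ^ 6 * qdot l h) by (field; lra).
  rewrite Rabs_mult, !Rabs_pos_eq by lra.
  replace (5 * qn h / r ^ 4) with (/ r ^ 4 * qn h + 4 * / r ^ 6 * (r * qn h) * r) by (field; lra).
  apply Rplus_le_compat_l, Rmult_le_compat_r; [lra|]. apply Rmult_le_compat_l; lra.
Qed.

(** Since |h| is at most |l|/2, the quadratic remainder costs at most 350 |h|/|l|^4; the
    differential adds 5 more. *)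
Lemma Gq_lipschitz l h : 0 < qn l -> 2 * qn h <= qn l ->
  qn (qsub (Gq (qadd l h)) (Gq l)) <= 355 * qn h / qn l ^ 4.
Proof.
  intros Hl Hh.
  replace (qsub (Gq (qadd l h)) (Gq l)) with
    (qadd (qsub (qsub (Gq (qadd l h)) (Gq l)) (dGq l h)) (dGq l h)) by qring.
  eapply Rle_trans; [apply qn_add|].
  assert (H1 := Gq_taylor l h Hl Hh). assert (H2 := dGq_bound l h Hl).
  assert (H3 : 700 * qn h ^ 2 / qn l ^ 5 <= 350 * qn h / qn l ^ 4).
  { replace (350 * qn h / qn l ^ 4) with (350 * qn h * qn l / qn l ^ 5) by (field; lra).
    apply Rmult_le_compat_r; [left; apply Rinv_0_lt_compat, pow_lt; auto|].
    assert (0 <= qn h) by apply qn_ge0. nra. }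
  replace (355 * qn h / qn l ^ 4) with (350 * qn h / qn l ^ 4 + 5 * qn h / qn l ^ 4) by (field; lra).
  lra.
Qed.

Lemma qn_Gq l : 0 < qn l -> qn (Gq l) = / qn l ^ 3.
Proof.
  intros H; unfold Gq. rewrite qn_scale, qn_conj, <- qn_sqr, Rabs_pos_eq.
  - field; lra.
  - left; apply Rinv_0_lt_compat, pow_lt, pow_lt; auto.
Qed.


(** * Finite sums over symmetric ranges of integers *)

Fixpoint rsumn (n : nat) (f : nat -> R) : R :=
  match n with 0%nat => 0 | S m => rsumn m f + f m end.
Definition rsum (N : nat) (f : Z -> R) : R :=
  rsumn (2 * N + 1) (fun k => f (Z.of_nat k - Z.of_nat N)%Z).
Definition inbox (N : nat) (k : Z) : Prop := (Z.abs k <= Z.of_nat N)%Z.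

Lemma rsumn_le n f g : (forall k, (k < n)%nat -> f k <= g k) -> rsumn n f <= rsumn n g.
Proof.
  induction n as [|n IH]; simpl; intros H; [lra|].
  assert (f n <= g n) by (apply H; lia).
  assert (rsumn n f <= rsumn n g) by (apply IH; intros; apply H; lia). lra.
Qed.

Lemma rsum_le N f g : (forall k, inbox N k -> f k <= g k) -> rsum N f <= rsum N g.
Proof. intros H; apply rsumn_le; intros k Hk; apply H; unfold inbox; lia. Qed.

Lemma rsum_ext N f g : (forall k, inbox N k -> f k = g k) -> rsum N f = rsum N g.
Proof. intros H; apply Rle_antisym; apply rsum_le; intros k Hk; rewrite (H k Hk); lra. Qed.

Lemma rsum_add N f g : rsum N (fun k => f k + g k) = rsum N f + rsum N g.
Proof. unfold rsum; induction (2 * N + 1)%nat as [|n IH]; simpl; [|rewrite IH]; ring. Qed.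

Lemma rsum_mul N c f : rsum N (fun k => c * f k) = c * rsum N f.
Proof. unfold rsum; induction (2 * N + 1)%nat as [|n IH]; simpl; [|rewrite IH]; ring. Qed.

Lemma rsum_sub N f g : rsum N (fun k => f k - g k) = rsum N f - rsum N g.
Proof. unfold rsum; induction (2 * N + 1)%nat as [|n IH]; simpl; [|rewrite IH]; ring. Qed.

Lemma rsum_const N c : rsum N (fun _ => c) = (2 * INR N + 1) * c.
Proof.
  unfold rsum. replace (2 * INR N + 1) with (INR (2 * N + 1)) by (rewrite plus_INR, mult_INR; simpl; ring).
  induction (2 * N + 1)%nat as [|n IH]; [simpl; ring|]. rewrite S_INR; simpl rsumn; rewrite IH; ring.
Qed.

Lemma rsum_ge0 N f : (forall k, inbox N k -> 0 <= f k) -> 0 <= rsum N f.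
Proof.
  intros H. replace 0 with (rsum N (fun _ => 0)) by (rewrite rsum_const; ring). apply rsum_le; auto.
Qed.

Lemma rsum_abs N f : Rabs (rsum N f) <= rsum N (fun k => Rabs (f k)).
Proof.
  unfold rsum; induction (2 * N + 1)%nat as [|n IH]; simpl.
  - rewrite Rabs_R0; lra.
  - eapply Rle_trans; [apply Rabs_triang|lra].
Qed.

Lemma rsum_tele N F : rsum N (fun k => F (k + 1)%Z - F k) = F (Z.of_nat N + 1)%Z - F (- Z.of_nat N)%Z.
Proof.
  unfold rsum.
  replace (Z.of_nat N + 1)%Z with (Z.of_nat (2 * N + 1) - Z.of_nat N)%Z by lia.
  replace (- Z.of_nat N)%Z with (Z.of_nat 0 - Z.of_nat N)%Z by lia.
  induction (2 * N + 1)%nat as [|n IH]; cbn [rsumn]; [ring|].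
  rewrite IH. replace (Z.of_nat (S n) - Z.of_nat N)%Z with (Z.of_nat n - Z.of_nat N + 1)%Z by lia. ring.
Qed.

Lemma rsum_S N f : rsum (S N) f = rsum N f + f (Z.of_nat (S N)) + f (- Z.of_nat (S N))%Z.
Proof.
  unfold rsum.
  replace (2 * S N + 1)%nat with (S (S (2 * N + 1))) by lia.
  assert (Hh : forall n g, rsumn (S n) g = g 0%nat + rsumn n (fun k => g (S k))).
  { induction n as [|n IH]; intros g; [simpl; ring|].
    change (rsumn (S (S n)) g) with (rsumn (S n) g + g (S n)). rewrite IH. simpl; ring. }
  rewrite Hh. cbn [rsumn].
  replace (Z.of_nat (S (2 * N + 1)) - Z.of_nat (S N))%Z with (Z.of_nat (S N)) by lia.
  replace (Z.of_nat 0 - Z.of_nat (S N))%Z with (- Z.of_nat (S N))%Z by lia.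
  replace (rsumn (2 * N + 1) (fun k => f (Z.of_nat (S k) - Z.of_nat (S N))%Z))
    with (rsumn (2 * N + 1) (fun k => f (Z.of_nat k - Z.of_nat N)%Z)); [ring|].
  apply Rle_antisym; apply rsumn_le; intros k _; right; f_equal; lia.
Qed.

Lemma rsum_term N f k : inbox N k -> (forall k, 0 <= f k) -> f k <= rsum N f.
Proof.
  unfold inbox. intros Hk Hf; induction N as [|N IH].
  - replace k with 0%Z by lia. unfold rsum; simpl. lra.
  - rewrite rsum_S.
    assert (A1 := Hf (Z.of_nat (S N))). assert (A2 := Hf (- Z.of_nat (S N))%Z).
    destruct (Z.eq_dec k (Z.of_nat (S N))) as [->|n1]; [assert (0 <= rsum N f) by (apply rsum_ge0; auto); lra|].
    destruct (Z.eq_dec k (- Z.of_nat (S N))) as [->|n2]; [assert (0 <= rsum N f) by (apply rsum_ge0; auto); lra|].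
    assert (f k <= rsum N f) by (apply IH; lia). lra.
Qed.

Lemma zsum_ext N f g : (forall k, inbox N k -> f k = g k) -> zsum N f = zsum N g.
Proof.
  intros H; unfold zsum.
  assert (Hn : forall n, (n <= 2 * N + 1)%nat ->
    qsumn n (fun k => f (Z.of_nat k - Z.of_nat N)%Z) = qsumn n (fun k => g (Z.of_nat k - Z.of_nat N)%Z)).
  { induction n as [|n IH]; intros Hn; [reflexivity|]. simpl. rewrite IH by lia.
    rewrite H; [reflexivity|]. unfold inbox; lia. }
  apply Hn; lia.
Qed.

Lemma zsum_add N f g : zsum N (fun k => qadd (f k) (g k)) = qadd (zsum N f) (zsum N g).
Proof. unfold zsum; induction (2 * N + 1)%nat as [|n IH]; simpl; [|rewrite IH]; qring. Qed.

Lemma zsum_sub N f g : zsum N (fun k => qsub (f k) (g k)) = qsub (zsum N f) (zsum N g).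
Proof. unfold zsum; induction (2 * N + 1)%nat as [|n IH]; simpl; [|rewrite IH]; qring. Qed.

Lemma zsum_mul N c f : zsum N (fun k => qmul c (f k)) = qmul c (zsum N f).
Proof. unfold zsum; induction (2 * N + 1)%nat as [|n IH]; simpl; [|rewrite IH]; qring. Qed.

Lemma zsum_rscale N c f : zsum N (fun k => qscale (f k) c) = qscale (rsum N f) c.
Proof. unfold zsum, rsum; induction (2 * N + 1)%nat as [|n IH]; simpl; [|rewrite IH]; qring. Qed.

Lemma zsum_tele N F :
  zsum N (fun k => qsub (F (k + 1)%Z) (F k)) = qsub (F (Z.of_nat N + 1)%Z) (F (- Z.of_nat N)%Z).
Proof.
  unfold zsum.
  replace (Z.of_nat N + 1)%Z with (Z.of_nat (2 * N + 1) - Z.of_nat N)%Z by lia.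
  replace (- Z.of_nat N)%Z with (Z.of_nat 0 - Z.of_nat N)%Z by lia.
  induction (2 * N + 1)%nat as [|n IH]; cbn [qsumn]; [qring|].
  rewrite IH. replace (Z.of_nat (S n) - Z.of_nat N)%Z with (Z.of_nat n - Z.of_nat N + 1)%Z by lia. qring.
Qed.

Lemma zsum_S N f : zsum (S N) f = qadd (qadd (zsum N f) (f (Z.of_nat (S N)))) (f (- Z.of_nat (S N))%Z).
Proof.
  unfold zsum.
  replace (2 * S N + 1)%nat with (S (S (2 * N + 1))) by lia.
  assert (Hh : forall n g, qsumn (S n) g = qadd (g 0%nat) (qsumn n (fun k => g (S k)))).
  { induction n as [|n IH]; intros g; [simpl; qring|].
    change (qsumn (S (S n)) g) with (qadd (qsumn (S n) g) (g (S n))). rewrite IH. simpl; qring. }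
  rewrite Hh. cbn [qsumn].
  replace (Z.of_nat (S (2 * N + 1)) - Z.of_nat (S N))%Z with (Z.of_nat (S N)) by lia.
  replace (Z.of_nat 0 - Z.of_nat (S N))%Z with (- Z.of_nat (S N))%Z by lia.
  replace (qsumn (2 * N + 1) (fun k => f (Z.of_nat (S k) - Z.of_nat (S N))%Z))
    with (qsumn (2 * N + 1) (fun k => f (Z.of_nat k - Z.of_nat N)%Z)); [qring|].
  induction (2 * N + 1)%nat as [|n IH]; [reflexivity|]. cbn [qsumn]. rewrite IH.
  replace (Z.of_nat (S n) - Z.of_nat (S N))%Z with (Z.of_nat n - Z.of_nat N)%Z by lia. reflexivity.
Qed.

Lemma zsum_reflect N f : zsum N (fun k => f (- k)%Z) = zsum N f.
Proof.
  induction N as [|N IH]; [reflexivity|]. rewrite !zsum_S, IH, Z.opp_involutive. qring.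
Qed.

Lemma zsum_norm N f g : (forall k, inbox N k -> qn (f k) <= g k) -> qn (zsum N f) <= rsum N g.
Proof.
  intros H; unfold zsum, rsum.
  assert (Hn : forall n, (n <= 2 * N + 1)%nat ->
    qn (qsumn n (fun k => f (Z.of_nat k - Z.of_nat N)%Z)) <= rsumn n (fun k => g (Z.of_nat k - Z.of_nat N)%Z)).
  { induction n as [|n IH]; intros Hn; simpl; [rewrite qn_zero; lra|].
    eapply Rle_trans; [apply qn_add|]. apply Rplus_le_compat; [apply IH; lia|]. apply H; unfold inbox; lia. }
  apply Hn; lia.
Qed.

Lemma zsum_bound N f c : (forall k, inbox N k -> qn (f k) <= c) -> qn (zsum N f) <= (2 * INR N + 1) * c.
Proof. intros H; rewrite <- rsum_const; apply zsum_norm; auto. Qed.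

Lemma zsum_diff0 N f g : (forall k, k <> 0%Z -> f k = g k) ->
  qsub (zsum N f) (zsum N g) = qsub (f 0%Z) (g 0%Z).
Proof.
  intros H; induction N as [|N IH].
  - unfold zsum; simpl. qring.
  - rewrite !zsum_S, !(H (Z.of_nat (S N))), !(H (- Z.of_nat (S N))%Z) by lia.
    rewrite <- IH. qring.
Qed.

(** The bound is kept as a difference of majorants so that it can be nested: the conclusion for an
    inner sum has the shape of the hypothesis on [a k - b k] for the next outer one. *)
Lemma zsum_dominated_diff N K F G a b : (K <= N)%nat ->
  (forall k, qn (F k) <= a k) -> (forall k, qn (qsub (F k) (G k)) <= a k - b k) ->
  qn (qsub (zsum N F) (zsum K G)) <= rsum N a - rsum K b.
Proof.
  intros H Ha Hb; induction H as [|N H IH].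
  - rewrite <- zsum_sub, <- rsum_sub. apply zsum_norm; auto.
  - rewrite zsum_S, rsum_S.
    replace (qsub _ _) with (qadd (qadd (qsub (zsum N F) (zsum K G)) (F (Z.of_nat (S N)))) (F (- Z.of_nat (S N))%Z)) by qring.
    eapply Rle_trans; [apply qn_add|]. assert (H1 := qn_add (qsub (zsum N F) (zsum K G)) (F (Z.of_nat (S N)))).
    assert (H2 := Ha (Z.of_nat (S N))). assert (H3 := Ha (- Z.of_nat (S N))%Z). lra.
Qed.

(** A shift by one telescopes to two boundary values, so a shift by [z] costs 2 [z] values, all
    within distance [z] of the boundary or beyond it. *)
Lemma zsum_shift_nat N f z B :
  (forall k, (Z.of_nat N - Z.of_nat z <= Z.abs k)%Z -> qn (f k) <= B) ->
  qn (qsub (zsum N (fun k => f (k + Z.of_nat z)%Z)) (zsum N f)) <= 2 * INR z * B.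
Proof.
  revert f; induction z as [|z IH]; intros f H.
  - replace (zsum N (fun k => f (k + Z.of_nat 0)%Z)) with (zsum N f).
    + replace (qsub _ _) with qzero by qring. rewrite qn_zero; simpl; lra.
    + apply zsum_ext; intros; f_equal; lia.
  - replace (zsum N (fun k => f (k + Z.of_nat (S z))%Z)) with
      (zsum N (fun k => (fun j => f (j + Z.of_nat z)%Z) (k + 1)%Z))
      by (apply zsum_ext; intros; f_equal; lia).
    replace (qsub _ _) with (qadd (qsub (zsum N (fun k => (fun j => f (j + Z.of_nat z)%Z) (k + 1)%Z)) (zsum N (fun j => f (j + Z.of_nat z)%Z)))
       (qsub (zsum N (fun j => f (j + Z.of_nat z)%Z)) (zsum N f))) by qring.
    rewrite <- zsum_sub, (zsum_tele N (fun j => f (j + Z.of_nat z)%Z)).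
    eapply Rle_trans; [apply qn_add|].
    assert (H1 := IH f). rewrite S_INR.
    assert (H2 := qn_sub (f (Z.of_nat N + 1 + Z.of_nat z)%Z) (f (- Z.of_nat N + Z.of_nat z)%Z)).
    assert (qn (f (Z.of_nat N + 1 + Z.of_nat z)%Z) <= B) by (apply H; lia).
    assert (qn (f (- Z.of_nat N + Z.of_nat z)%Z) <= B) by (apply H; lia).
    assert (H5 : forall k, (Z.of_nat N - Z.of_nat z <= Z.abs k)%Z -> qn (f k) <= B) by (intros; apply H; lia).
    specialize (H1 H5). lra.
Qed.

Lemma zsum_shift N f z B :
  (forall k, (Z.of_nat N - Z.abs z <= Z.abs k)%Z -> qn (f k) <= B) ->
  qn (qsub (zsum N (fun k => f (k + z)%Z)) (zsum N f)) <= 2 * IZR (Z.abs z) * B.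
Proof.
  intros H. assert (HI : IZR (Z.abs z) = INR (Z.abs_nat z)) by (rewrite INR_IZR_INZ, Nat2Z.inj_abs_nat; auto).
  rewrite HI. destruct (Z_le_gt_dec 0 z) as [Hz|Hz].
  - replace (zsum N (fun k => f (k + z)%Z)) with (zsum N (fun k => f (k + Z.of_nat (Z.abs_nat z))%Z))
      by (apply zsum_ext; intros; f_equal; lia).
    apply zsum_shift_nat; intros; apply H; lia.
  (* Reflecting both sums turns the negative shift into a positive one. *)
  - rewrite <- (zsum_reflect N f), <- (zsum_reflect N (fun k => f (k + z)%Z)).
    replace (zsum N (fun k => f (- k + z)%Z)) with (zsum N (fun k => (fun j => f (- j)%Z) (k + Z.of_nat (Z.abs_nat z))%Z))
      by (apply zsum_ext; intros; f_equal; lia).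
    apply (zsum_shift_nat N (fun j => f (- j)%Z)); intros; apply H; lia.
Qed.


(** * Absolutely convergent sums over boxes *)

(** Nested square roots let the exponent 5/4 be handled through integer powers, within reach of
    [field] and the lemmas on [pow]. *)
Definition root4 (k : Z) : R := sqrt (sqrt (1 + IZR (Z.abs k))).
(* wt k = (1+|k|)^(-5/4): summable, and a product of four of them dominates |n|^(-5). *)
Definition wt (k : Z) : R := / root4 k ^ 5.

Lemma root4_ge1 k : 1 <= root4 k.
Proof.
  unfold root4. rewrite <- sqrt_1 at 1. apply sqrt_le_1_alt.
  rewrite <- sqrt_1 at 1. apply sqrt_le_1_alt.
  assert (0 <= IZR (Z.abs k)) by (apply IZR_le; lia). lra.
Qed.

Lemma root4_pow4 k : root4 k ^ 4 = 1 + IZR (Z.abs k).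
Proof.
  unfold root4. assert (0 <= IZR (Z.abs k)) by (apply IZR_le; lia).
  replace 4%nat with (2 * 2)%nat by lia. rewrite pow_mult, !pow2_sqrt; auto; try lra. apply sqrt_pos.
Qed.

Lemma wt_pos k : 0 < wt k.
Proof. apply Rinv_0_lt_compat, pow_lt. assert (H := root4_ge1 k); lra. Qed.

Lemma wt_opp k : wt (- k) = wt k.
Proof. unfold wt, root4. rewrite Z.abs_opp; auto. Qed.

(** Discrete form of the fact that -4 x^(-1/4) is a primitive of x^(-5/4). With a^4 and b^4
    consecutive, 1 = b^4 - a^4 is b - a times a cubic form that is at most 4 b^3. *)
Lemma wt_succ N :
  wt (Z.of_nat (S N)) <= 4 * (/ root4 (Z.of_nat N) - / root4 (Z.of_nat (S N))).
Proof.
  unfold wt. set (a := root4 (Z.of_nat N)). set (b := root4 (Z.of_nat (S N))).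
  assert (Ha : 1 <= a) by apply root4_ge1. assert (Hb : 1 <= b) by apply root4_ge1.
  assert (Hab : b ^ 4 = a ^ 4 + 1).
  { unfold a, b. rewrite !root4_pow4, !Z.abs_eq by lia.
    rewrite Nat2Z.inj_succ, succ_IZR. ring. }
  assert (a <= b) by (apply Rnot_lt_le; intros H; assert (b ^ 4 <= a ^ 4) by (apply pow_incr; lra); lra).
  assert (H1 : 1 <= (b - a) * (4 * b ^ 3)).
  { replace 1 with ((b - a) * (b ^ 3 + b ^ 2 * a + b * a ^ 2 + a ^ 3)) by (ring_simplify; lra).
    apply Rmult_le_compat_l; [lra|].
    assert (a ^ 3 <= b ^ 3) by (apply pow_incr; lra).
    assert (a ^ 2 <= b ^ 2) by (apply pow_incr; lra).
    assert (b ^ 2 * a <= b ^ 3) by (replace (b ^ 3) with (b ^ 2 * b) by ring; apply Rmult_le_compat_l; nra).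
    assert (b * a ^ 2 <= b ^ 3) by (replace (b ^ 3) with (b * b ^ 2) by ring; apply Rmult_le_compat_l; lra).
    lra. }
  assert (Hb5 : 0 < b ^ 5) by (apply pow_lt; lra).
  replace (4 * (/ a - / b)) with (4 * (b - a) * b ^ 4 * / (a * b ^ 5)) by (field; lra).
  assert (Hab5 : 0 < a * b ^ 5) by (apply Rmult_lt_0_compat; lra).
  replace (/ b ^ 5) with (a * / (a * b ^ 5)) by (field; lra).
  apply Rmult_le_compat_r; [left; apply Rinv_0_lt_compat; auto|].
  nra.
Qed.

Definition wsum (N : nat) : R := rsum N wt.
Definition rootN (N : nat) : R := root4 (Z.of_nat N).

Lemma rootN_ge1 N : 1 <= rootN N.
Proof. apply root4_ge1. Qed.

Lemma wsum_tail N K : (K <= N)%nat -> wsum N - wsum K <= 8 * (/ rootN K - / rootN N).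
Proof.
  intros H; induction H as [|N H IH]; [lra|].
  unfold wsum in *. rewrite rsum_S, wt_opp. assert (H1 := wt_succ N). unfold rootN in *. lra.
Qed.

(** The central term contributes 1, and the two tails, each bounded by 4, contribute 8. This 9
    recurs in the later constants, once for each index summed. *)
Lemma wsum_bound N : wsum N <= 9.
Proof.
  assert (H := wsum_tail N 0 ltac:(lia)).
  replace (wsum 0) with 1 in H.
  - replace (rootN 0) with 1 in H.
    + assert (0 < / rootN N) by (apply Rinv_0_lt_compat; assert (H1 := rootN_ge1 N); lra). lra.
    + unfold rootN, root4; simpl. replace (1 + 0) with 1 by ring. rewrite !sqrt_1; auto.
  - unfold wsum, rsum, wt, root4; simpl. replace (1 + 0) with 1 by ring. rewrite !sqrt_1; field.
Qed.

Lemma wsum_ge0 N : 0 <= wsum N.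
Proof. apply rsum_ge0; intros; left; apply wt_pos. Qed.

Definition box3 (N2 N3 N4 : nat) (f : Z -> Z -> Z -> quat) : quat :=
  zsum N2 (fun n2 => zsum N3 (fun n3 => zsum N4 (fun n4 => f n2 n3 n4))).
Definition box4 (N1 N2 N3 N4 : nat) (f : Z -> Z -> Z -> Z -> quat) : quat :=
  zsum N1 (fun n1 => box3 N2 N3 N4 (f n1)).

Lemma zsum_wt_norm N F a : (forall k, qn (F k) <= wt k * a) -> qn (zsum N F) <= wsum N * a.
Proof.
  intros H. replace (wsum N * a) with (rsum N (fun k => wt k * a)); [apply zsum_norm; auto|].
  rewrite (rsum_ext _ _ (fun k => a * wt k)) by (intros; ring). rewrite rsum_mul; unfold wsum; ring.
Qed.

Lemma zsum_wt_diff N K F G a b : (K <= N)%nat ->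
  (forall k, qn (F k) <= wt k * a) -> (forall k, qn (qsub (F k) (G k)) <= wt k * (a - b)) ->
  qn (qsub (zsum N F) (zsum K G)) <= wsum N * a - wsum K * b.
Proof.
  intros HK Ha Hb.
  replace (wsum N * a - wsum K * b) with (rsum N (fun k => a * wt k) - rsum K (fun k => b * wt k))
    by (rewrite !rsum_mul; unfold wsum; ring).
  apply zsum_dominated_diff; auto; intros k; [rewrite Rmult_comm; auto|].
  eapply Rle_trans; [apply Hb|]. right; ring.
Qed.

(** Working substitute for absolute convergence: the error depends only on the cube contained in the
    box, not on the proportions of the box. It gives both the Cauchy property of the cubes and the
    passage to elongated boxes. *)
Lemma box4_tail f C : 
  (forall n1 n2 n3 n4, qn (f n1 n2 n3 n4) <= wt n1 * (wt n2 * (wt n3 * (wt n4 * C)))) ->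
  exists C', 0 <= C' /\ forall K N1 N2 N3 N4, (K <= N1)%nat -> (K <= N2)%nat -> (K <= N3)%nat -> (K <= N4)%nat ->
    qn (qsub (box4 N1 N2 N3 N4 f) (box4 K K K K f)) <= C' / rootN K.
Proof.
  intros Hf.
  assert (HC : 0 <= C).
  { specialize (Hf 0%Z 0%Z 0%Z 0%Z). eapply Rle_trans in Hf; [|apply qn_ge0].
    assert (w := wt_pos 0). 
    apply Rnot_lt_le; intros HC. assert (0 < wt 0 * (wt 0 * (wt 0 * wt 0))) by (repeat apply Rmult_lt_0_compat; auto).
    nra. }
  exists (C * (8 * (4 * 9 ^ 3))). split; [apply Rmult_le_pos; lra|].
  intros K N1 N2 N3 N4 H1 H2 H3 H4.
  set (s := wsum K).
  assert (HD : qn (qsub (box4 N1 N2 N3 N4 f) (box4 K K K K f)) <=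
     wsum N1 * (wsum N2 * (wsum N3 * (wsum N4 * C))) - s * (s * (s * (s * C)))).
  { unfold box4, box3.
    assert (E0 : forall n1 n2 n3, qn (zsum N4 (fun n4 => f n1 n2 n3 n4)) <= wt n1 * (wt n2 * (wt n3 * (wsum N4 * C)))).
    { intros. eapply Rle_trans; [apply zsum_wt_norm with (a := wt n1 * (wt n2 * (wt n3 * C)))|right; ring].
      intros n4; eapply Rle_trans; [apply Hf|right; ring]. }
    assert (E1 : forall n1 n2, qn (zsum N3 (fun n3 => zsum N4 (fun n4 => f n1 n2 n3 n4))) <= wt n1 * (wt n2 * (wsum N3 * (wsum N4 * C)))).
    { intros. eapply Rle_trans; [apply zsum_wt_norm with (a := wt n1 * (wt n2 * (wsum N4 * C)))|right; ring].
      intros n3; eapply Rle_trans; [apply E0|right; ring]. }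
    assert (E2 : forall n1, qn (zsum N2 (fun n2 => zsum N3 (fun n3 => zsum N4 (fun n4 => f n1 n2 n3 n4)))) <= wt n1 * (wsum N2 * (wsum N3 * (wsum N4 * C)))).
    { intros. eapply Rle_trans; [apply zsum_wt_norm with (a := wt n1 * (wsum N3 * (wsum N4 * C)))|right; ring].
      intros n3; eapply Rle_trans; [apply E1|right; ring]. }
    apply zsum_wt_diff; auto. intros n1.
    eapply Rle_trans; [apply zsum_wt_diff with (a := wt n1 * (wsum N3 * (wsum N4 * C))) (b := wt n1 * (s * (s * C)))|unfold s; right; ring]; auto.
    { intros; eapply Rle_trans; [apply E1|right; ring]. } intros n2.
    eapply Rle_trans; [apply zsum_wt_diff with (a := wt n1 * (wt n2 * (wsum N4 * C))) (b := wt n1 * (wt n2 * (s * C)))|unfold s; right; ring]; auto.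
    { intros; eapply Rle_trans; [apply E0|right; ring]. } intros n3.
    eapply Rle_trans; [apply zsum_wt_diff with (a := wt n1 * (wt n2 * (wt n3 * C))) (b := wt n1 * (wt n2 * (wt n3 * C)))|unfold s; right; ring]; auto.
    { intros; eapply Rle_trans; [apply Hf|right; ring]. } intros n4.
    replace (qsub _ _) with qzero by qring. rewrite qn_zero; right; ring. }
  eapply Rle_trans; [apply HD|]. clear HD.
  set (y := s + 8 * / rootN K). 
  (* All four weight sums lie below [z]. The cap 9 bounds the cubic cofactor in z^4 - s^4, while z
     <= y gives z - s <= 8 / [rootN K]. *)
  set (z := Rmin y 9).
  assert (Hs0 : 0 <= s) by apply wsum_ge0.
  assert (Hs9 : s <= 9) by apply wsum_bound.
  assert (Hr : 0 < / rootN K) by (apply Rinv_0_lt_compat; assert (H := rootN_ge1 K); lra).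
  assert (Hz : forall N, (K <= N)%nat -> 0 <= wsum N <= z).
  { intros N HN; split; [apply wsum_ge0|]. apply Rmin_glb; [|apply wsum_bound].
    assert (H := wsum_tail N K HN). unfold y, s.
    assert (0 < / rootN N) by (apply Rinv_0_lt_compat; assert (HH := rootN_ge1 N); lra). lra. }
  assert (Hz9 : z <= 9) by apply Rmin_r. assert (Hzy : z <= y) by apply Rmin_l.
  assert (Hsz : s <= z) by (apply Hz; lia).
  assert (HP : wsum N1 * (wsum N2 * (wsum N3 * (wsum N4 * C))) <= z * (z * (z * (z * C)))).
  { assert (A4 := Hz _ H4). assert (A3 := Hz _ H3). assert (A2 := Hz _ H2). assert (A1 := Hz _ H1).
    repeat (apply Rmult_le_compat; try lra; repeat (apply Rmult_le_pos; try lra)). }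
  assert (HQ : z * (z * (z * z)) - s * (s * (s * s)) <= (z - s) * (4 * 9 ^ 3)).
  { replace (z * (z * (z * z)) - s * (s * (s * s))) with ((z - s) * (z ^ 3 + z ^ 2 * s + z * s ^ 2 + s ^ 3)) by ring.
    apply Rmult_le_compat_l; [lra|].
    assert (z ^ 3 <= 9 ^ 3) by (apply pow_incr; lra).
    assert (s ^ 3 <= 9 ^ 3) by (apply pow_incr; lra).
    assert (z ^ 2 * s <= 9 ^ 2 * 9) by (apply Rmult_le_compat; try lra; [apply pow2_ge_0|apply pow_incr; lra]).
    assert (z * s ^ 2 <= 9 * 9 ^ 2) by (apply Rmult_le_compat; try lra; [apply pow2_ge_0|apply pow_incr; lra]).
    lra. }
  assert (HZ : z - s <= 8 * / rootN K) by (unfold y in Hzy; lra).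
  assert (HQ2 : (z - s) * (4 * 9 ^ 3) <= 8 * / rootN K * (4 * 9 ^ 3)) by (apply Rmult_le_compat_r; lra).
  replace (C * (8 * (4 * 9 ^ 3)) / rootN K) with (C * (8 * / rootN K * (4 * 9 ^ 3))) by (unfold Rdiv; ring).
  assert (C * (z * (z * (z * z)) - s * (s * (s * s))) <= C * (8 * / rootN K * (4 * 9 ^ 3))) by (apply Rmult_le_compat_l; lra).
  lra.
Qed.

(** * Limits *)

(** An eventual bound at one fixed rate, closed under addition: errors from different sources can be
    added without carrying their constants and thresholds along. *)
Definition small (e : nat -> R) : Prop :=
  exists C N0, 0 <= C /\ forall N, (N0 <= N)%nat -> e N <= C / rootN N.
Definition Qcv (u : nat -> quat) (l : quat) : Prop :=
  forall eps, 0 < eps -> exists N0, forall N, (N0 <= N)%nat -> qn (qsub (u N) l) < eps.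

Lemma rootN_big x : exists N0, forall N, (N0 <= N)%nat -> x <= rootN N.
Proof.
  destruct (INR_unbounded (x ^ 4)) as [N0 H]. exists N0. intros N HN.
  destruct (Rle_or_lt x 0) as [Hx|Hx]; [assert (H1 := rootN_ge1 N); lra|].
  apply Rnot_lt_le; intros Hlt. assert (H1 := rootN_ge1 N).
  assert (H2 : rootN N ^ 4 <= x ^ 4) by (apply pow_incr; lra).
  unfold rootN in H2; rewrite root4_pow4, Z.abs_eq, <- INR_IZR_INZ in H2 by lia.
  apply le_INR in HN. lra.
Qed.

Lemma small_lt e eps : small e -> 0 < eps -> exists N0, forall N, (N0 <= N)%nat -> e N < eps.
Proof.
  intros (C & N0 & HC & H) He. destruct (rootN_big (2 * (C + 1) / eps)) as [N1 H1].
  exists (Nat.max N0 N1). intros N HN. eapply Rle_lt_trans; [apply H; lia|].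
  assert (H2 := H1 N ltac:(lia)). assert (H3 := rootN_ge1 N).
  apply Rmult_lt_reg_r with (rootN N); [lra|]. unfold Rdiv; rewrite Rmult_assoc, Rinv_l, Rmult_1_r by lra.
  apply (Rmult_le_compat_l eps) in H2; [|lra].
  replace (eps * (2 * (C + 1) / eps)) with (2 * (C + 1)) in H2 by (field; lra). lra.
Qed.

Lemma small_le e f : small f -> (exists N0, forall N, (N0 <= N)%nat -> e N <= f N) -> small e.
Proof.
  intros (C & N0 & HC & H) (N1 & H1). exists C, (Nat.max N0 N1). split; auto.
  intros N HN. eapply Rle_trans; [apply H1|apply H]; lia.
Qed.

Lemma small_add e f : small e -> small f -> small (fun N => e N + f N).
Proof.
  intros (C & N0 & HC & H) (D & N1 & HD & H1). exists (C + D), (Nat.max N0 N1). split; [lra|].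
  intros N HN. unfold Rdiv. rewrite Rmult_plus_distr_r. apply Rplus_le_compat; [apply H|apply H1]; lia.
Qed.

Lemma small_root C : 0 <= C -> small (fun N => C / rootN N).
Proof. intros HC; exists C, 0%nat; split; auto; intros; lra. Qed.

Lemma small_inv C : 0 <= C -> small (fun N => C / INR N).
Proof.
  intros HC; exists (C * 2), 1%nat; split; [lra|]. intros N HN.
  unfold Rdiv; rewrite Rmult_assoc. apply Rmult_le_compat_l; auto.
  apply le_INR in HN; simpl in HN. assert (H := rootN_ge1 N).
  assert (H4 : rootN N ^ 4 = 1 + INR N).
  { unfold rootN; rewrite root4_pow4, Z.abs_eq, <- INR_IZR_INZ by lia; auto. }
  assert (rootN N <= 2 * INR N).
  { assert (rootN N <= rootN N ^ 4); [|lra]. 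
    rewrite <- (pow_1 (rootN N)) at 1. apply Rle_pow; auto; lia. }
  apply Rmult_le_reg_l with (rootN N * INR N); [nra|]. 
  replace (rootN N * INR N * / INR N) with (rootN N) by (field; lra).
  replace (rootN N * INR N * (2 * / rootN N)) with (2 * INR N) by (field; lra). lra.
Qed.

Lemma Qcv_unique u l m : Qcv u l -> Qcv u m -> l = m.
Proof.
  intros Hl Hm. assert (H0 : qn (qsub l m) = 0).
  { apply Rle_antisym; [|apply qn_ge0]. apply Rnot_lt_le; intros H.
    destruct (Hl (qn (qsub l m) / 2)) as [N1 H1]; [lra|].
    destruct (Hm (qn (qsub l m) / 2)) as [N2 H2]; [lra|].
    specialize (H1 (Nat.max N1 N2) ltac:(lia)). specialize (H2 (Nat.max N1 N2) ltac:(lia)).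
    rewrite qn_sub_sym in H1. assert (H3 := qn_sub_tri l (u (Nat.max N1 N2)) m). lra. }
  apply qn_eq0 in H0. replace l with (qadd (qsub l m) m) by qring. rewrite H0; qring.
Qed.

Lemma Qcv_sub u v l m : Qcv u l -> Qcv v m -> Qcv (fun N => qsub (u N) (v N)) (qsub l m).
Proof.
  intros Hl Hm eps He. destruct (Hl (eps / 2)) as [N1 H1]; [lra|].
  destruct (Hm (eps / 2)) as [N2 H2]; [lra|].
  exists (Nat.max N1 N2). intros N HN. specialize (H1 N ltac:(lia)). specialize (H2 N ltac:(lia)).
  replace (qsub _ _) with (qsub (qsub (u N) l) (qsub (v N) m)) by qring.
  eapply Rle_lt_trans; [apply qn_sub|lra].
Qed.

Lemma Qcv_const l : Qcv (fun _ => l) l.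
Proof. intros eps He; exists 0%nat; intros. replace (qsub l l) with qzero by qring. rewrite qn_zero; auto. Qed.

Lemma Qcv_add u v l m : Qcv u l -> Qcv v m -> Qcv (fun N => qadd (u N) (v N)) (qadd l m).
Proof.
  intros Hl Hm eps He. destruct (Qcv_sub _ _ _ _ Hl (Qcv_sub _ _ _ _ (Qcv_const qzero) Hm) eps He) as [N0 H].
  exists N0. intros N HN. specialize (H N HN). 
  replace (qsub (qadd (u N) (v N)) (qadd l m)) with
    (qsub (qsub (u N) (qsub qzero (v N))) (qsub l (qsub qzero m))) by qring. auto.
Qed.

Lemma Qcv_mul c u l : Qcv u l -> Qcv (fun N => qmul c (u N)) (qmul c l).
Proof.
  intros Hl eps He. assert (Hc := qn_ge0 c). destruct (Hl (eps / (qn c + 1))) as [N0 H].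
  { apply Rdiv_lt_0_compat; lra. }
  exists N0. intros N HN. specialize (H N HN).
  replace (qsub _ _) with (qmul c (qsub (u N) l)) by qring. rewrite qn_mul.
  apply Rle_lt_trans with ((qn c) * (eps / (qn c + 1))); [apply Rmult_le_compat_l; lra|].
  apply Rmult_lt_reg_r with (qn c + 1); [lra|]. unfold Rdiv. rewrite !Rmult_assoc, Rinv_l by lra. nra.
Qed.

Lemma Qcv_small u v l : Qcv u l -> small (fun N => qn (qsub (u N) (v N))) -> Qcv v l.
Proof.
  intros Hl Hs eps He. destruct (Hl (eps / 2)) as [N1 H1]; [lra|].
  destruct (small_lt _ (eps / 2) Hs) as [N2 H2]; [lra|].
  exists (Nat.max N1 N2). intros N HN. specialize (H1 N ltac:(lia)). specialize (H2 N ltac:(lia)).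
  cbv beta in H2. rewrite qn_sub_sym in H2. assert (H3 := qn_sub_tri (v N) (u N) l). lra.
Qed.

Lemma Qcv_comp u l : Qcv u l -> forall k, Un_cv (fun N => qcomp k (u N)) (qcomp k l).
Proof.
  intros H k eps He. destruct (H eps He) as [N0 H0]. exists N0. intros N HN.
  unfold Rdist. replace (qcomp k (u N) - qcomp k l) with (qcomp k (qsub (u N) l)).
  - eapply Rle_lt_trans; [apply qcomp_abs_le|apply H0; lia].
  - destruct k as [|[|[|k]]]; qunf; simpl; ring.
Qed.

Lemma lim_seq_eq u l : Un_cv u l -> lim_seq u = l.
Proof.
  intros H. assert (Hs := epsilon_spec (inhabits 0) (fun l => Un_cv u l) (ex_intro _ l H)).
  exact (UL_sequence _ _ _ Hs H).
Qed.

Lemma qlim_eq u l : Qcv u l -> qlim u = l.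
Proof.
  intros H. assert (Hc := Qcv_comp u l H). unfold qlim.
  apply quat_ext; cbn [q0 q1 q2 q3]; apply lim_seq_eq; [apply (Hc 0%nat)|apply (Hc 1%nat)|apply (Hc 2%nat)|apply (Hc 3%nat)].
Qed.

Lemma Qcv_cauchy u C : 0 <= C -> (forall K N, (K <= N)%nat -> qn (qsub (u N) (u K)) <= C / rootN K) ->
  exists l, Qcv u l.
Proof.
  intros HC H.
  assert (Hk : forall k, exists l, Un_cv (fun N => qcomp k (u N)) l).
  { intros k.
    assert (Hcc : Cauchy_crit (fun N => qcomp k (u N))).
    { intros eps He. destruct (small_lt _ (eps / 2) (small_root C HC)) as [N0 H0]; [lra|].
      exists N0. intros n m Hn Hm. unfold Rdist.
      replace (qcomp k (u n) - qcomp k (u m)) with (qcomp k (qsub (qsub (u n) (u N0)) (qsub (u m) (u N0))))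
        by (destruct k as [|[|[|k]]]; qunf; simpl; ring).
      eapply Rle_lt_trans; [apply qcomp_abs_le|]. eapply Rle_lt_trans; [apply qn_sub|].
      assert (H1 := H N0 n ltac:(lia)). assert (H2 := H N0 m ltac:(lia)). assert (H3 := H0 N0 ltac:(lia)).
      cbv beta in H3. lra. }
    destruct (Rcomplete.R_complete _ Hcc) as [l Hl]; eauto. }
  destruct (Hk 0%nat) as [l0 H0], (Hk 1%nat) as [l1 H1], (Hk 2%nat) as [l2 H2], (Hk 3%nat) as [l3 H3].
  exists (mkQ l0 l1 l2 l3). intros eps He.
  destruct (H0 (eps / 4)) as [N0 K0]; [lra|]. destruct (H1 (eps / 4)) as [N1 K1]; [lra|].
  destruct (H2 (eps / 4)) as [N2 K2]; [lra|]. destruct (H3 (eps / 4)) as [N3 K3]; [lra|].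
  exists (Nat.max (Nat.max N0 N1) (Nat.max N2 N3)). intros N HN.
  specialize (K0 N ltac:(lia)). specialize (K1 N ltac:(lia)). specialize (K2 N ltac:(lia)). specialize (K3 N ltac:(lia)).
  unfold Rdist in *. simpl qcomp in *.
  eapply Rle_lt_trans with (Rabs (q0 (u N) - l0) + Rabs (q1 (u N) - l1) + Rabs (q2 (u N) - l2) + Rabs (q3 (u N) - l3)); [|lra].
  apply Rsqr_incr_0_var; [|repeat apply Rplus_le_le_0_compat; apply Rabs_pos].
  replace (Rsqr (qn (qsub (u N) (mkQ l0 l1 l2 l3)))) with (qn (qsub (u N) (mkQ l0 l1 l2 l3)) ^ 2) by (unfold Rsqr; ring).
  rewrite qn_sqr. unfold qnorm2; qunf. unfold Rsqr.
  rewrite <- (pow2_abs (q0 (u N) + - l0)), <- (pow2_abs (q1 (u N) + - l1)), <- (pow2_abs (q2 (u N) + - l2)), <- (pow2_abs (q3 (u N) + - l3)).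
  fold (q0 (u N) - l0) (q1 (u N) - l1) (q2 (u N) - l2) (q3 (u N) - l3).
  assert (P0 := Rabs_pos (q0 (u N) - l0)). assert (P1 := Rabs_pos (q1 (u N) - l1)).
  assert (P2 := Rabs_pos (q2 (u N) - l2)). assert (P3 := Rabs_pos (q3 (u N) - l3)).
  revert P0 P1 P2 P3. generalize (Rabs (q0 (u N) - l0)) (Rabs (q1 (u N) - l1)) (Rabs (q2 (u N) - l2)) (Rabs (q3 (u N) - l3)).
  intros. nra.
Qed.


(** * Dual basis and lattice estimates *)

Ltac lam_ring lam :=
  unfold qdot, hatlam, det4, cof4, det3, Lam, skip, qsum4, qadd, qscale, qe;
  cbn [q0 q1 q2 q3 qcomp Nat.ltb Nat.leb Nat.add pow];
  destruct (lam 0%nat), (lam 1%nat), (lam 2%nat), (lam 3%nat); cbn [q0 q1 q2 q3]; ring.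

Lemma hatlam_comp lam h k : (k < 4)%nat -> qcomp k (hatlam lam h) = cof4 (Lam lam) h k.
Proof.
  intros Hk. destruct k as [|[|[|[|k]]]]; try lia; unfold hatlam; qunf; cbn [qcomp qe q0 q1 q2 q3]; ring.
Qed.

(** Expansion of the determinant along a row, where alien cofactors give 0: up to the factor [det4],
    the family [hatlam] is the dual basis of [lam]. *)
Lemma hatlam_dual lam h k : (h < 4)%nat -> (k < 4)%nat ->
  qdot (hatlam lam h) (lam k) = if Nat.eqb h k then det4 (Lam lam) else 0.
Proof.
  intros Hh Hk.
  transitivity (cof4 (Lam lam) h 0 * q0 (lam k) + cof4 (Lam lam) h 1 * q1 (lam k) + cof4 (Lam lam) h 2 * q2 (lam k)
    + cof4 (Lam lam) h 3 * q3 (lam k)).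
  - rewrite <- !hatlam_comp by lia. reflexivity.
  - destruct h as [|[|[|[|h]]]]; try lia; destruct k as [|[|[|[|k]]]]; try lia;
  cbn [Nat.eqb]; lam_ring lam.
Qed.

Lemma hatlam_col lam a b : (a < 4)%nat -> (b < 4)%nat ->
  cof4 (Lam lam) 0 a * qcomp b (lam 0%nat) + cof4 (Lam lam) 1 a * qcomp b (lam 1%nat) + cof4 (Lam lam) 2 a * qcomp b (lam 2%nat)
    + cof4 (Lam lam) 3 a * qcomp b (lam 3%nat)
   = if Nat.eqb a b then det4 (Lam lam) else 0.
Proof.
  intros Ha Hb.
  destruct a as [|[|[|[|a]]]]; try lia; destruct b as [|[|[|[|b]]]]; try lia;
  cbn [Nat.eqb]; lam_ring lam.
Qed.

Lemma hatlam_cramer lam x :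
  qscale (det4 (Lam lam)) x = qsum4 (fun h => qscale (qdot (hatlam lam h) x) (lam h)).
Proof.
  assert (H : forall b, (b < 4)%nat -> det4 (Lam lam) * qcomp b x =
    qdot (hatlam lam 0) x * qcomp b (lam 0%nat) + qdot (hatlam lam 1) x * qcomp b (lam 1%nat)
    + qdot (hatlam lam 2) x * qcomp b (lam 2%nat) + qdot (hatlam lam 3) x * qcomp b (lam 3%nat)).
  { intros b Hb. assert (Hc := fun a Ha => hatlam_col lam a b Ha Hb).
    assert (E : forall h, qdot (hatlam lam h) x = cof4 (Lam lam) h 0 * q0 x + cof4 (Lam lam) h 1 * q1 x
       + cof4 (Lam lam) h 2 * q2 x + cof4 (Lam lam) h 3 * q3 x)
      by (intros h; rewrite <- !hatlam_comp by lia; reflexivity).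
    rewrite !E. assert (H0 := Hc 0%nat ltac:(lia)). assert (H1 := Hc 1%nat ltac:(lia)).
    assert (H2 := Hc 2%nat ltac:(lia)). assert (H3 := Hc 3%nat ltac:(lia)). clear E Hc.
    transitivity (q0 x * (if Nat.eqb 0 b then det4 (Lam lam) else 0) + q1 x * (if Nat.eqb 1 b then det4 (Lam lam) else 0)
      + q2 x * (if Nat.eqb 2 b then det4 (Lam lam) else 0) + q3 x * (if Nat.eqb 3 b then det4 (Lam lam) else 0)).
    - clear - Hb; destruct b as [|[|[|[|b]]]]; try lia; cbn [Nat.eqb qcomp]; ring.
    - rewrite <- H0, <- H1, <- H2, <- H3. clear.
      generalize (cof4 (Lam lam)) (qcomp b (lam 0%nat)) (qcomp b (lam 1%nat)) (qcomp b (lam 2%nat)) (qcomp b (lam 3%nat)).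
      intros; ring. }
  apply quat_ext; qunf; [apply (H 0%nat)|apply (H 1%nat)|apply (H 2%nat)|apply (H 3%nat)]; lia.
Qed.

Lemma hatlam_cramer_dual lam x :
  qscale (det4 (Lam lam)) x = qsum4 (fun h => qscale (qdot x (lam h)) (hatlam lam h)).
Proof.
  assert (H : forall a, (a < 4)%nat -> det4 (Lam lam) * qcomp a x =
    qdot x (lam 0%nat) * qcomp a (hatlam lam 0) + qdot x (lam 1%nat) * qcomp a (hatlam lam 1)
    + qdot x (lam 2%nat) * qcomp a (hatlam lam 2) + qdot x (lam 3%nat) * qcomp a (hatlam lam 3)).
  { intros a Ha. rewrite !hatlam_comp by auto.
    assert (H0 := hatlam_col lam a 0 Ha ltac:(lia)). assert (H1 := hatlam_col lam a 1 Ha ltac:(lia)).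
    assert (H2 := hatlam_col lam a 2 Ha ltac:(lia)). assert (H3 := hatlam_col lam a 3 Ha ltac:(lia)).
    transitivity (q0 x * (if Nat.eqb a 0 then det4 (Lam lam) else 0) + q1 x * (if Nat.eqb a 1 then det4 (Lam lam) else 0)
      + q2 x * (if Nat.eqb a 2 then det4 (Lam lam) else 0) + q3 x * (if Nat.eqb a 3 then det4 (Lam lam) else 0)).
    - clear - Ha; destruct a as [|[|[|[|a]]]]; try lia; cbn [Nat.eqb qcomp]; ring.
    - rewrite <- H0, <- H1, <- H2, <- H3. clear. cbn [qcomp]. unfold qdot.
      generalize (cof4 (Lam lam) 0 a) (cof4 (Lam lam) 1 a) (cof4 (Lam lam) 2 a) (cof4 (Lam lam) 3 a).
      intros; ring. }
  apply quat_ext; qunf; [apply (H 0%nat)|apply (H 1%nat)|apply (H 2%nat)|apply (H 3%nat)]; lia.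
Qed.

(** Contraction of a basis with its dual does not depend on the basis, so the sum is [det4] times
    the sum of e_a * conj(e_a) over the standard basis; each of these four products is 1. *)
Lemma hatlam_mul_conj lam :
  qsum4 (fun h => qmul (hatlam lam h) (qconj (lam h))) = qscale (4 * det4 (Lam lam)) qone.
Proof.
  assert (H := hatlam_col lam).
  assert (H00 := H 0%nat 0%nat ltac:(lia) ltac:(lia)). assert (H01 := H 0%nat 1%nat ltac:(lia) ltac:(lia)).
  assert (H02 := H 0%nat 2%nat ltac:(lia) ltac:(lia)). assert (H03 := H 0%nat 3%nat ltac:(lia) ltac:(lia)).
  assert (H10 := H 1%nat 0%nat ltac:(lia) ltac:(lia)). assert (H11 := H 1%nat 1%nat ltac:(lia) ltac:(lia)).
  assert (H12 := H 1%nat 2%nat ltac:(lia) ltac:(lia)). assert (H13 := H 1%nat 3%nat ltac:(lia) ltac:(lia)).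
  assert (H20 := H 2%nat 0%nat ltac:(lia) ltac:(lia)). assert (H21 := H 2%nat 1%nat ltac:(lia) ltac:(lia)).
  assert (H22 := H 2%nat 2%nat ltac:(lia) ltac:(lia)). assert (H23 := H 2%nat 3%nat ltac:(lia) ltac:(lia)).
  assert (H30 := H 3%nat 0%nat ltac:(lia) ltac:(lia)). assert (H31 := H 3%nat 1%nat ltac:(lia) ltac:(lia)).
  assert (H32 := H 3%nat 2%nat ltac:(lia) ltac:(lia)). assert (H33 := H 3%nat 3%nat ltac:(lia) ltac:(lia)).
  clear H. rewrite <- !hatlam_comp in * by lia. cbn [qcomp Nat.eqb] in *.
  apply quat_ext; qunf; lra.
Qed.

(** [hatlam lam 0] is the generalised cross product of the other three basis vectors, and its
    squared length is their Gram determinant (Cauchy-Binet). Needed for the last pivot when squares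
    are completed on a face. *)
Lemma hatlam_norm_gram lam :
  qnorm2 (hatlam lam 0) =
    qdot (lam 1%nat) (lam 1%nat) * (qdot (lam 2%nat) (lam 2%nat) * qdot (lam 3%nat) (lam 3%nat) - qdot (lam 2%nat) (lam 3%nat) ^ 2)
    - qdot (lam 1%nat) (lam 2%nat) * (qdot (lam 1%nat) (lam 2%nat) * qdot (lam 3%nat) (lam 3%nat) - qdot (lam 2%nat) (lam 3%nat) * qdot (lam 1%nat) (lam 3%nat))
    + qdot (lam 1%nat) (lam 3%nat) * (qdot (lam 1%nat) (lam 2%nat) * qdot (lam 2%nat) (lam 3%nat) - qdot (lam 2%nat) (lam 2%nat) * qdot (lam 1%nat) (lam 3%nat)).
Proof.
  transitivity (cof4 (Lam lam) 0 0 ^ 2 + cof4 (Lam lam) 0 1 ^ 2 + cof4 (Lam lam) 0 2 ^ 2 + cof4 (Lam lam) 0 3 ^ 2).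
  - rewrite <- !hatlam_comp by lia. reflexivity.
  - lam_ring lam.
Qed.

Lemma qscale_inj d x y : d <> 0 -> qscale d x = qscale d y -> x = y.
Proof.
  intros Hd H. replace x with (qscale (/ d) (qscale d x)) by (apply quat_ext; qunf; field; auto).
  rewrite H. apply quat_ext; qunf; field; auto.
Qed.

Lemma qdot_conj_mul a x y : qdot (qmul (qconj a) x) y = qdot x (qmul a y).
Proof. unfold qdot; qunf; ring. Qed.

Lemma hatlam_transpose lam a (U : nat -> nat -> Z) j : det4 (Lam lam) <> 0 -> (j < 4)%nat ->
  (forall h, (h < 4)%nat -> qmul a (lam h) = qsum4 (fun j => qscale (IZR (U h j)) (lam j))) ->
  qsum4 (fun i => qscale (IZR (U i j)) (hatlam lam i)) = qmul (qconj a) (hatlam lam j).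
Proof.
  intros HD Hj HU. apply (qscale_inj _ _ _ HD). rewrite (hatlam_cramer_dual lam (qmul (qconj a) (hatlam lam j))).
  set (D := det4 (Lam lam)).
  assert (Hh : forall h, (h < 4)%nat -> qdot (qmul (qconj a) (hatlam lam j)) (lam h) = D * IZR (U h j)).
  { intros h Hh. rewrite qdot_conj_mul, HU by auto.
    replace (qdot (hatlam lam j) (qsum4 (fun j => qscale (IZR (U h j)) (lam j)))) with
      (IZR (U h 0%nat) * qdot (hatlam lam j) (lam 0%nat) + IZR (U h 1%nat) * qdot (hatlam lam j) (lam 1%nat)
       + IZR (U h 2%nat) * qdot (hatlam lam j) (lam 2%nat) + IZR (U h 3%nat) * qdot (hatlam lam j) (lam 3%nat))
      by (unfold qdot; qunf; ring).
    rewrite !hatlam_dual by (auto; lia). fold D.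
    destruct j as [|[|[|[|j]]]]; try lia; cbn [Nat.eqb]; ring. }
  unfold qsum4. rewrite !Hh by lia. qring.
Qed.

(** Contracting with the dual basis gives [det4] times the Cauchy-Fueter operator applied to [Gq],
    which vanishes by left regularity. Concretely, both parts of [dGq] contribute 4 [det4] / |l|^4,
    with opposite signs. *)
Lemma hatlam_dGq lam l : qnorm2 l <> 0 ->
  qsum4 (fun h => qmul (hatlam lam h) (dGq l (lam h))) = qzero.
Proof.
  intros Hl. unfold dGq.
  assert (H1 := hatlam_mul_conj lam). assert (H2 := hatlam_cramer_dual lam l).
  set (u := / qnorm2 l ^ 2). set (w := / qnorm2 l ^ 3).
  assert (Hu : u = w * qnorm2 l) by (unfold u, w; field; auto).
  assert (E : forall h, qmul (hatlam lam h) (qsub (qscale u (qconj (lam h))) (qscale (4 * qdot l (lam h) / qnorm2 l ^ 3) (qconj l)))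
    = qsub (qscale u (qmul (hatlam lam h) (qconj (lam h))))
        (qscale (4 * w) (qmul (qscale (qdot l (lam h)) (hatlam lam h)) (qconj l)))).
  { intros h. unfold Rdiv; fold w. generalize (qdot l (lam h)) (hatlam lam h) (lam h). qring. }
  transitivity (qsub (qscale u (qsum4 (fun h => qmul (hatlam lam h) (qconj (lam h)))))
    (qscale (4 * w) (qmul (qsum4 (fun h => qscale (qdot l (lam h)) (hatlam lam h))) (qconj l)))).
  - unfold qsum4. rewrite !E. clear.
    assert (K : forall a b c d a' b' c' d' z : quat, 
      qadd (qadd (qadd (qsub (qscale u a) (qscale (4 * w) (qmul a' z))) (qsub (qscale u b) (qscale (4 * w) (qmul b' z))))
         (qsub (qscale u c) (qscale (4 * w) (qmul c' z)))) (qsub (qscale u d) (qscale (4 * w) (qmul d' z)))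
      = qsub (qscale u (qadd (qadd (qadd a b) c) d)) (qscale (4 * w) (qmul (qadd (qadd (qadd a' b') c') d') z))) by qring.
    intros; apply K.
  - rewrite H1, <- H2, Hu. unfold qnorm2. qring.
Qed.

(** Repeats the [match] written inside [zeta_partial], so that [zeta_partial_eq] holds by
    conversion. *)
Definition lpt (lam : nat -> quat) (n1 n2 n3 n4 : Z) : quat :=
  latpt lam (fun i => match i with 0%nat => n1 | 1%nat => n2 | 2%nat => n3 | _ => n4 end).

(** Each coordinate is the scalar product of the lattice point with a [hatlam], divided by [det4],
    so Cauchy-Schwarz bounds it by the norm of the point. *)
Lemma qn_lpt_lower lam : 0 < det4 (Lam lam) ->
  exists c, 0 < c /\ forall n1 n2 n3 n4,
    c * IZR (Z.abs n1) <= qn (lpt lam n1 n2 n3 n4) /\ c * IZR (Z.abs n2) <= qn (lpt lam n1 n2 n3 n4) /\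
    c * IZR (Z.abs n3) <= qn (lpt lam n1 n2 n3 n4) /\ c * IZR (Z.abs n4) <= qn (lpt lam n1 n2 n3 n4).
Proof.
  intros HD. set (D := det4 (Lam lam)) in *.
  set (H := 1 + qn (hatlam lam 0) + qn (hatlam lam 1) + qn (hatlam lam 2) + qn (hatlam lam 3)).
  assert (P0 := qn_ge0 (hatlam lam 0)). assert (P1 := qn_ge0 (hatlam lam 1)).
  assert (P2 := qn_ge0 (hatlam lam 2)). assert (P3 := qn_ge0 (hatlam lam 3)).
  assert (HH : 1 <= H) by (unfold H; lra).
  exists (D / H). split; [apply Rdiv_lt_0_compat; lra|]. intros n1 n2 n3 n4.
  set (x := lpt lam n1 n2 n3 n4).
  assert (K : forall h n, qdot (hatlam lam h) x = D * IZR n -> qn (hatlam lam h) <= H -> D / H * IZR (Z.abs n) <= qn x).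
  { intros h n E Hh. assert (B := qdot_abs (hatlam lam h) x). rewrite E, Rabs_mult, (Rabs_pos_eq D), Rabs_Zabs in B by lra.
    assert (qn (hatlam lam h) * qn x <= H * qn x) by (apply Rmult_le_compat_r; auto; apply qn_ge0).
    apply Rmult_le_reg_l with H; [lra|]. replace (H * (D / H * IZR (Z.abs n))) with (D * IZR (Z.abs n)) by (field; lra). lra. }
  assert (E : forall h, qdot (hatlam lam h) x = IZR n1 * qdot (hatlam lam h) (lam 0%nat) + IZR n2 * qdot (hatlam lam h) (lam 1%nat)
       + IZR n3 * qdot (hatlam lam h) (lam 2%nat) + IZR n4 * qdot (hatlam lam h) (lam 3%nat))
      by (intros; unfold x, lpt, latpt, qdot; qunf; ring).
  repeat split; [apply (K 0%nat)|apply (K 1%nat)|apply (K 2%nat)|apply (K 3%nat)]; try (unfold H; lra);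
  rewrite E, !hatlam_dual by lia; cbn [Nat.eqb]; fold D; ring.
Qed.

Lemma inv_pow5_le_wt y k : 0 < y -> 1 + IZR (Z.abs k) <= y ^ 4 -> / y ^ 5 <= wt k.
Proof.
  intros Hy H. apply Rinv_le_contravar; [apply pow_lt; assert (H1 := root4_ge1 k); lra|].
  apply pow_incr. assert (H1 := root4_ge1 k). split; [lra|].
  rewrite <- root4_pow4 in H. apply Rnot_lt_le; intros Hlt.
  assert (y ^ 4 < root4 k ^ 4); [|lra]. 
  assert (y ^ 2 < root4 k ^ 2) by nra.
  replace (y ^ 4) with (y ^ 2 * y ^ 2) by ring. replace (root4 k ^ 4) with (root4 k ^ 2 * root4 k ^ 2) by ring.
  assert (0 < y ^ 2) by (apply pow_lt; auto). nra.
Qed.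

Lemma fourth_root x : 0 < x -> exists y, 0 < y /\ y ^ 4 = x.
Proof.
  intros Hx. exists (sqrt (sqrt x)). split; [apply sqrt_lt_R0, sqrt_lt_R0; auto|].
  replace 4%nat with (2 * 2)%nat by lia. rewrite pow_mult, !pow2_sqrt; auto; try lra. apply sqrt_pos.
Qed.

Lemma inv_pow5_le_wt4 x n1 n2 n3 n4 :
  1 + IZR (Z.abs n1) <= x -> 1 + IZR (Z.abs n2) <= x -> 1 + IZR (Z.abs n3) <= x -> 1 + IZR (Z.abs n4) <= x ->
  / x ^ 5 <= wt n1 * (wt n2 * (wt n3 * wt n4)).
Proof.
  intros H1 H2 H3 H4. assert (0 <= IZR (Z.abs n1)) by (apply IZR_le; lia).
  (* With x = y^4 the twenty factors 1/y split into four groups of five, one weight for each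
     index. *)
  destruct (fourth_root x) as (y & Hy & <-); [lra|].
  replace (/ (y ^ 4) ^ 5) with (/ y ^ 5 * (/ y ^ 5 * (/ y ^ 5 * / y ^ 5))) by (field; lra).
  assert (0 < / y ^ 5) by (apply Rinv_0_lt_compat, pow_lt; auto).
  repeat (apply Rmult_le_compat; repeat (apply Rmult_le_pos); try (apply inv_pow5_le_wt; assumption); try lra).
Qed.

(** A finite cube is absorbed in the constant: the sum of all norms over it bounds each value there,
    and [w ^ 4] bounds the product of the weights from below. *)
Lemma wt4_dominated (f : Z -> Z -> Z -> Z -> quat) K C :
  (forall n1 n2 n3 n4, ~ (inbox K n1 /\ inbox K n2 /\ inbox K n3 /\ inbox K n4) ->
     qn (f n1 n2 n3 n4) <= wt n1 * (wt n2 * (wt n3 * (wt n4 * C)))) ->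
  exists C', forall n1 n2 n3 n4, qn (f n1 n2 n3 n4) <= wt n1 * (wt n2 * (wt n3 * (wt n4 * C'))).
Proof.
  intros H.
  set (B := rsum K (fun n1 => rsum K (fun n2 => rsum K (fun n3 => rsum K (fun n4 => qn (f n1 n2 n3 n4)))))).
  assert (HB : forall n1 n2 n3 n4, inbox K n1 -> inbox K n2 -> inbox K n3 -> inbox K n4 -> qn (f n1 n2 n3 n4) <= B).
  { intros n1 n2 n3 n4 I1 I2 I3 I4. unfold B.
    eapply Rle_trans; [|apply rsum_term with (k := n1); auto]; cbv beta.
    eapply Rle_trans; [|apply rsum_term with (k := n2); auto]; cbv beta.
    eapply Rle_trans; [|apply rsum_term with (k := n3); auto]; cbv beta.
    apply (rsum_term K (fun n4 => qn (f n1 n2 n3 n4)) n4); auto.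
    all: intros; repeat (apply rsum_ge0; intros); apply qn_ge0. }
  assert (Hw0 := wt_pos (Z.of_nat K)). set (w := wt (Z.of_nat K)) in *.
  assert (HB0 : 0 <= B) by (repeat (apply rsum_ge0; intros); apply qn_ge0).
  assert (Hw : forall k, inbox K k -> w <= wt k).
  { intros k Hk. apply Rinv_le_contravar; [apply pow_lt; assert (H1 := root4_ge1 k); lra|].
    apply pow_incr. assert (H1 := root4_ge1 k). split; [lra|]. unfold root4.
    do 2 apply sqrt_le_1_alt. apply Rplus_le_compat_l, IZR_le. unfold inbox in Hk; lia. }
  exists (Rmax C (B / w ^ 4)). intros n1 n2 n3 n4.
  assert (W1 := wt_pos n1). assert (W2 := wt_pos n2). assert (W3 := wt_pos n3). assert (W4 := wt_pos n4).
  destruct (excluded_middle_informative (inbox K n1 /\ inbox K n2 /\ inbox K n3 /\ inbox K n4)) as [(I1 & I2 & I3 & I4)|I].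
  - eapply Rle_trans; [apply HB; auto|].
    apply Rle_trans with (w * (w * (w * (w * (B / w ^ 4))))); [right; field; lra|].
    assert (0 <= B / w ^ 4) by (apply Rmult_le_pos; auto; left; apply Rinv_0_lt_compat, pow_lt; auto).
    assert (HR := Rmax_r C (B / w ^ 4)). revert HR H0. generalize (B / w ^ 4) (Rmax C (B / w ^ 4)). intros b m HR H0.
    repeat (apply Rmult_le_compat; repeat (apply Rmult_le_pos); try apply Hw; auto; try lra).
  - eapply Rle_trans; [apply H; auto|].
    repeat (apply Rmult_le_compat_l; [lra|]). apply Rmax_l.
Qed.

Definition zterm (lam : nat -> quat) (q : quat) (n1 n2 n3 n4 : Z) : quat :=
  if (Z.eqb n1 0 && Z.eqb n2 0 && Z.eqb n3 0 && Z.eqb n4 0)%bool then qzero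
  else zeta_term q (lpt lam n1 n2 n3 n4).

Lemma lpt_nonzero lam n1 n2 n3 n4 : 0 < det4 (Lam lam) ->
  (Z.eqb n1 0 && Z.eqb n2 0 && Z.eqb n3 0 && Z.eqb n4 0)%bool = false -> 0 < qn (lpt lam n1 n2 n3 n4).
Proof.
  intros HD H. destruct (qn_lpt_lower lam HD) as (c & Hc & Hl).
  destruct (Hl n1 n2 n3 n4) as (A1 & A2 & A3 & A4).
  assert (P : forall n, n <> 0%Z -> 0 < c * IZR (Z.abs n)) by (intros; apply Rmult_lt_0_compat; auto; apply IZR_lt; lia).
  destruct (Z.eqb_spec n1 0) as [|E]; [|specialize (P n1 E); lra].
  destruct (Z.eqb_spec n2 0) as [|E]; [|specialize (P n2 E); lra].
  destruct (Z.eqb_spec n3 0) as [|E]; [|specialize (P n3 E); lra].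
  destruct (Z.eqb_spec n4 0) as [|E]; [|specialize (P n4 E); lra]. discriminate.
Qed.

Lemma lpt_far lam R0 : 0 < det4 (Lam lam) ->
  exists c K, 0 < c /\ forall n1 n2 n3 n4,
   ~ (inbox K n1 /\ inbox K n2 /\ inbox K n3 /\ inbox K n4) ->
   R0 <= qn (lpt lam n1 n2 n3 n4) /\ 0 < qn (lpt lam n1 n2 n3 n4) /\
   / qn (lpt lam n1 n2 n3 n4) ^ 5 <= c * (wt n1 * (wt n2 * (wt n3 * wt n4))).
Proof.
  intros HD. destruct (qn_lpt_lower lam HD) as (c & Hc & Hl).
  destruct (INR_unbounded (R0 / c)) as [K HK].
  exists ((2 / c) ^ 5), (S K). split; [apply pow_lt, Rdiv_lt_0_compat; lra|].
  intros n1 n2 n3 n4 I. destruct (Hl n1 n2 n3 n4) as (A1 & A2 & A3 & A4).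
  set (x := qn (lpt lam n1 n2 n3 n4)) in *.
  assert (Hx : c * INR (S K) <= x).
  { rewrite INR_IZR_INZ. unfold inbox in I.
    assert (P : forall n, c * IZR (Z.abs n) <= x -> (Z.of_nat (S K) <= Z.abs n)%Z -> c * IZR (Z.of_nat (S K)) <= x).
    { intros n B Hn. apply IZR_le in Hn. apply (Rmult_le_compat_l c) in Hn; lra. }
    destruct (Z_le_gt_dec (Z.abs n1) (Z.of_nat (S K))); [|apply (P n1); auto; lia].
    destruct (Z_le_gt_dec (Z.abs n2) (Z.of_nat (S K))); [|apply (P n2); auto; lia].
    destruct (Z_le_gt_dec (Z.abs n3) (Z.of_nat (S K))); [|apply (P n3); auto; lia].
    destruct (Z_le_gt_dec (Z.abs n4) (Z.of_nat (S K))); [|apply (P n4); auto; lia]. tauto. }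
  rewrite S_INR in Hx. assert (0 <= INR K) by apply pos_INR.
  assert (R0 < c * INR K).
  { apply (Rmult_lt_compat_l c) in HK; auto. replace (c * (R0 / c)) with R0 in HK by (field; lra). lra. }
  assert (Hc1 : c <= x) by nra.
  split; [nra|]. split; [lra|].
  replace (/ x ^ 5) with ((2 / c) ^ 5 * / (2 / c * x) ^ 5) by (field; lra).
  apply Rmult_le_compat_l; [left; apply pow_lt, Rdiv_lt_0_compat; lra|].
  (* The summand 1 is paid for by [Hc1], that is 1 <= x / c; this doubles the factor 1 / c and
     explains the constant (2 / c)^5. *)
  assert (P : forall n, c * IZR (Z.abs n) <= x -> 1 + IZR (Z.abs n) <= 2 / c * x).
  { intros n B. apply Rmult_le_reg_l with c; auto. replace (c * (2 / c * x)) with (2 * x) by (field; lra). lra. }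
  apply inv_pow5_le_wt4; auto.
Qed.

Lemma zterm_dominated lam q : 0 < det4 (Lam lam) ->
  exists C, forall n1 n2 n3 n4, qn (zterm lam q n1 n2 n3 n4) <= wt n1 * (wt n2 * (wt n3 * (wt n4 * C))).
Proof.
  intros HD. destruct (lpt_far lam (2 * qn q) HD) as (c & K & Hc & H).
  apply wt4_dominated with K (700 * qn q ^ 2 * c). intros n1 n2 n3 n4 I.
  destruct (H _ _ _ _ I) as (H1 & H2 & H3). unfold zterm.
  destruct (_ && _)%bool eqn:E.
  - destruct (Z.eqb_spec n1 0); [|discriminate]. destruct (Z.eqb_spec n2 0); [|discriminate].
    destruct (Z.eqb_spec n3 0); [|discriminate]. destruct (Z.eqb_spec n4 0); [|discriminate].
    exfalso; apply I; unfold inbox; subst; simpl; lia.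
  - assert (Hl : qnorm2 (lpt lam n1 n2 n3 n4) <> 0) by (rewrite <- qn_sqr; apply pow_nonzero; lra).
    rewrite zeta_term_eq by auto.
    eapply Rle_trans; [apply Gq_taylor; auto|]. unfold Rdiv.
    assert (0 <= 700 * qn q ^ 2) by (assert (0 <= qn q ^ 2) by apply pow2_ge_0; lra).
    eapply Rle_trans; [apply Rmult_le_compat_l; [auto|apply H3]|]. right; ring.
Qed.

Lemma zeta_partial_eq lam q N : zeta_partial lam q N = box4 N N N N (zterm lam q).
Proof. reflexivity. Qed.

(** [qlim] is defined through [epsilon] and says nothing by itself; only after convergence is proved
    is it the limit of the cubes. *)
Lemma zeta_partial_cv lam q : 0 < det4 (Lam lam) ->
  Qcv (zeta_partial lam q) (qlim (zeta_partial lam q)).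
Proof.
  intros HD. destruct (zterm_dominated lam q HD) as [C HC].
  destruct (box4_tail _ _ HC) as (C' & HC' & Ht).
  destruct (Qcv_cauchy (zeta_partial lam q) C' HC') as [l Hl].
  - intros K N HKN. rewrite !zeta_partial_eq. apply Ht; auto.
  - rewrite (qlim_eq _ _ Hl); auto.
Qed.


(** * Reduction to a sum over two opposite faces *)

Lemma qsum4_mul_sub (x f g : nat -> quat) :
  qsum4 (fun h => qmul (x h) (qsub (f h) (g h))) =
  qsub (qsum4 (fun h => qmul (x h) (f h))) (qsum4 (fun h => qmul (x h) (g h))).
Proof.
  assert (E : forall a b c, qmul a (qsub b c) = qsub (qmul a b) (qmul a c)) by qring.
  unfold qsum4. rewrite !E.
  assert (K : forall a b c d a' b' c' d', qadd (qadd (qadd (qsub a a') (qsub b b')) (qsub c c')) (qsub d d')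
    = qsub (qadd (qadd (qadd a b) c) d) (qadd (qadd (qadd a' b') c') d')) by qring.
  apply K.
Qed.

Lemma qsum4_mul_add (x f g : nat -> quat) :
  qsum4 (fun h => qmul (x h) (qadd (f h) (g h))) =
  qadd (qsum4 (fun h => qmul (x h) (f h))) (qsum4 (fun h => qmul (x h) (g h))).
Proof.
  assert (E : forall a b c, qmul a (qadd b c) = qadd (qmul a b) (qmul a c)) by qring.
  unfold qsum4. rewrite !E.
  assert (K : forall a b c d a' b' c' d', qadd (qadd (qadd (qadd a a') (qadd b b')) (qadd c c')) (qadd d d')
    = qadd (qadd (qadd (qadd a b) c) d) (qadd (qadd (qadd a' b') c') d')) by qring.
  apply K.
Qed.

Lemma box4_sub N1 N2 N3 N4 f g :
  box4 N1 N2 N3 N4 (fun a b c d => qsub (f a b c d) (g a b c d)) = qsub (box4 N1 N2 N3 N4 f) (box4 N1 N2 N3 N4 g).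
Proof.
  unfold box4, box3. rewrite <- zsum_sub. apply zsum_ext; intros. rewrite <- zsum_sub. apply zsum_ext; intros.
  rewrite <- zsum_sub. apply zsum_ext; intros. apply zsum_sub.
Qed.

Lemma box4_add N1 N2 N3 N4 f g :
  box4 N1 N2 N3 N4 (fun a b c d => qadd (f a b c d) (g a b c d)) = qadd (box4 N1 N2 N3 N4 f) (box4 N1 N2 N3 N4 g).
Proof.
  unfold box4, box3. rewrite <- zsum_add. apply zsum_ext; intros. rewrite <- zsum_add. apply zsum_ext; intros.
  rewrite <- zsum_add. apply zsum_ext; intros. apply zsum_add.
Qed.

Lemma box4_mul N1 N2 N3 N4 x f :
  box4 N1 N2 N3 N4 (fun a b c d => qmul x (f a b c d)) = qmul x (box4 N1 N2 N3 N4 f).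
Proof.
  unfold box4, box3. rewrite <- zsum_mul. apply zsum_ext; intros. rewrite <- zsum_mul. apply zsum_ext; intros.
  rewrite <- zsum_mul. apply zsum_ext; intros. apply zsum_mul.
Qed.

(** Handles the origin, which the zeta series leaves out but the telescoping sums contain. *)
Lemma box4_diff0 N1 N2 N3 N4 f g :
  (forall n1 n2 n3 n4, (Z.eqb n1 0 && Z.eqb n2 0 && Z.eqb n3 0 && Z.eqb n4 0)%bool = false ->
     f n1 n2 n3 n4 = g n1 n2 n3 n4) ->
  qsub (box4 N1 N2 N3 N4 f) (box4 N1 N2 N3 N4 g) = qsub (f 0%Z 0%Z 0%Z 0%Z) (g 0%Z 0%Z 0%Z 0%Z).
Proof.
  intros H. unfold box4, box3.
  rewrite zsum_diff0, zsum_diff0, zsum_diff0, zsum_diff0; auto; intros n Hn.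
  - apply H. rewrite <- !Bool.andb_assoc. apply Z.eqb_neq in Hn; rewrite Hn; reflexivity.
  - apply zsum_ext; intros; apply H. apply Z.eqb_neq in Hn; rewrite Hn; reflexivity.
  - do 2 (apply zsum_ext; intros); apply H. apply Z.eqb_neq in Hn; rewrite Hn; reflexivity.
  - do 3 (apply zsum_ext; intros); apply H. apply Z.eqb_neq in Hn; rewrite Hn; reflexivity.
Qed.

Definition gshift (lam : nat -> quat) (q : quat) (n1 n2 n3 n4 : Z) : quat := Gq (qadd q (lpt lam n1 n2 n3 n4)).

Definition gdiff (lam : nat -> quat) (q : quat) (h : nat) (n1 n2 n3 n4 : Z) : quat :=
  qsub (gshift lam (qadd q (lam h)) n1 n2 n3 n4) (gshift lam q n1 n2 n3 n4).

Definition fterm (lam : nat -> quat) (q : quat) (n1 n2 n3 n4 : Z) : quat :=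
  qsum4 (fun h => qmul (hatlam lam h) (gdiff lam q h n1 n2 n3 n4)).

Definition zterm_comb (lam : nat -> quat) (q : quat) (n1 n2 n3 n4 : Z) : quat :=
  qsum4 (fun h => qmul (hatlam lam h) (qsub (zterm lam (qadd q (lam h)) n1 n2 n3 n4) (zterm lam q n1 n2 n3 n4))).

Lemma dGq_add l x y : dGq l (qadd x y) = qadd (dGq l x) (dGq l y).
Proof.
  unfold dGq, Rdiv. generalize (/ qnorm2 l ^ 2) (/ qnorm2 l ^ 3); intros. unfold qdot. qring.
Qed.

(* The first-order Taylor terms cancel by [hatlam_dGq], so [fterm] is absolutely summable and
   its cubes may be replaced by boxes of any shape. *)
Lemma zterm_comb_eq lam q n1 n2 n3 n4 : 0 < det4 (Lam lam) ->
  (Z.eqb n1 0 && Z.eqb n2 0 && Z.eqb n3 0 && Z.eqb n4 0)%bool = false ->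
  zterm_comb lam q n1 n2 n3 n4 = fterm lam q n1 n2 n3 n4.
Proof.
  intros HD H. assert (Hl := lpt_nonzero lam _ _ _ _ HD H).
  unfold zterm_comb, fterm, zterm, gdiff, gshift. rewrite H. set (l := lpt lam n1 n2 n3 n4) in *.
  assert (Hl2 : qnorm2 l <> 0) by (rewrite <- qn_sqr; apply pow_nonzero; lra).
  assert (HZ := hatlam_dGq lam l Hl2).
  assert (E : forall h, qsub (zeta_term (qadd q (lam h)) l) (zeta_term q l) =
    qsub (qsub (Gq (qadd (qadd q (lam h)) l)) (Gq (qadd q l))) (dGq l (lam h))).
  { intros h. rewrite !zeta_term_eq by auto. rewrite dGq_add.
    replace (qadd l (qadd q (lam h))) with (qadd (qadd q (lam h)) l) by qring.
    replace (qadd l q) with (qadd q l) by qring. qring. }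
  transitivity (qsum4 (fun h => qmul (hatlam lam h)
    (qsub (qsub (Gq (qadd (qadd q (lam h)) l)) (Gq (qadd q l))) (dGq l (lam h))))).
  - unfold qsum4. rewrite !E. reflexivity.
  - rewrite (qsum4_mul_sub (hatlam lam) (fun h => qsub (Gq (qadd (qadd q (lam h)) l)) (Gq (qadd q l)))), HZ.
    assert (K : forall x, qsub x qzero = x) by qring. apply K.
Qed.

Lemma zterm_comb_dominated lam q : 0 < det4 (Lam lam) ->
  exists C, forall n1 n2 n3 n4, qn (zterm_comb lam q n1 n2 n3 n4) <= wt n1 * (wt n2 * (wt n3 * (wt n4 * C))).
Proof.
  intros HD.
  assert (H : forall h, exists C, forall n1 n2 n3 n4,
     qn (qmul (hatlam lam h) (qsub (zterm lam (qadd q (lam h)) n1 n2 n3 n4) (zterm lam q n1 n2 n3 n4)))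
       <= wt n1 * (wt n2 * (wt n3 * (wt n4 * C)))).
  { intros h. destruct (zterm_dominated lam q HD) as [C0 H0].
    destruct (zterm_dominated lam (qadd q (lam h)) HD) as [C1 H1].
    exists (qn (hatlam lam h) * (C1 + C0)). intros. rewrite qn_mul.
    replace (wt n1 * (wt n2 * (wt n3 * (wt n4 * (qn (hatlam lam h) * (C1 + C0)))))) with
     (qn (hatlam lam h) * (wt n1 * (wt n2 * (wt n3 * (wt n4 * C1))) + wt n1 * (wt n2 * (wt n3 * (wt n4 * C0))))) by ring.
    apply Rmult_le_compat_l; [apply qn_ge0|]. eapply Rle_trans; [apply qn_sub|]. apply Rplus_le_compat; auto. }
  destruct (H 0%nat) as [C0 H0], (H 1%nat) as [C1 H1], (H 2%nat) as [C2 H2], (H 3%nat) as [C3 H3].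
  exists (C0 + C1 + C2 + C3). intros. unfold zterm_comb, qsum4.
  eapply Rle_trans; [apply qn_add|]. eapply Rle_trans; [apply Rplus_le_compat_r, qn_add|].
  eapply Rle_trans; [apply Rplus_le_compat_r, Rplus_le_compat_r, qn_add|].
  specialize (H0 n1 n2 n3 n4). specialize (H1 n1 n2 n3 n4). specialize (H2 n1 n2 n3 n4). specialize (H3 n1 n2 n3 n4).
  lra.
Qed.

(** The summand [Gq q] in front of the series of [zeta] supplies exactly the term of [fterm] at the
    origin, so the limit is that of complete boxes, with no hole to spoil the telescoping. *)
Lemma eta_comb_cv lam q : 0 < det4 (Lam lam) ->
  Qcv (fun N => box4 N N N N (fterm lam q)) (qsum4 (fun h => qmul (hatlam lam h) (eta lam q h))).
Proof.
  intros HD.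
  assert (He : forall h, Qcv (fun N => qmul (hatlam lam h) (qadd (gdiff lam q h 0 0 0 0)
     (qsub (zeta_partial lam (qadd q (lam h)) N) (zeta_partial lam q N)))) (qmul (hatlam lam h) (eta lam q h))).
  { intros h. apply Qcv_mul.
    replace (eta lam q h) with (qadd (gdiff lam q h 0 0 0 0)
      (qsub (qlim (zeta_partial lam (qadd q (lam h)))) (qlim (zeta_partial lam q)))).
    - apply Qcv_add; [apply Qcv_const|]. apply Qcv_sub; apply zeta_partial_cv; auto.
    - unfold eta, zeta, gdiff, gshift.
      assert (E : forall x, qadd x (lpt lam 0 0 0 0) = x) by (intros; unfold lpt, latpt; qring).
      rewrite !E. qring. }
  assert (HS := Qcv_add _ _ _ _ (Qcv_add _ _ _ _ (Qcv_add _ _ _ _ (He 0%nat) (He 1%nat)) (He 2%nat)) (He 3%nat)).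
  eapply Qcv_small; [exact HS|]. apply small_le with (fun N => 0 / rootN N); [apply small_root; lra|].
  exists 0%nat. intros N _. right. unfold Rdiv; rewrite Rmult_0_l.
  set (Z := fun h => qsub (zeta_partial lam (qadd q (lam h)) N) (zeta_partial lam q N)).
  assert (E0 := box4_diff0 N N N N (fterm lam q) (zterm_comb lam q)
    (fun n1 n2 n3 n4 H => eq_sym (zterm_comb_eq lam q n1 n2 n3 n4 HD H))).
  assert (E1 : box4 N N N N (zterm_comb lam q) = qsum4 (fun h => qmul (hatlam lam h) (Z h))).
  { unfold zterm_comb, qsum4, Z. rewrite !box4_add, !box4_mul, !box4_sub, <- !zeta_partial_eq. reflexivity. }
  assert (E2 : zterm_comb lam q 0 0 0 0 = qzero).
  { assert (K : forall x, qmul x (qsub qzero qzero) = qzero) by qring.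
    unfold zterm_comb, zterm; cbn [Z.eqb andb]. unfold qsum4. rewrite !K. qring. }
  assert (E3 : box4 N N N N (fterm lam q) = qsum4 (fun h => qmul (hatlam lam h) (qadd (gdiff lam q h 0 0 0 0) (Z h)))).
  { rewrite qsum4_mul_add, <- E1. fold (fterm lam q 0 0 0 0). rewrite E2 in E0.
    assert (K : forall x y z, qsub x y = qsub z qzero -> x = qadd z y).
    { intros x y z H. replace x with (qadd (qsub x y) y) by qring. rewrite H. qring. }
    apply K, E0. }
  rewrite E3. replace (qsub _ _) with qzero; [apply qn_zero|].
  assert (K : forall x, qzero = qsub x x) by qring. apply K.
Qed.

(* With the exponents 5, 6, 7 the faces [n_h = +-N_h] in the last three directions are negligible
   by the crude bound (number of points) * O(N_h^(-3)). *)
Lemma box_change lam q : 0 < det4 (Lam lam) ->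
  small (fun N => qn (qsub (box4 N (N ^ 5) (N ^ 6) (N ^ 7) (fterm lam q)) (box4 N N N N (fterm lam q)))).
Proof.
  intros HD. destruct (zterm_comb_dominated lam q HD) as [C HC].
  destruct (box4_tail _ _ HC) as (C' & HC' & Ht).
  apply small_le with (fun N => C' / rootN N); [apply small_root; auto|].
  exists 1%nat. intros N HN.
  assert (E : forall N1 N2 N3 N4, box4 N1 N2 N3 N4 (fterm lam q) = qadd (box4 N1 N2 N3 N4 (zterm_comb lam q))
     (qsub (fterm lam q 0 0 0 0) (zterm_comb lam q 0 0 0 0))).
  { intros. rewrite <- (box4_diff0 N1 N2 N3 N4 (fterm lam q) (zterm_comb lam q)); [qring|].
    intros; symmetry; apply zterm_comb_eq; auto. }
  rewrite !E.
  assert (K : forall x y z, qsub (qadd x z) (qadd y z) = qsub x y) by qring. rewrite K.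
  assert (P : forall k, (1 <= k)%nat -> (N <= N ^ k)%nat).
  { intros k Hk. rewrite <- (Nat.pow_1_r N) at 1. apply Nat.pow_le_mono_r; lia. }
  apply Ht; try (apply P; lia). lia.
Qed.

Lemma gshift_far lam q : 0 < det4 (Lam lam) ->
  exists C N0, 0 < C /\ forall M n1 n2 n3 n4, (N0 <= M)%nat ->
   (Z.of_nat M <= Z.abs n1 \/ Z.of_nat M <= Z.abs n2 \/ Z.of_nat M <= Z.abs n3 \/ Z.of_nat M <= Z.abs n4)%Z ->
   qn (gshift lam q n1 n2 n3 n4) <= C / INR M ^ 3.
Proof.
  intros HD. destruct (qn_lpt_lower lam HD) as (c & Hc & Hl).
  destruct (INR_unbounded (2 * qn q / c)) as [N0 HN0].
  exists ((2 / c) ^ 3), (S N0). split; [apply pow_lt, Rdiv_lt_0_compat; lra|].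
  intros M n1 n2 n3 n4 HM Hn. destruct (Hl n1 n2 n3 n4) as (A1 & A2 & A3 & A4).
  set (l := lpt lam n1 n2 n3 n4) in *.
  assert (HM1 : 2 * qn q <= c * INR M).
  { apply le_INR in HM. rewrite S_INR in HM.
    apply (Rmult_lt_compat_l c) in HN0; auto. replace (c * (2 * qn q / c)) with (2 * qn q) in HN0 by (field; lra). nra. }
  assert (HM0 : 0 < INR M) by (apply lt_0_INR; lia).
  assert (Hx : c * INR M <= qn l).
  { rewrite INR_IZR_INZ.
    assert (P : forall n, c * IZR (Z.abs n) <= qn l -> (Z.of_nat M <= Z.abs n)%Z -> c * IZR (Z.of_nat M) <= qn l).
    { intros n B H. apply IZR_le in H. apply (Rmult_le_compat_l c) in H; lra. }
    destruct Hn as [H|[H|[H|H]]]; eauto. }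
  assert (Hq : c * INR M / 2 <= qn (qadd q l)).
  { assert (H := qn_add_lower l q). replace (qadd l q) with (qadd q l) in H by qring. lra. }
  assert (Hq0 : 0 < c * INR M / 2) by (apply Rdiv_lt_0_compat; nra).
  unfold gshift; fold l. rewrite qn_Gq by lra.
  replace ((2 / c) ^ 3 / INR M ^ 3) with (/ (c * INR M / 2) ^ 3) by (field; lra).
  apply Rinv_le_contravar; [apply pow_lt; auto|]. apply pow_incr; lra.
Qed.

(** Translation by a basis vector is a unit step of one index; hence the part of [fterm] carrying
    [hatlam lam h] telescopes in the index of direction [h]. *)
Lemma gdiff_eq lam q n1 n2 n3 n4 :
  gdiff lam q 0 n1 n2 n3 n4 = qsub (gshift lam q (n1 + 1) n2 n3 n4) (gshift lam q n1 n2 n3 n4) /\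
  gdiff lam q 1 n1 n2 n3 n4 = qsub (gshift lam q n1 (n2 + 1) n3 n4) (gshift lam q n1 n2 n3 n4) /\
  gdiff lam q 2 n1 n2 n3 n4 = qsub (gshift lam q n1 n2 (n3 + 1) n4) (gshift lam q n1 n2 n3 n4) /\
  gdiff lam q 3 n1 n2 n3 n4 = qsub (gshift lam q n1 n2 n3 (n4 + 1)) (gshift lam q n1 n2 n3 n4).
Proof.
  unfold gdiff, gshift. repeat split; do 2 f_equal; unfold lpt, latpt; apply quat_ext; qunf; rewrite plus_IZR; ring.
Qed.

Lemma box3_sub N2 N3 N4 f g :
  box3 N2 N3 N4 (fun b c d => qsub (f b c d) (g b c d)) = qsub (box3 N2 N3 N4 f) (box3 N2 N3 N4 g).
Proof.
  unfold box3. rewrite <- zsum_sub. apply zsum_ext; intros. rewrite <- zsum_sub. apply zsum_ext; intros. apply zsum_sub.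
Qed.

Lemma box4_gdiff0 lam q N1 N2 N3 N4 : box4 N1 N2 N3 N4 (gdiff lam q 0) =
  qsub (box3 N2 N3 N4 (gshift lam q (Z.of_nat N1 + 1))) (box3 N2 N3 N4 (gshift lam q (- Z.of_nat N1))).
Proof.
  unfold box4. rewrite <- (zsum_tele N1 (fun n1 => box3 N2 N3 N4 (gshift lam q n1))).
  apply zsum_ext; intros n1 _. rewrite <- box3_sub. unfold box3. do 3 (apply zsum_ext; intros). apply gdiff_eq.
Qed.

Lemma box4_gdiff_bound1 lam q N1 N2 N3 N4 B :
  (forall n1 n3 n4, (qn (gshift lam q n1 (Z.of_nat N2 + 1) n3 n4) <= B /\ qn (gshift lam q n1 (- Z.of_nat N2) n3 n4) <= B)) ->
  qn (box4 N1 N2 N3 N4 (gdiff lam q 1)) <= (2 * INR N1 + 1) * ((2 * INR N3 + 1) * ((2 * INR N4 + 1) * (2 * B))).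
Proof.
  intros H. unfold box4, box3. apply zsum_bound; intros n1 _.
  replace (zsum N2 _) with (qsub (zsum N3 (fun n3 => zsum N4 (fun n4 => gshift lam q n1 (Z.of_nat N2 + 1)%Z n3 n4)))
     (zsum N3 (fun n3 => zsum N4 (fun n4 => gshift lam q n1 (- Z.of_nat N2)%Z n3 n4)))).
  - rewrite <- zsum_sub. apply zsum_bound; intros n3 _. rewrite <- zsum_sub. apply zsum_bound; intros n4 _.
    destruct (H n1 n3 n4). eapply Rle_trans; [apply qn_sub|lra].
  - rewrite <- (zsum_tele N2 (fun n2 => zsum N3 (fun n3 => zsum N4 (fun n4 => gshift lam q n1 n2 n3 n4)))).
    apply zsum_ext; intros n2 _. rewrite <- zsum_sub. apply zsum_ext; intros n3 _. rewrite <- zsum_sub. apply zsum_ext; intros n4 _.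
    symmetry; apply gdiff_eq.
Qed.

Lemma box4_gdiff_bound2 lam q N1 N2 N3 N4 B :
  (forall n1 n2 n4, (qn (gshift lam q n1 n2 (Z.of_nat N3 + 1) n4) <= B /\ qn (gshift lam q n1 n2 (- Z.of_nat N3) n4) <= B)) ->
  qn (box4 N1 N2 N3 N4 (gdiff lam q 2)) <= (2 * INR N1 + 1) * ((2 * INR N2 + 1) * ((2 * INR N4 + 1) * (2 * B))).
Proof.
  intros H. unfold box4, box3. apply zsum_bound; intros n1 _. apply zsum_bound; intros n2 _.
  replace (zsum N3 _) with (qsub (zsum N4 (fun n4 => gshift lam q n1 n2 (Z.of_nat N3 + 1)%Z n4))
     (zsum N4 (fun n4 => gshift lam q n1 n2 (- Z.of_nat N3)%Z n4))).
  - rewrite <- zsum_sub. apply zsum_bound; intros n4 _.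
    destruct (H n1 n2 n4). eapply Rle_trans; [apply qn_sub|lra].
  - rewrite <- (zsum_tele N3 (fun n3 => zsum N4 (fun n4 => gshift lam q n1 n2 n3 n4))).
    apply zsum_ext; intros n3 _. rewrite <- zsum_sub. apply zsum_ext; intros n4 _.
    symmetry; apply gdiff_eq.
Qed.

Lemma box4_gdiff_bound3 lam q N1 N2 N3 N4 B :
  (forall n1 n2 n3, (qn (gshift lam q n1 n2 n3 (Z.of_nat N4 + 1)) <= B /\ qn (gshift lam q n1 n2 n3 (- Z.of_nat N4)) <= B)) ->
  qn (box4 N1 N2 N3 N4 (gdiff lam q 3)) <= (2 * INR N1 + 1) * ((2 * INR N2 + 1) * ((2 * INR N3 + 1) * (2 * B))).
Proof.
  intros H. unfold box4, box3. apply zsum_bound; intros n1 _. apply zsum_bound; intros n2 _. apply zsum_bound; intros n3 _.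
  rewrite (zsum_ext N4 _ (fun n4 => qsub (gshift lam q n1 n2 n3 (n4 + 1)%Z) (gshift lam q n1 n2 n3 n4)))
    by (intros; apply gdiff_eq).
  rewrite (zsum_tele N4 (gshift lam q n1 n2 n3)).
  destruct (H n1 n2 n3). eapply Rle_trans; [apply qn_sub|lra].
Qed.

Lemma count_bound N a b c : (1 <= N)%nat -> forall C, 0 <= C ->
  (2 * INR (N ^ a) + 1) * ((2 * INR (N ^ b) + 1) * ((2 * INR (N ^ c) + 1) * C)) <= 27 * INR N ^ (a + b + c) * C.
Proof.
  intros HN C HC. rewrite !pow_INR. apply le_INR in HN; simpl in HN.
  assert (P : forall k, 1 <= INR N ^ k) by (intros; apply pow_R1_Rle; auto).
  replace (27 * INR N ^ (a + b + c) * C) with (3 * INR N ^ a * (3 * INR N ^ b * (3 * INR N ^ c * C))) by (rewrite !pow_add; ring).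
  assert (Pa := P a). assert (Pb := P b). assert (Pc := P c).
  repeat (apply Rmult_le_compat; repeat apply Rmult_le_pos); lra.
Qed.

(** A face with about N^e points at distance of order N^k costs N^(e - 3k). The pairs (e, k) that
    occur are (14, 5), (13, 6) and (12, 7); the first satisfies the condition with equality. *)
Lemma face_small N e k C : (1 <= N)%nat -> 0 <= C -> (e + 1 <= 3 * k)%nat ->
  27 * INR N ^ e * (2 * (C / INR (N ^ k) ^ 3)) <= 54 * C / INR N.
Proof.
  intros HN HC He. rewrite pow_INR. apply le_INR in HN; simpl in HN.
  rewrite <- pow_mult. replace (k * 3)%nat with (e + 1 + (k * 3 - (e + 1)))%nat by lia.
  rewrite !pow_add, pow_1. set (y := INR N ^ (k * 3 - (e + 1))).
  assert (1 <= y) by (apply pow_R1_Rle; auto). assert (0 < INR N ^ e) by (apply pow_lt; lra).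
  replace (27 * INR N ^ e * (2 * (C / (INR N ^ e * INR N * y)))) with (54 * C / INR N * / y) by (field; lra).
  rewrite <- (Rmult_1_r (54 * C / INR N)) at 2. apply Rmult_le_compat_l.
  - apply Rmult_le_pos; [lra|left; apply Rinv_0_lt_compat; lra].
  - rewrite <- Rinv_1. apply Rinv_le_contravar; lra.
Qed.

Lemma face_reduction lam q : 0 < det4 (Lam lam) ->
  small (fun N => qn (qsub (box4 N (N ^ 5) (N ^ 6) (N ^ 7) (fterm lam q))
    (qmul (hatlam lam 0) (qsub (box3 (N ^ 5) (N ^ 6) (N ^ 7) (gshift lam q (Z.of_nat N + 1)))
       (box3 (N ^ 5) (N ^ 6) (N ^ 7) (gshift lam q (- Z.of_nat N))))))).
Proof.
  intros HD. destruct (gshift_far lam q HD) as (C & N0 & HC & Hf).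
  set (H := qn (hatlam lam 1) + qn (hatlam lam 2) + qn (hatlam lam 3)).
  assert (P1 := qn_ge0 (hatlam lam 1)). assert (P2 := qn_ge0 (hatlam lam 2)). assert (P3 := qn_ge0 (hatlam lam 3)).
  apply small_le with (fun N => H * (54 * C) / INR N); [apply small_inv; apply Rmult_le_pos; unfold H; lra|].
  exists (S N0). intros N HN. rewrite <- box4_gdiff0.
  assert (P : forall k, (1 <= k)%nat -> (N0 <= N ^ k)%nat).
  { intros k Hk. transitivity (N ^ 1)%nat; [simpl; lia|]. apply Nat.pow_le_mono_r; lia. }
  assert (B1 : qn (box4 N (N ^ 5) (N ^ 6) (N ^ 7) (gdiff lam q 1)) <= 54 * C / INR N).
  { eapply Rle_trans; [apply box4_gdiff_bound1 with (B := C / INR (N ^ 5) ^ 3)|].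
    - intros; split; apply Hf; try (apply P; lia); lia.
    - replace N with (N ^ 1)%nat at 1 by apply Nat.pow_1_r.
      eapply Rle_trans; [apply count_bound; [lia|]|apply face_small; lia || lra].
      apply Rmult_le_pos; [lra|]. apply Rmult_le_pos; [lra|]. left; apply Rinv_0_lt_compat, pow_lt, lt_0_INR.
      assert (N ^ 5 <> 0)%nat by (apply Nat.pow_nonzero; lia). lia. }
  assert (B2 : qn (box4 N (N ^ 5) (N ^ 6) (N ^ 7) (gdiff lam q 2)) <= 54 * C / INR N).
  { eapply Rle_trans; [apply box4_gdiff_bound2 with (B := C / INR (N ^ 6) ^ 3)|].
    - intros; split; apply Hf; try (apply P; lia); lia.
    - replace N with (N ^ 1)%nat at 1 by apply Nat.pow_1_r.
      eapply Rle_trans; [apply count_bound; [lia|]|apply face_small; lia || lra].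
      apply Rmult_le_pos; [lra|]. apply Rmult_le_pos; [lra|]. left; apply Rinv_0_lt_compat, pow_lt, lt_0_INR.
      assert (N ^ 6 <> 0)%nat by (apply Nat.pow_nonzero; lia). lia. }
  assert (B3 : qn (box4 N (N ^ 5) (N ^ 6) (N ^ 7) (gdiff lam q 3)) <= 54 * C / INR N).
  { eapply Rle_trans; [apply box4_gdiff_bound3 with (B := C / INR (N ^ 7) ^ 3)|].
    - intros; split; apply Hf; try (apply P; lia); lia.
    - replace N with (N ^ 1)%nat at 1 by apply Nat.pow_1_r.
      eapply Rle_trans; [apply count_bound; [lia|]|apply face_small; lia || lra].
      apply Rmult_le_pos; [lra|]. apply Rmult_le_pos; [lra|]. left; apply Rinv_0_lt_compat, pow_lt, lt_0_INR.
      assert (N ^ 7 <> 0)%nat by (apply Nat.pow_nonzero; lia). lia. }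
  unfold fterm at 1. unfold qsum4. rewrite !box4_add, !box4_mul.
  assert (K : forall a b c d, qsub (qadd (qadd (qadd a b) c) d) a = qadd (qadd b c) d) by qring.
  replace (qsub _ _) with
    (qadd (qadd (qmul (hatlam lam 1) (box4 N (N ^ 5) (N ^ 6) (N ^ 7) (gdiff lam q 1)))
                (qmul (hatlam lam 2) (box4 N (N ^ 5) (N ^ 6) (N ^ 7) (gdiff lam q 2))))
          (qmul (hatlam lam 3) (box4 N (N ^ 5) (N ^ 6) (N ^ 7) (gdiff lam q 3))))
    by (symmetry; apply K).
  eapply Rle_trans; [apply qn_add|]. eapply Rle_trans; [apply Rplus_le_compat_r, qn_add|]. rewrite !qn_mul.
  apply (Rmult_le_compat_l _ _ _ P1) in B1. apply (Rmult_le_compat_l _ _ _ P2) in B2. apply (Rmult_le_compat_l _ _ _ P3) in B3.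
  replace (H * (54 * C) / INR N) with (qn (hatlam lam 1) * (54 * C / INR N) + qn (hatlam lam 2) * (54 * C / INR N) + qn (hatlam lam 3) * (54 * C / INR N))
    by (unfold H, Rdiv; ring).
  lra.
Qed.


(** * Sums against integrals *)

(* [V] bounds the variation of [f]; by the mean value theorem it controls each term separately. *)
Lemma rsum_primitive_variation f F V M s :
  (forall y, derivable_pt_lim F y (f y)) ->
  (forall x y, x <= y -> Rabs (f x - f y) <= V y - V x) ->
  Rabs (rsum M (fun n => f (IZR n + s)) - (F (INR M + 1 + s) - F (- INR M + s)))
    <= V (INR M + 1 + s) - V (- INR M + s).
Proof.
  intros HF HV.
  assert (Hend : forall Q : R -> R, Q (INR M + 1 + s) - Q (- INR M + s) = rsum M (fun n => Q (IZR (n + 1) + s) - Q (IZR n + s))).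
  { intros Q. rewrite (rsum_tele M (fun n => Q (IZR n + s))). rewrite plus_IZR, opp_IZR, <- INR_IZR_INZ. reflexivity. }
  rewrite !Hend, <- rsum_sub. eapply Rle_trans; [apply rsum_abs|]. apply rsum_le. intros n _.
  rewrite plus_IZR. set (x := IZR n + s). replace (IZR n + 1 + s) with (x + 1) by (unfold x; ring).
  destruct (MVT_cor2 F f x (x + 1)) as (c & E & Hc); [lra|intros; apply HF|].
  rewrite E. replace (f x - f c * (x + 1 - x)) with (f x - f c) by ring.
  assert (H1 := HV x c ltac:(lra)). assert (H2 := HV c (x + 1) ltac:(lra)).
  assert (H3 := Rabs_pos (f c - f (x + 1))). lra.
Qed.

(** An even function decreasing away from 0 has total variation at most 2 [K], whatever the shift
    [s]. The odd primitive [F] tends to the half-integral [I] up to [T], and [R] is a distance from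
    0 that both ends of the shifted range exceed. *)
Lemma rsum_unimodal f F K I T R M s :
  (forall y, derivable_pt_lim F y (f y)) ->
  (forall y, 0 <= f y) -> f 0 = K ->
  (forall x y, 0 <= x <= y -> f y <= f x) -> (forall y, f (- y) = f y) -> (forall y, F (- y) = - F y) ->
  (forall y, R <= y -> Rabs (F y - I) <= T) -> R <= INR M - Rabs s ->
  Rabs (rsum M (fun n => f (IZR n + s)) - 2 * I) <= 2 * K + 2 * T.
Proof.
  intros HF H0 HK Hdec Hev Hodd HT HR.
  (* The accumulated variation of [f]: it rises to [K] at 0 and then counts the descent
     positively. *)
  set (V := fun y => if Rle_dec y 0 then f y else 2 * K - f y).
  assert (Hmax : forall y, f y <= K).
  { intros y. rewrite <- HK. destruct (Rle_dec 0 y); [apply Hdec; lra|].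
    rewrite <- Hev. apply Hdec; lra. }
  assert (Hinc : forall x y, x <= y <= 0 -> f x <= f y).
  { intros x y H. rewrite <- (Hev x), <- (Hev y). apply Hdec; lra. }
  assert (HV : forall x y, x <= y -> Rabs (f x - f y) <= V y - V x).
  { intros x y H. unfold V. assert (Mx := Hmax x). assert (My := Hmax y).
    destruct (Rle_dec y 0), (Rle_dec x 0); try lra; apply Rabs_le.
    - specialize (Hinc x y); lra.
    - lra.
    - specialize (Hdec x y); lra. }
  assert (Hvb : forall y, 0 <= V y <= 2 * K).
  { intros y; unfold V. assert (My := Hmax y). assert (Py := H0 y). destruct (Rle_dec y 0); lra. }
  assert (Hmain := rsum_primitive_variation f F V M s HF HV).
  assert (B1 := Hvb (INR M + 1 + s)). assert (B2 := Hvb (- INR M + s)).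
  assert (Hs := Rle_abs s). assert (Hs' := Rle_abs (- s)). rewrite Rabs_Ropp in Hs'.
  assert (T1 := HT (INR M + 1 + s) ltac:(lra)). assert (T2 := HT (INR M - s) ltac:(lra)).
  replace (- INR M + s) with (- (INR M - s)) in * by ring. rewrite Hodd in Hmain.
  apply Rabs_le_between in Hmain. apply Rabs_le_between in T1. apply Rabs_le_between in T2.
  apply Rabs_le. lra.
Qed.

Lemma atan_bounds t : 0 <= t -> t / (1 + t ^ 2) <= atan t <= t.
Proof.
  intros Ht. destruct (Req_dec t 0) as [->|Hn].
  { rewrite atan_0. unfold Rdiv; rewrite Rmult_0_l. lra. }
  destruct (MVT_cor2 atan (fun x => / (1 + x ^ 2)) 0 t) as (c & E & Hc); [lra| |].
  { intros; apply derivable_pt_lim_atan. }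
  rewrite atan_0 in E. replace (atan t) with (/ (1 + c ^ 2) * t) by lra.
  assert (c ^ 2 <= t ^ 2) by (apply pow_incr; lra). assert (0 <= c ^ 2) by apply pow2_ge_0.
  split.
  - unfold Rdiv. rewrite Rmult_comm. apply Rmult_le_compat_r; [lra|]. apply Rinv_le_contravar; lra.
  - rewrite <- (Rmult_1_l t) at 2. apply Rmult_le_compat_r; [lra|].
    rewrite <- Rinv_1. apply Rinv_le_contravar; lra.
Qed.

Lemma sumsq_pos a x : 0 < a -> 0 < a ^ 2 + x ^ 2.
Proof. intros. assert (0 < a ^ 2) by (apply pow_lt; auto). assert (0 <= x ^ 2) by apply pow2_ge_0. lra. Qed.

Lemma sumsq_mono a s x y : 0 < a -> 0 < s -> 0 <= x <= y -> a ^ 2 + (s * x) ^ 2 <= a ^ 2 + (s * y) ^ 2.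
Proof. intros. apply Rplus_le_compat_l, pow_incr. nra. Qed.

(** This lemma and the next two integrate out one index each: r^(-4) becomes a^(-3), then a^(-2),
    then a^(-1), with factors PI/2, 2 and PI. Their product is the PI^2 of a single face. The error
    is twice the peak value plus a tail that does not involve [a]. *)
Lemma rsum_inv_sq4 a s R M t : 0 < a -> 0 < s -> 0 < R -> R <= INR M - Rabs t ->
  Rabs (rsum M (fun n => / (a ^ 2 + (s * (IZR n + t)) ^ 2) ^ 2) - PI / (2 * a ^ 3 * s))
    <= 2 * / a ^ 4 + / (s ^ 4 * R ^ 3).
Proof.
  intros Ha Hs HR HM.
  replace (PI / (2 * a ^ 3 * s)) with (2 * (PI / (4 * a ^ 3 * s))) by (field; lra).
  replace (/ (s ^ 4 * R ^ 3)) with (2 * (/ (2 * s ^ 4 * R ^ 3))) by (field; lra).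
  apply (rsum_unimodal (fun y => / (a ^ 2 + (s * y) ^ 2) ^ 2)
    (fun y => y / (2 * a ^ 2 * (a ^ 2 + (s * y) ^ 2)) + atan (s * y / a) / (2 * a ^ 3 * s))) with (R := R); auto.
  - intros y. apply is_derive_Reals. assert (H := sumsq_pos a (s * y) Ha). auto_derive.
    + simpl in *. apply Rgt_not_eq. assert (0 < a * (a * 1)) by nra. nra.
    + field. repeat split; lra.
  - intros y. left. apply Rinv_0_lt_compat, pow_lt, sumsq_pos; auto.
  - field. lra.
  - intros x y H. apply Rinv_le_contravar; [apply pow_lt, sumsq_pos; auto|].
    apply pow_incr. split; [left; apply sumsq_pos; auto|]. apply sumsq_mono; auto.
  - intros y. do 2 f_equal. ring.
  - intros y. replace (s * - y / a) with (- (s * y / a)) by (field; lra). rewrite atan_opp.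
    replace ((s * - y) ^ 2) with ((s * y) ^ 2) by ring. field.
    assert (H := sumsq_pos a (s * y) Ha). repeat split; lra.
  - intros y Hy. assert (H := sumsq_pos a (s * y) Ha).
    assert (Hu : 0 < a / (s * y)) by (apply Rdiv_lt_0_compat; nra).
    (* Passing to the complementary angle cancels the limit of the primitive and leaves a small
       argument t = a / (s y). *)
    assert (Hat : atan (s * y / a) = PI / 2 - atan (a / (s * y))).
    { rewrite <- atan_inv by auto. f_equal. field. split; lra. }
    rewrite Hat. destruct (atan_bounds (a / (s * y)) ltac:(lra)) as [L U].
    set (v := atan (a / (s * y))) in *.
    replace (y / (2 * a ^ 2 * (a ^ 2 + (s * y) ^ 2)) + (PI / 2 - v) / (2 * a ^ 3 * s) - PI / (4 * a ^ 3 * s))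
      with ((a / (s * y) / (1 + (a / (s * y)) ^ 2) - v) / (2 * a ^ 3 * s)).
    2: { field. repeat split; try lra. }
    unfold Rdiv at 1. rewrite Rabs_mult, (Rabs_pos_eq (/ _)) by (left; apply Rinv_0_lt_compat; assert (0 < a ^ 3) by (apply pow_lt; auto); nra).
    rewrite Rabs_minus_sym, Rabs_pos_eq by lra.
    (* Both t / (1 + t^2) and atan t agree with t to first order; their difference is of order t^3,
       which cancels the factor a^(-3). *)
    apply Rle_trans with ((a / (s * y) - a / (s * y) / (1 + (a / (s * y)) ^ 2)) * / (2 * a ^ 3 * s)).
    + apply Rmult_le_compat_r; [left; apply Rinv_0_lt_compat; assert (0 < a ^ 3) by (apply pow_lt; auto); nra|lra].
    + replace ((a / (s * y) - a / (s * y) / (1 + (a / (s * y)) ^ 2)) * / (2 * a ^ 3 * s)) with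
        (/ (2 * s ^ 2 * y * (a ^ 2 + (s * y) ^ 2))) by (field; repeat split; lra).
      assert (0 < s ^ 2) by (apply pow_lt; auto). assert (0 < s ^ 4) by (apply pow_lt; auto).
      assert (0 < R ^ 3) by (apply pow_lt; auto). assert (R ^ 3 <= y ^ 3) by (apply pow_incr; lra).
      apply Rinv_le_contravar; [nra|].
      apply Rle_trans with (2 * s ^ 2 * y * (s * y) ^ 2).
      * replace (2 * s ^ 2 * y * (s * y) ^ 2) with (2 * s ^ 4 * y ^ 3) by ring. apply Rmult_le_compat_l; lra.
      * apply Rmult_le_compat_l; [nra|]. assert (0 <= a ^ 2) by apply pow2_ge_0. lra.
Qed.

Lemma rsum_inv_sq3 a s R M t : 0 < a -> 0 < s -> 0 < R -> R <= INR M - Rabs t ->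
  Rabs (rsum M (fun n => / sqrt (a ^ 2 + (s * (IZR n + t)) ^ 2) ^ 3) - 2 / (a ^ 2 * s))
    <= 2 * / a ^ 3 + / (s ^ 3 * R ^ 2).
Proof.
  intros Ha Hs HR HM.
  replace (2 / (a ^ 2 * s)) with (2 * (/ (a ^ 2 * s))) by (field; lra).
  replace (/ (s ^ 3 * R ^ 2)) with (2 * (/ (2 * s ^ 3 * R ^ 2))) by (field; lra).
  assert (Hp : forall y, 0 < sqrt (a ^ 2 + (s * y) ^ 2)) by (intros; apply sqrt_lt_R0, sumsq_pos; auto).
  assert (H2 : forall y, sqrt (a ^ 2 + (s * y) ^ 2) ^ 2 = a ^ 2 + (s * y) ^ 2)
    by (intros; apply pow2_sqrt; left; apply sumsq_pos; auto).
  apply (rsum_unimodal (fun y => / sqrt (a ^ 2 + (s * y) ^ 2) ^ 3)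
    (fun y => y / (a ^ 2 * sqrt (a ^ 2 + (s * y) ^ 2)))) with (R := R); auto.
  - intros y. apply is_derive_Reals. assert (H := sumsq_pos a (s * y) Ha).
    assert (Hy := Hp y). assert (Hy2 := H2 y).
    auto_derive.
    + simpl in *; split; [lra|split;[|auto]]. apply Rgt_not_eq. assert (0 < a * (a * 1)) by nra. nra.
    + replace (a * (a * 1) + s * y * (s * y * 1)) with (a ^ 2 + (s * y) ^ 2) by ring.
      set (r := sqrt (a ^ 2 + (s * y) ^ 2)) in *.
      (* Eliminating [a] in favour of the square root [r] makes the identity rational, so that
         [field] decides it. *)
      replace (a * (a * 1)) with (r ^ 2 - (s * y) ^ 2) by (rewrite Hy2; ring).
      assert (r ^ 2 - (s * y) ^ 2 <> 0) by (rewrite Hy2; assert (0 < a ^ 2) by (apply pow_lt; auto); lra).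
      field. split; [|lra]. simpl in *; lra.
  - intros y. left. apply Rinv_0_lt_compat, pow_lt; auto.
  - replace (a ^ 2 + (s * 0) ^ 2) with (a ^ 2) by ring. rewrite sqrt_pow2 by lra. reflexivity.
  - intros x y H. apply Rinv_le_contravar; [apply pow_lt; auto|].
    apply pow_incr. split; [left; auto|]. apply sqrt_le_1_alt, sumsq_mono; auto.
  - intros y. do 3 f_equal. ring.
  - intros y. replace ((s * - y) ^ 2) with ((s * y) ^ 2) by ring. field. assert (Hy := Hp y). split; lra.
  - intros y Hy. assert (P := Hp y). assert (Q := H2 y). set (r := sqrt (a ^ 2 + (s * y) ^ 2)) in *.
    assert (Hsy : 0 < s * y) by nra.
    assert (Hr : s * y <= r) by (apply Rnot_lt_le; intros HH; assert (0 < a ^ 2) by (apply pow_lt; auto); nra).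
    (* This factorisation rationalises the difference between the primitive and its limit: the
       vanishing factor r - s y cancels. *)
    assert (Ha2 : a ^ 2 = (r - s * y) * (r + s * y)) by (replace ((r - s * y) * (r + s * y)) with (r ^ 2 - (s * y) ^ 2) by ring; lra).
    assert (Hne : r - s * y <> 0) by (intros HH; rewrite HH in Ha2; assert (0 < a ^ 2) by (apply pow_lt; auto); lra).
    rewrite Rabs_minus_sym, Rabs_pos_eq.
    + rewrite Ha2. replace (/ ((r - s * y) * (r + s * y) * s) - y / ((r - s * y) * (r + s * y) * r)) with (/ (s * r * (r + s * y))) by (field; repeat split; lra).
      assert (0 < s ^ 3) by (apply pow_lt; auto). assert (0 < R ^ 2) by (apply pow_lt; auto).
      apply Rinv_le_contravar; [nra|].
      assert (R ^ 2 <= y ^ 2) by (apply pow_incr; lra).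
      apply Rle_trans with (s * (s * y) * (2 * (s * y))).
      * replace (s * (s * y) * (2 * (s * y))) with (2 * s ^ 3 * y ^ 2) by ring. apply Rmult_le_compat_l; lra.
      * apply Rmult_le_compat; nra.
    + rewrite Ha2. replace (/ ((r - s * y) * (r + s * y) * s) - y / ((r - s * y) * (r + s * y) * r)) with (/ (s * r * (r + s * y))) by (field; repeat split; lra).
      left; apply Rinv_0_lt_compat. repeat apply Rmult_lt_0_compat; lra.
Qed.

Lemma rsum_inv_sq2 a s R M t : 0 < a -> 0 < s -> 0 < R -> R <= INR M - Rabs t ->
  Rabs (rsum M (fun n => / (a ^ 2 + (s * (IZR n + t)) ^ 2)) - PI / (s * a))
    <= 2 * / a ^ 2 + 2 * / (s ^ 2 * R).
Proof.
  intros Ha Hs HR HM.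
  replace (PI / (s * a)) with (2 * (PI / (2 * s * a))) by (field; lra).
  apply (rsum_unimodal (fun y => / (a ^ 2 + (s * y) ^ 2)) (fun y => atan (s * y / a) / (s * a))) with (R := R); auto.
  - intros y. apply is_derive_Reals. assert (H := sumsq_pos a (s * y) Ha). auto_derive.
    + auto.
    + field. repeat split; lra.
  - intros y. left. apply Rinv_0_lt_compat, sumsq_pos; auto.
  - f_equal. ring.
  - intros x y H. apply Rinv_le_contravar; [apply sumsq_pos; auto|]. apply sumsq_mono; auto.
  - intros y. do 2 f_equal. ring.
  - intros y. replace (s * - y / a) with (- (s * y / a)) by (field; lra). rewrite atan_opp. field; lra.
  - intros y Hy. assert (Hu : 0 < a / (s * y)) by (apply Rdiv_lt_0_compat; nra).
    assert (Hat : atan (s * y / a) = PI / 2 - atan (a / (s * y))).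
    { rewrite <- atan_inv by auto. f_equal. field. split; lra. }
    rewrite Hat. destruct (atan_bounds (a / (s * y)) ltac:(lra)) as [L U].
    assert (0 < a / (s * y) / (1 + (a / (s * y)) ^ 2)).
    { apply Rdiv_lt_0_compat; auto. assert (0 <= (a / (s * y)) ^ 2) by apply pow2_ge_0. lra. }
    set (v := atan (a / (s * y))) in *.
    replace ((PI / 2 - v) / (s * a) - PI / (2 * s * a)) with (- (v / (s * a))) by (field; lra).
    assert (Hsa : 0 < / (s * a)) by (apply Rinv_0_lt_compat; nra).
    rewrite Rabs_Ropp, Rabs_pos_eq by (apply Rmult_le_pos; lra).
    apply Rle_trans with (a / (s * y) / (s * a)); [apply Rmult_le_compat_r; lra|].
    replace (a / (s * y) / (s * a)) with (/ (s ^ 2 * y)) by (field; lra).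
    assert (0 < s ^ 2) by (apply pow_lt; auto).
    apply Rinv_le_contravar; [nra|]. apply Rmult_le_compat_l; lra.
Qed.


(** * Trading powers of the distance for summable weights *)

(** With X = y^4, the power X^(-(j+1)) has 4j + 4 factors 1/y. Five go into each of j weights, and
    the remaining 4 - j, at least one for j <= 3, give the decay [/ rootN N]. The three lemmas on
    inverse powers below are the cases j = 1, 2, 3. *)
Lemma fourth_root_ge N X : 1 + INR N <= X ->
  exists y, 1 <= y /\ y ^ 4 = X /\ (forall k, 0 < / y ^ k) /\ / y <= / rootN N /\
   (forall n, 1 + IZR (Z.abs n) <= X -> / y ^ 5 <= wt n).
Proof.
  intros H. assert (HN := pos_INR N). destruct (fourth_root X) as (y & Hy & E); [lra|].
  assert (Hr : rootN N <= y).
  { apply Rnot_lt_le; intros Hlt. assert (Hg := rootN_ge1 N).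
    assert (H4 : rootN N ^ 4 = 1 + INR N) by (unfold rootN; rewrite root4_pow4, Z.abs_eq, <- INR_IZR_INZ by lia; auto).
    assert (y ^ 2 < rootN N ^ 2) by nra. assert (0 < y ^ 2) by (apply pow_lt; auto).
    replace (y ^ 4) with (y ^ 2 * y ^ 2) in E by ring.
    replace (rootN N ^ 4) with (rootN N ^ 2 * rootN N ^ 2) in H4 by ring. nra. }
  assert (Hg := rootN_ge1 N). exists y. split; [lra|]. split; [auto|].
  split; [intros; apply Rinv_0_lt_compat, pow_lt; auto|].
  split; [apply Rinv_le_contravar; lra|].
  intros n Hn. apply inv_pow5_le_wt; auto. rewrite E; auto.
Qed.

Lemma inv_pow_shrink y k : 1 <= y -> / y ^ S k <= / y.
Proof.
  intros H. apply Rinv_le_contravar; [lra|]. rewrite <- (pow_1 y) at 1. apply Rle_pow; auto; lia.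
Qed.

Lemma inv_pow2_le_wt1 N X n2 : 1 + INR N <= X -> 1 + IZR (Z.abs n2) <= X -> / X ^ 2 <= wt n2 * / rootN N.
Proof.
  intros H H2. destruct (fourth_root_ge N X H) as (y & Hy & <- & Hk & Hr & Hw).
  replace (/ (y ^ 4) ^ 2) with (/ y ^ 5 * / y ^ 3) by (field; lra).
  assert (A5 := Hk 5%nat). assert (A3 := Hk 3%nat). assert (S := inv_pow_shrink y 2 Hy).
  assert (W := Hw n2 H2). apply Rmult_le_compat; lra.
Qed.

Lemma inv_pow3_le_wt2 N X n2 n3 : 1 + INR N <= X -> 1 + IZR (Z.abs n2) <= X -> 1 + IZR (Z.abs n3) <= X ->
  / X ^ 3 <= wt n2 * (wt n3 * / rootN N).
Proof.
  intros H H2 H3. destruct (fourth_root_ge N X H) as (y & Hy & <- & Hk & Hr & Hw).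
  replace (/ (y ^ 4) ^ 3) with (/ y ^ 5 * (/ y ^ 5 * / y ^ 2)) by (field; lra).
  assert (A5 := Hk 5%nat). assert (A3 := Hk 2%nat). assert (S := inv_pow_shrink y 1 Hy).
  assert (W2 := Hw n2 H2). assert (W3 := Hw n3 H3).
  repeat apply Rmult_le_compat; try lra. apply Rmult_le_pos; lra.
Qed.

Lemma inv_pow4_le_wt3 N X n2 n3 n4 : 1 + INR N <= X ->
  1 + IZR (Z.abs n2) <= X -> 1 + IZR (Z.abs n3) <= X -> 1 + IZR (Z.abs n4) <= X ->
  / X ^ 4 <= wt n2 * (wt n3 * (wt n4 * / rootN N)).
Proof.
  intros H H2 H3 H4. destruct (fourth_root_ge N X H) as (y & Hy & <- & Hk & Hr & Hw).
  replace (/ (y ^ 4) ^ 4) with (/ y ^ 5 * (/ y ^ 5 * (/ y ^ 5 * / y))) by (field; lra).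
  assert (A5 := Hk 5%nat). assert (A1 := Hk 1%nat). rewrite pow_1 in A1.
  assert (W2 := Hw n2 H2). assert (W3 := Hw n3 H3). assert (W4 := Hw n4 H4).
  repeat (apply Rmult_le_compat; repeat apply Rmult_le_pos; try lra).
Qed.

Lemma rsum_wt_le N f c : 0 <= c -> (forall n, f n <= wt n * c) -> rsum N f <= 9 * c.
Proof.
  intros Hc H. eapply Rle_trans; [apply rsum_le; intros n _; apply H|].
  rewrite (rsum_ext _ _ (fun n => c * wt n)) by (intros; ring). rewrite rsum_mul.
  assert (W := wsum_bound N). unfold wsum in W. nra.
Qed.

Lemma pow_count N k : (1 <= N)%nat -> 0 <= 2 * INR (N ^ k) + 1 <= 3 * INR N ^ k.
Proof.
  intros HN. rewrite pow_INR. apply le_INR in HN; simpl in HN.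
  assert (1 <= INR N ^ k) by (apply pow_R1_Rle; auto). lra.
Qed.

(** * The triple sum over one face, one index at a time *)

Section TripleSum.
Variables s1 s2 s3 s4 be ga de : R.
Hypotheses (P1 : 0 < s1) (P2 : 0 < s2) (P3 : 0 < s3) (P4 : 0 < s4).

(** The squared norm on a face with squares completed, nested so that each form is the next smaller
    one plus one square. An inner sum is then a shifted one-variable sum whose [a ^ 2] is the
    smaller form; [de], [be] and [ga] are the shears. *)
Definition quadform2 (x : R) (n2 : Z) : R := (s1 * x) ^ 2 + (s2 * IZR n2) ^ 2.
Definition quadform3 (x : R) (n2 n3 : Z) : R := quadform2 x n2 + (s3 * (IZR n3 + de * IZR n2)) ^ 2.
Definition quadform4 (x : R) (n2 n3 n4 : Z) : R :=
  quadform3 x n2 n3 + (s4 * (IZR n4 + (be * IZR n3 + ga * IZR n2))) ^ 2.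

Lemma quadform2_pos x n2 : 0 < x -> 0 < quadform2 x n2.
Proof. intros; apply sumsq_pos. nra. Qed.

Lemma quadform3_pos x n2 n3 : 0 < x -> 0 < quadform3 x n2 n3.
Proof. intros H; unfold quadform3. assert (H1 := quadform2_pos x n2 H). assert (0 <= (s3 * (IZR n3 + de * IZR n2)) ^ 2) by apply pow2_ge_0. lra. Qed.

Lemma abs_le_sqrt u a : 0 <= a -> u ^ 2 <= a ^ 2 -> Rabs u <= a.
Proof.
  intros Ha H. apply Rnot_lt_le; intros Hlt. rewrite <- (pow2_abs u) in H. nra.
Qed.

(** One constant for all the lower bounds: 2 / s1 serves 1 + N <= 2 x, and the term with [Rabs de]
    is the price of undoing the shear when [n3] is bounded. *)
Definition quadform_scale : R := 2 / s1 + (1 + Rabs de) / s2 + / s3 + / s2.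

Lemma quadform_scale_pos : 0 < quadform_scale.
Proof.
  unfold quadform_scale. assert (H := Rabs_pos de). 
  assert (0 < / s1) by (apply Rinv_0_lt_compat; auto). assert (0 < / s2) by (apply Rinv_0_lt_compat; auto).
  assert (0 < / s3) by (apply Rinv_0_lt_compat; auto). unfold Rdiv. nra.
Qed.

Lemma quadform3_lower N x n2 n3 : (1 <= N)%nat -> INR N <= x ->
  let a := sqrt (quadform3 x n2 n3) in
  0 < a /\ s1 * x <= a /\ 1 + INR N <= quadform_scale * a /\ 1 + IZR (Z.abs n2) <= quadform_scale * a /\ 1 + IZR (Z.abs n3) <= quadform_scale * a.
Proof.
  intros HN Hx a. apply le_INR in HN; simpl in HN.
  assert (Hq := quadform3_pos x n2 n3 ltac:(lra)).
  assert (Ha : 0 < a) by (apply sqrt_lt_R0; auto).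
  assert (Ha2 : a ^ 2 = quadform3 x n2 n3) by (apply pow2_sqrt; lra).
  unfold quadform3, quadform2 in Ha2.
  assert (Q1 := pow2_ge_0 (s1 * x)). assert (Q2 := pow2_ge_0 (s2 * IZR n2)). assert (Q3 := pow2_ge_0 (s3 * (IZR n3 + de * IZR n2))).
  assert (B1 : Rabs (s1 * x) <= a) by (apply abs_le_sqrt; lra).
  assert (B2 : Rabs (s2 * IZR n2) <= a) by (apply abs_le_sqrt; lra).
  assert (B3 : Rabs (s3 * (IZR n3 + de * IZR n2)) <= a) by (apply abs_le_sqrt; lra).
  rewrite Rabs_mult, Rabs_pos_eq in B1 by lra. rewrite (Rabs_pos_eq x) in B1 by lra.
  rewrite Rabs_mult, Rabs_pos_eq in B2 by lra. rewrite Rabs_mult, Rabs_pos_eq in B3 by lra.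
  assert (I1 : x <= a / s1) by (apply Rmult_le_reg_l with s1; auto; replace (s1 * (a / s1)) with a by (field; lra); lra).
  assert (I2 : Rabs (IZR n2) <= a / s2) by (apply Rmult_le_reg_l with s2; auto; replace (s2 * (a / s2)) with a by (field; lra); lra).
  assert (I3 : Rabs (IZR n3 + de * IZR n2) <= a / s3) by (apply Rmult_le_reg_l with s3; auto; replace (s3 * (a / s3)) with a by (field; lra); lra).
  assert (I4 : Rabs (IZR n3) <= a / s3 + Rabs de * (a / s2)).
  { replace (IZR n3) with ((IZR n3 + de * IZR n2) + - (de * IZR n2)) by ring.
    eapply Rle_trans; [apply Rabs_triang|]. rewrite Rabs_Ropp, Rabs_mult.
    assert (Rabs de * Rabs (IZR n2) <= Rabs de * (a / s2)) by (apply Rmult_le_compat_l; auto; apply Rabs_pos). lra. }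
  rewrite <- !Rabs_Zabs.
  assert (E : quadform_scale * a = 2 * (a / s1) + a / s2 + Rabs de * (a / s2) + a / s3 + a / s2) by (unfold quadform_scale; field; lra).
  assert (Z1 : 0 < a / s1) by (apply Rdiv_lt_0_compat; auto). assert (Z2 : 0 < a / s2) by (apply Rdiv_lt_0_compat; auto).
  assert (Z3 : 0 < a / s3) by (apply Rdiv_lt_0_compat; auto).
  assert (Z4 : 0 <= Rabs de * (a / s2)) by (apply Rmult_le_pos; [apply Rabs_pos|lra]).
  rewrite E. repeat split; lra.
Qed.

Lemma quadform2_lower N x n2 : (1 <= N)%nat -> INR N <= x ->
  let b := sqrt (quadform2 x n2) in
  0 < b /\ s1 * x <= b /\ 1 + INR N <= quadform_scale * b /\ 1 + IZR (Z.abs n2) <= quadform_scale * b.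
Proof.
  intros HN Hx b. apply le_INR in HN; simpl in HN.
  assert (Hq := quadform2_pos x n2 ltac:(lra)).
  assert (Hb : 0 < b) by (apply sqrt_lt_R0; auto).
  assert (Hb2 : b ^ 2 = quadform2 x n2) by (apply pow2_sqrt; lra).
  unfold quadform2 in Hb2.
  assert (Q1 := pow2_ge_0 (s1 * x)). assert (Q2 := pow2_ge_0 (s2 * IZR n2)).
  assert (B1 : Rabs (s1 * x) <= b) by (apply abs_le_sqrt; lra).
  assert (B2 : Rabs (s2 * IZR n2) <= b) by (apply abs_le_sqrt; lra).
  rewrite Rabs_mult, Rabs_pos_eq in B1 by lra. rewrite (Rabs_pos_eq x) in B1 by lra.
  rewrite Rabs_mult, Rabs_pos_eq in B2 by lra.
  assert (I1 : x <= b / s1) by (apply Rmult_le_reg_l with s1; auto; replace (s1 * (b / s1)) with b by (field; lra); lra).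
  assert (I2 : Rabs (IZR n2) <= b / s2) by (apply Rmult_le_reg_l with s2; auto; replace (s2 * (b / s2)) with b by (field; lra); lra).
  rewrite <- !Rabs_Zabs.
  assert (E : quadform_scale * b = 2 * (b / s1) + b / s2 + Rabs de * (b / s2) + b / s3 + b / s2) by (unfold quadform_scale; field; lra).
  assert (Z1 : 0 < b / s1) by (apply Rdiv_lt_0_compat; auto). assert (Z2 : 0 < b / s2) by (apply Rdiv_lt_0_compat; auto).
  assert (Z3 : 0 < b / s3) by (apply Rdiv_lt_0_compat; auto).
  assert (Z4 : 0 <= Rabs de * (b / s2)) by (apply Rmult_le_pos; [apply Rabs_pos|lra]).
  rewrite E. repeat split; lra.
Qed.

(** The peak error 2 / a^4, multiplied by x <= a / s1, is of order a^(-3), summable over two indices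
    with decay to spare. The tail T is of order N^(-21) and occurs x times about N^11 times, hence
    N^(-9) in all. *)
Lemma sum_n4_limit : exists C N0, 0 <= C /\ forall N x, (N0 <= N)%nat -> INR N <= x <= INR N + 1 ->
  Rabs (x * rsum (N ^ 5) (fun n2 => rsum (N ^ 6) (fun n3 => rsum (N ^ 7) (fun n4 => / quadform4 x n2 n3 n4 ^ 2)))
   - x * rsum (N ^ 5) (fun n2 => rsum (N ^ 6) (fun n3 => PI / (2 * sqrt (quadform3 x n2 n3) ^ 3 * s4))))
  <= C / rootN N + C / INR N.
Proof.
  destruct (INR_unbounded (2 * (Rabs be + Rabs ga))) as [N0 HN0].
  assert (Hc := quadform_scale_pos).
  assert (HC1 : 0 <= 162 * quadform_scale ^ 3 / s1) by (apply Rmult_le_pos; [assert (0 < quadform_scale ^ 3) by (apply pow_lt; auto); lra|left; apply Rinv_0_lt_compat; auto]).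
  assert (HC2 : 0 <= 144 / s4 ^ 4) by (apply Rmult_le_pos; [lra|left; apply Rinv_0_lt_compat, pow_lt; auto]).
  exists (162 * quadform_scale ^ 3 / s1 + 144 / s4 ^ 4), (S N0). split; [lra|]. intros N x HN Hx.
  assert (HN1 : 1 <= INR N) by (change 1 with (INR 1); apply le_INR; lia).
  assert (HNN : 2 * (Rabs be + Rabs ga) <= INR N) by (assert (INR N0 <= INR N) by (apply le_INR; lia); lra).
  set (T := / (s4 ^ 4 * (INR N ^ 7 / 2) ^ 3)).
  assert (HT : 0 < T) by (apply Rinv_0_lt_compat, Rmult_lt_0_compat; apply pow_lt; auto; assert (0 < INR N ^ 7) by (apply pow_lt; lra); lra).
  rewrite <- Rmult_minus_distr_l, <- rsum_sub.
  assert (H4 : forall n2 n3, inbox (N ^ 5) n2 -> inbox (N ^ 6) n3 ->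
    Rabs (x * (rsum (N ^ 7) (fun n4 => / quadform4 x n2 n3 n4 ^ 2) - PI / (2 * sqrt (quadform3 x n2 n3) ^ 3 * s4)))
     <= wt n2 * (wt n3 * (2 * quadform_scale ^ 3 / s1 * / rootN N)) + x * T).
  { intros n2 n3 I2 I3. destruct (quadform3_lower N x n2 n3 ltac:(lia) ltac:(lra)) as (Ha & Hax & X1 & X2 & X3).
    set (a := sqrt (quadform3 x n2 n3)) in *.
    assert (Ha2 : a ^ 2 = quadform3 x n2 n3) by (apply pow2_sqrt; left; apply quadform3_pos; lra).
    (* The growing exponents enter here: the shear is of order N^6 and moves the centre by less than
       half of the range N^7. *)
    assert (HR : INR N ^ 7 / 2 <= INR (N ^ 7) - Rabs (be * IZR n3 + ga * IZR n2)).
    { rewrite pow_INR. assert (Rabs (be * IZR n3 + ga * IZR n2) <= INR N ^ 7 / 2); [|lra].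
      assert (K3 : Rabs (IZR n3) <= INR N ^ 6) by (rewrite Rabs_Zabs, <- pow_INR, INR_IZR_INZ; apply IZR_le, I3).
      assert (K2 : Rabs (IZR n2) <= INR N ^ 6).
      { apply Rle_trans with (INR N ^ 5); [rewrite Rabs_Zabs, <- pow_INR, INR_IZR_INZ; apply IZR_le, I2|apply Rle_pow; auto; lia]. }
      eapply Rle_trans; [apply Rabs_triang|]. rewrite !Rabs_mult.
      assert (Rabs be * Rabs (IZR n3) <= Rabs be * INR N ^ 6) by (apply Rmult_le_compat_l; auto; apply Rabs_pos).
      assert (Rabs ga * Rabs (IZR n2) <= Rabs ga * INR N ^ 6) by (apply Rmult_le_compat_l; auto; apply Rabs_pos).
      assert (2 * (Rabs be + Rabs ga) * INR N ^ 6 <= INR N * INR N ^ 6) by (apply Rmult_le_compat_r; auto; apply pow_le; lra).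
      change (INR N ^ 7) with (INR N * INR N ^ 6). lra. }
    assert (HM := rsum_inv_sq4 a s4 (INR N ^ 7 / 2) (N ^ 7) (be * IZR n3 + ga * IZR n2) Ha P4
      ltac:(assert (0 < INR N ^ 7) by (apply pow_lt; lra); lra) HR). fold T in HM.
    unfold quadform4. rewrite <- Ha2. rewrite Rabs_mult, (Rabs_pos_eq x) by lra.
    eapply Rle_trans; [apply Rmult_le_compat_l; [lra|apply HM]|]. rewrite Rmult_plus_distr_l. apply Rplus_le_compat_r.
    apply Rle_trans with (2 * quadform_scale ^ 3 / s1 * / (quadform_scale * a) ^ 3).
    - replace (2 * quadform_scale ^ 3 / s1 * / (quadform_scale * a) ^ 3) with (a / s1 * (2 * / a ^ 4)) by (field; repeat split; lra).
      apply Rmult_le_compat_r.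
      + assert (0 < / a ^ 4) by (apply Rinv_0_lt_compat, pow_lt; auto). lra.
      + apply Rmult_le_reg_l with s1; auto. replace (s1 * (a / s1)) with a by (field; lra). lra.
    - replace (wt n2 * (wt n3 * (2 * quadform_scale ^ 3 / s1 * / rootN N))) with (2 * quadform_scale ^ 3 / s1 * (wt n2 * (wt n3 * / rootN N))) by ring.
      apply Rmult_le_compat_l; [|apply inv_pow3_le_wt2; auto].
      replace (2 * quadform_scale ^ 3 / s1) with (162 * quadform_scale ^ 3 / s1 / 81) by (field; lra). lra. }
  rewrite <- rsum_mul.
  assert (Hr : 0 < / rootN N) by (apply Rinv_0_lt_compat; assert (H := rootN_ge1 N); lra).
  set (A := 2 * quadform_scale ^ 3 / s1 * / rootN N) in *.
  assert (HA : 0 <= A).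
  { unfold A. apply Rmult_le_pos; [|lra]. replace (2 * quadform_scale ^ 3 / s1) with (162 * quadform_scale ^ 3 / s1 / 81) by (field; lra). lra. }
  apply Rle_trans with (rsum (N ^ 5) (fun n2 => rsum (N ^ 6) (fun n3 => wt n2 * (wt n3 * A) + x * T))).
  - eapply Rle_trans; [apply rsum_abs|]. apply rsum_le. intros n2 I2. rewrite <- rsum_sub, <- rsum_mul.
    eapply Rle_trans; [apply rsum_abs|]. apply rsum_le. intros n3 I3. apply H4; auto.
  - apply Rle_trans with (rsum (N ^ 5) (fun n2 => wt n2 * (9 * A) + (2 * INR (N ^ 6) + 1) * (x * T))).
    { apply rsum_le. intros n2 _. rewrite rsum_add, rsum_const, rsum_mul. apply Rplus_le_compat_r.
      apply Rmult_le_compat_l; [left; apply wt_pos|]. apply rsum_wt_le; auto. intros; lra. }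
    rewrite rsum_add, rsum_const.
    assert (B1 : rsum (N ^ 5) (fun n2 => wt n2 * (9 * A)) <= 9 * (9 * A)) by (apply rsum_wt_le; [lra|intros; lra]).
    assert (B2 : (2 * INR (N ^ 5) + 1) * ((2 * INR (N ^ 6) + 1) * (x * T)) <= 144 / s4 ^ 4 / INR N).
    { apply Rle_trans with (3 * INR N ^ 5 * (3 * INR N ^ 6 * (2 * INR N * T))).
      - assert (K5 := pow_count N 5 ltac:(lia)). assert (K6 := pow_count N 6 ltac:(lia)).
        assert (0 <= x * T <= 2 * INR N * T).
        { split; [apply Rmult_le_pos; lra|apply Rmult_le_compat_r; lra]. }
        apply Rmult_le_compat; try lra; [apply Rmult_le_pos; lra|]. apply Rmult_le_compat; lra.
      - unfold T. replace (3 * INR N ^ 5 * (3 * INR N ^ 6 * (2 * INR N * / (s4 ^ 4 * (INR N ^ 7 / 2) ^ 3)))) with (144 / s4 ^ 4 * / INR N ^ 9) by (field; repeat split; lra).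
        unfold Rdiv. apply Rmult_le_compat_l; [exact HC2|]. apply inv_pow_shrink; auto. }
    assert (B3 : 9 * (9 * A) = 162 * quadform_scale ^ 3 / s1 / rootN N) by (unfold A; assert (H := rootN_ge1 N); field; lra).
    assert (HiN : 0 < / INR N) by (apply Rinv_0_lt_compat; lra).
    unfold Rdiv at 1 3. rewrite !Rmult_plus_distr_r.
    assert (0 <= 162 * quadform_scale ^ 3 / s1 * / INR N) by (apply Rmult_le_pos; lra).
    assert (0 <= 144 / s4 ^ 4 * / rootN N) by (apply Rmult_le_pos; lra).
    unfold Rdiv in *. lra.
Qed.

(** Same scheme with one index fewer: the peak error times x is of order b^(-2), against a single
    weight, and the shear of order N^5 fits in half of the range N^6. *)
Lemma sum_n3_limit : exists C N0, 0 <= C /\ forall N x, (N0 <= N)%nat -> INR N <= x <= INR N + 1 ->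
  Rabs (x * rsum (N ^ 5) (fun n2 => rsum (N ^ 6) (fun n3 => / sqrt (quadform3 x n2 n3) ^ 3))
   - x * rsum (N ^ 5) (fun n2 => 2 / (quadform2 x n2 * s3)))
  <= C / rootN N + C / INR N.
Proof.
  destruct (INR_unbounded (2 * Rabs de)) as [N0 HN0].
  assert (Hc := quadform_scale_pos).
  assert (HC1 : 0 <= 18 * quadform_scale ^ 2 / s1) by (apply Rmult_le_pos; [assert (0 < quadform_scale ^ 2) by (apply pow_lt; auto); lra|left; apply Rinv_0_lt_compat; auto]).
  assert (HC2 : 0 <= 24 / s3 ^ 3) by (apply Rmult_le_pos; [lra|left; apply Rinv_0_lt_compat, pow_lt; auto]).
  exists (18 * quadform_scale ^ 2 / s1 + 24 / s3 ^ 3), (S N0). split; [lra|]. intros N x HN Hx.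
  assert (HN1 : 1 <= INR N) by (change 1 with (INR 1); apply le_INR; lia).
  assert (HNN : 2 * Rabs de <= INR N) by (assert (INR N0 <= INR N) by (apply le_INR; lia); lra).
  set (T := / (s3 ^ 3 * (INR N ^ 6 / 2) ^ 2)).
  assert (HT : 0 < T) by (apply Rinv_0_lt_compat, Rmult_lt_0_compat; apply pow_lt; auto; assert (0 < INR N ^ 6) by (apply pow_lt; lra); lra).
  rewrite <- Rmult_minus_distr_l, <- rsum_sub.
  assert (H4 : forall n2, inbox (N ^ 5) n2 ->
    Rabs (x * (rsum (N ^ 6) (fun n3 => / sqrt (quadform3 x n2 n3) ^ 3) - 2 / (quadform2 x n2 * s3)))
     <= wt n2 * (2 * quadform_scale ^ 2 / s1 * / rootN N) + x * T).
  { intros n2 I2. destruct (quadform2_lower N x n2 ltac:(lia) ltac:(lra)) as (Hb & Hbx & X1 & X2).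
    set (b := sqrt (quadform2 x n2)) in *.
    assert (Hb2 : b ^ 2 = quadform2 x n2) by (apply pow2_sqrt; left; apply quadform2_pos; lra).
    assert (HR : INR N ^ 6 / 2 <= INR (N ^ 6) - Rabs (de * IZR n2)).
    { rewrite pow_INR. assert (Rabs (de * IZR n2) <= INR N ^ 6 / 2); [|lra].
      assert (K2 : Rabs (IZR n2) <= INR N ^ 5) by (rewrite Rabs_Zabs, <- pow_INR, INR_IZR_INZ; apply IZR_le, I2).
      rewrite Rabs_mult.
      assert (Rabs de * Rabs (IZR n2) <= Rabs de * INR N ^ 5) by (apply Rmult_le_compat_l; auto; apply Rabs_pos).
      assert (2 * Rabs de * INR N ^ 5 <= INR N * INR N ^ 5) by (apply Rmult_le_compat_r; auto; apply pow_le; lra).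
      change (INR N ^ 6) with (INR N * INR N ^ 5). lra. }
    assert (HM := rsum_inv_sq3 b s3 (INR N ^ 6 / 2) (N ^ 6) (de * IZR n2) Hb P3
      ltac:(assert (0 < INR N ^ 6) by (apply pow_lt; lra); lra) HR). fold T in HM.
    unfold quadform3. rewrite <- Hb2. rewrite Rabs_mult, (Rabs_pos_eq x) by lra.
    eapply Rle_trans; [apply Rmult_le_compat_l; [lra|apply HM]|]. rewrite Rmult_plus_distr_l. apply Rplus_le_compat_r.
    apply Rle_trans with (2 * quadform_scale ^ 2 / s1 * / (quadform_scale * b) ^ 2).
    - replace (2 * quadform_scale ^ 2 / s1 * / (quadform_scale * b) ^ 2) with (b / s1 * (2 * / b ^ 3)) by (field; repeat split; lra).
      apply Rmult_le_compat_r.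
      + assert (0 < / b ^ 3) by (apply Rinv_0_lt_compat, pow_lt; auto). lra.
      + apply Rmult_le_reg_l with s1; auto. replace (s1 * (b / s1)) with b by (field; lra). lra.
    - replace (wt n2 * (2 * quadform_scale ^ 2 / s1 * / rootN N)) with (2 * quadform_scale ^ 2 / s1 * (wt n2 * / rootN N)) by ring.
      apply Rmult_le_compat_l; [|apply inv_pow2_le_wt1; auto].
      replace (2 * quadform_scale ^ 2 / s1) with (18 * quadform_scale ^ 2 / s1 / 9) by (field; lra). lra. }
  rewrite <- rsum_mul.
  assert (Hr : 0 < / rootN N) by (apply Rinv_0_lt_compat; assert (H := rootN_ge1 N); lra).
  set (A := 2 * quadform_scale ^ 2 / s1 * / rootN N) in *.
  assert (HA : 0 <= A).
  { unfold A. apply Rmult_le_pos; [|lra]. replace (2 * quadform_scale ^ 2 / s1) with (18 * quadform_scale ^ 2 / s1 / 9) by (field; lra). lra. }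
  apply Rle_trans with (rsum (N ^ 5) (fun n2 => wt n2 * A + x * T)).
  - eapply Rle_trans; [apply rsum_abs|]. apply rsum_le. intros n2 I2. apply H4; auto.
  - rewrite rsum_add, rsum_const.
    assert (B1 : rsum (N ^ 5) (fun n2 => wt n2 * A) <= 9 * A) by (apply rsum_wt_le; [lra|intros; lra]).
    assert (B2 : (2 * INR (N ^ 5) + 1) * (x * T) <= 24 / s3 ^ 3 / INR N).
    { apply Rle_trans with (3 * INR N ^ 5 * (2 * INR N * T)).
      - assert (K5 := pow_count N 5 ltac:(lia)).
        assert (0 <= x * T <= 2 * INR N * T).
        { split; [apply Rmult_le_pos; lra|apply Rmult_le_compat_r; lra]. }
        apply Rmult_le_compat; lra.
      - unfold T. replace (3 * INR N ^ 5 * (2 * INR N * / (s3 ^ 3 * (INR N ^ 6 / 2) ^ 2))) with (24 / s3 ^ 3 * / INR N ^ 6) by (field; repeat split; lra).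
        unfold Rdiv. apply Rmult_le_compat_l; [exact HC2|]. apply inv_pow_shrink; auto. }
    assert (B3 : 9 * A = 18 * quadform_scale ^ 2 / s1 / rootN N) by (unfold A; assert (H := rootN_ge1 N); field; lra).
    assert (HiN : 0 < / INR N) by (apply Rinv_0_lt_compat; lra).
    unfold Rdiv at 1 3. rewrite !Rmult_plus_distr_r.
    assert (0 <= 18 * quadform_scale ^ 2 / s1 * / INR N) by (apply Rmult_le_pos; lra).
    assert (0 <= 24 / s3 ^ 3 * / rootN N) by (apply Rmult_le_pos; lra).
    unfold Rdiv in *. lra.
Qed.

(** The outermost sum has no shear and its [a] is s1 x, so the prefactor x cancels the distance of
    the face and leaves a constant. *)
Lemma sum_n2_limit : exists C, 0 <= C /\ forall N x, (1 <= N)%nat -> INR N <= x <= INR N + 1 ->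
  Rabs (x * rsum (N ^ 5) (fun n2 => / quadform2 x n2) - PI / (s1 * s2)) <= C / INR N.
Proof.
  assert (HC1 : 0 <= 2 / s1 ^ 2) by (apply Rmult_le_pos; [lra|left; apply Rinv_0_lt_compat, pow_lt; auto]).
  assert (HC2 : 0 <= 8 / s2 ^ 2) by (apply Rmult_le_pos; [lra|left; apply Rinv_0_lt_compat, pow_lt; auto]).
  exists (2 / s1 ^ 2 + 8 / s2 ^ 2). split; [lra|]. intros N x HN Hx.
  assert (HN1 : 1 <= INR N) by (change 1 with (INR 1); apply le_INR; lia).
  assert (HN5 : 0 < INR N ^ 5) by (apply pow_lt; lra).
  assert (Hsx : 0 < s1 * x) by nra.
  assert (HM := rsum_inv_sq2 (s1 * x) s2 (INR N ^ 5 / 2) (N ^ 5) 0 Hsx P2 ltac:(lra)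
    ltac:(rewrite pow_INR, Rabs_R0; lra)).
  rewrite (rsum_ext _ _ (fun n => / ((s1 * x) ^ 2 + (s2 * (IZR n + 0)) ^ 2)))
    by (intros; unfold quadform2; rewrite Rplus_0_r; reflexivity).
  replace (PI / (s1 * s2)) with (x * (PI / (s2 * (s1 * x)))) by (field; lra).
  rewrite <- Rmult_minus_distr_l, Rabs_mult, (Rabs_pos_eq x) by lra.
  eapply Rle_trans; [apply Rmult_le_compat_l; [lra|apply HM]|].
  rewrite Rmult_plus_distr_l.
  replace ((2 / s1 ^ 2 + 8 / s2 ^ 2) / INR N) with (2 / s1 ^ 2 * / INR N + 8 / s2 ^ 2 * / INR N) by (unfold Rdiv; ring).
  apply Rplus_le_compat.
  - replace (x * (2 * / (s1 * x) ^ 2)) with (2 / s1 ^ 2 * / x) by (field; lra).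
    apply Rmult_le_compat_l; auto. apply Rinv_le_contravar; lra.
  - apply Rle_trans with (2 * INR N * (2 * / (s2 ^ 2 * (INR N ^ 5 / 2)))).
    + apply Rmult_le_compat_r; [|lra]. left. apply Rmult_lt_0_compat; [lra|]. apply Rinv_0_lt_compat.
      apply Rmult_lt_0_compat; [apply pow_lt; auto|lra].
    + replace (2 * INR N * (2 * / (s2 ^ 2 * (INR N ^ 5 / 2)))) with (8 / s2 ^ 2 * / INR N ^ 4) by (field; lra).
      apply Rmult_le_compat_l; auto. apply inv_pow_shrink; auto.
Qed.

Lemma triple_sum : exists C N0, 0 <= C /\ forall N x, (N0 <= N)%nat -> INR N <= x <= INR N + 1 ->
  Rabs (x * rsum (N ^ 5) (fun n2 => rsum (N ^ 6) (fun n3 => rsum (N ^ 7) (fun n4 => / quadform4 x n2 n3 n4 ^ 2)))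
   - PI ^ 2 / (s1 * s2 * s3 * s4)) <= C / rootN N + C / INR N.
Proof.
  destruct sum_n4_limit as (C4 & N4 & HC4 & H4). destruct sum_n3_limit as (C3 & N3 & HC3 & H3). destruct sum_n2_limit as (C2 & HC2 & H2).
  assert (HPI := PI_RGT_0).
  (* The factors produced by the inner integrations: [k3] by the one over n4, and [k2] = [k3] * 2 /
     s3 by those over n4 and n3. *)
  set (k3 := PI / (2 * s4)). set (k2 := PI / (s3 * s4)).
  assert (Hk3 : 0 < k3) by (apply Rdiv_lt_0_compat; lra).
  assert (Hk2 : 0 < k2) by (apply Rdiv_lt_0_compat; auto; apply Rmult_lt_0_compat; auto).
  exists (C4 + k3 * C3 + k2 * C2), (S (Nat.max N4 N3)).
  assert (0 <= k3 * C3) by (apply Rmult_le_pos; lra). assert (0 <= k2 * C2) by (apply Rmult_le_pos; lra).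
  split; [lra|]. intros N x HN Hx.
  assert (HN1 : 1 <= INR N) by (change 1 with (INR 1); apply le_INR; lia).
  specialize (H4 N x ltac:(lia) Hx). specialize (H3 N x ltac:(lia) Hx). specialize (H2 N x ltac:(lia) Hx).
  rewrite (rsum_ext (N ^ 5) (fun n2 => rsum (N ^ 6) (fun n3 => PI / (2 * sqrt (quadform3 x n2 n3) ^ 3 * s4)))
    (fun n2 => k3 * rsum (N ^ 6) (fun n3 => / sqrt (quadform3 x n2 n3) ^ 3))) in H4.
  2: { intros n2 _. rewrite <- rsum_mul. apply rsum_ext. intros n3 _. unfold k3. field.
       assert (0 < sqrt (quadform3 x n2 n3)) by (apply sqrt_lt_R0, quadform3_pos; lra). split; lra. }
  rewrite rsum_mul in H4.
  rewrite (rsum_ext (N ^ 5) (fun n2 => 2 / (quadform2 x n2 * s3)) (fun n2 => 2 / s3 * / quadform2 x n2)) in H3.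
  2: { intros n2 _. field. assert (0 < quadform2 x n2) by (apply quadform2_pos; lra). split; lra. }
  rewrite rsum_mul in H3.
  set (S4 := rsum (N ^ 5) (fun n2 => rsum (N ^ 6) (fun n3 => rsum (N ^ 7) (fun n4 => / quadform4 x n2 n3 n4 ^ 2)))) in *.
  set (S3 := rsum (N ^ 5) (fun n2 => rsum (N ^ 6) (fun n3 => / sqrt (quadform3 x n2 n3) ^ 3))) in *.
  set (S2 := rsum (N ^ 5) (fun n2 => / quadform2 x n2)) in *.
  replace (x * S4 - PI ^ 2 / (s1 * s2 * s3 * s4)) with
    ((x * S4 - x * (k3 * S3)) + (k3 * (x * S3 - x * (2 / s3 * S2)) + k2 * (x * S2 - PI / (s1 * s2))))
    by (unfold k3, k2; field; repeat split; lra).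
  eapply Rle_trans; [apply Rabs_triang|]. eapply Rle_trans; [apply Rplus_le_compat_l, Rabs_triang|].
  rewrite (Rabs_mult k3), (Rabs_mult k2), (Rabs_pos_eq k3), (Rabs_pos_eq k2) by lra.
  apply (Rmult_le_compat_l k3) in H3; [|lra]. apply (Rmult_le_compat_l k2) in H2; [|lra].
  assert (Hr : 0 < / rootN N) by (apply Rinv_0_lt_compat; assert (HH := rootN_ge1 N); lra).
  assert (0 <= k2 * C2 * / rootN N) by (apply Rmult_le_pos; lra).
  unfold Rdiv in *. lra.
Qed.
End TripleSum.


(** * Evaluation of the face sums *)

(* The component of [lam 0] orthogonal to [lam 1], [lam 2], [lam 3]. *)
Definition perp (lam : nat -> quat) : quat :=
  qscale (det4 (Lam lam) / qnorm2 (hatlam lam 0)) (hatlam lam 0).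

Lemma qdot_nonzero_pos h x : qdot h x <> 0 -> 0 < qnorm2 x.
Proof.
  intros H. destruct (Rle_lt_or_eq_dec _ _ (qnorm2_ge0 x)) as [|E]; auto. exfalso; apply H.
  assert (Hx : qn x = 0) by (unfold qn; rewrite <- E; apply sqrt_0).
  rewrite (qn_eq0 x Hx). unfold qdot, qzero; simpl; ring.
Qed.

Lemma qdot_sym x y : qdot x y = qdot y x.
Proof. unfold qdot; ring. Qed.

Lemma qdot_add_r x y z : qdot x (qadd y z) = qdot x y + qdot x z.
Proof. unfold qdot, qadd; simpl; ring. Qed.

Lemma qdot_scale_r x c y : qdot x (qscale c y) = c * qdot x y.
Proof. unfold qdot, qscale; simpl; ring. Qed.

Section Faces.
Variable lam : nat -> quat.
Hypothesis HD : 0 < det4 (Lam lam).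
Let D := det4 (Lam lam).
Let W := qnorm2 (hatlam lam 0).

Lemma hatlam0_pos : 0 < W.
Proof.
  apply (qdot_nonzero_pos (lam 0%nat)). rewrite qdot_sym, hatlam_dual by lia. simpl. lra.
Qed.

Lemma perp_norm : qnorm2 (perp lam) = D ^ 2 / W.
Proof.
  assert (HW := hatlam0_pos). unfold perp. fold D W. 
  replace (qnorm2 (qscale (D / W) (hatlam lam 0))) with ((D / W) ^ 2 * W) by (unfold W, qnorm2, qscale; simpl; ring).
  field. lra.
Qed.

(** [perp lam] is a real multiple of [hatlam lam 0], so the product is real; its value [D] will
    cancel the [D] in the denominator of the triple sum. *)
Lemma hatlam_mul_perp : qmul (hatlam lam 0) (qconj (perp lam)) = qscale D qone.
Proof.
  assert (HW := hatlam0_pos). unfold perp. fold D W.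
  replace (qmul (hatlam lam 0) (qconj (qscale (D / W) (hatlam lam 0)))) with (qscale (D / W * W) qone).
  - f_equal. field. lra.
  - unfold W, qnorm2. generalize (D / (q0 (hatlam lam 0) ^ 2 + q1 (hatlam lam 0) ^ 2 + q2 (hatlam lam 0) ^ 2 + q3 (hatlam lam 0) ^ 2)).
    qring.
Qed.

Lemma perp_orth n2 n3 n4 : qdot (perp lam) (lpt lam 0 n2 n3 n4) = 0.
Proof.
  unfold perp. rewrite qdot_sym, qdot_scale_r, qdot_sym.
  replace (qdot (hatlam lam 0) (lpt lam 0 n2 n3 n4)) with
    (IZR n2 * qdot (hatlam lam 0) (lam 1%nat) + IZR n3 * qdot (hatlam lam 0) (lam 2%nat) + IZR n4 * qdot (hatlam lam 0) (lam 3%nat))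
    by (unfold lpt, latpt, qsum4, qadd, qscale, qdot; simpl; ring).
  rewrite !hatlam_dual by lia. simpl. ring.
Qed.

(** The difference of [lam 0] and [perp lam] is orthogonal to [hatlam lam 0], so Cramer's rule gives
    it no [lam 0] component. The coefficients are real, not integral, and this forces the
    displacement [b] in [kern]. *)
Lemma perp_decomposition : exists a1 a2 a3,
  lam 0%nat = qadd (perp lam) (qadd (qadd (qscale a1 (lam 1%nat)) (qscale a2 (lam 2%nat))) (qscale a3 (lam 3%nat))).
Proof.
  assert (HW := hatlam0_pos). set (x := qsub (lam 0%nat) (perp lam)).
  exists (qdot (hatlam lam 1) x / D), (qdot (hatlam lam 2) x / D), (qdot (hatlam lam 3) x / D).
  assert (Hx : qdot (hatlam lam 0) x = 0).
  { unfold x, qsub. rewrite qdot_add_r, hatlam_dual by lia. simpl Nat.eqb. fold D.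
    replace (qopp (perp lam)) with (qscale (- (D / W)) (hatlam lam 0)) by (unfold perp; fold D W; qring).
    rewrite qdot_scale_r, <- qnorm2_dot. fold W. cbv iota. field. lra. }
  assert (Hc := hatlam_cramer lam x). fold D in Hc. unfold qsum4 in Hc. rewrite Hx in Hc.
  replace (lam 0%nat) with (qadd (perp lam) x) at 1 by (unfold x; qring). f_equal.
  apply (qscale_inj D); [unfold D; lra|]. rewrite Hc.
  generalize (qdot (hatlam lam 1) x) (qdot (hatlam lam 2) x) (qdot (hatlam lam 3) x). intros.
  apply quat_ext; unfold qadd, qscale; cbn [q0 q1 q2 q3]; field; unfold D; lra.
Qed.

(** The layer n_1 = m recentred over the foot of the perpendicular. In [kern], [b] collects [q] and
    the fractional parts of the tangential drift, hence stays bounded; the integer parts become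
    index shifts. *)
Definition facept (m : R) (n2 n3 n4 : Z) : quat := qadd (qscale m (perp lam)) (lpt lam 0 n2 n3 n4).
Definition kern (b : quat) (m : R) (n2 n3 n4 : Z) : quat := Gq (qadd (facept m n2 n3 n4) b).

Lemma facept_norm m n2 n3 n4 :
  qnorm2 (facept m n2 n3 n4) = m ^ 2 * qnorm2 (perp lam) + qnorm2 (lpt lam 0 n2 n3 n4).
Proof.
  unfold facept. rewrite qnorm2_add, qdot_sym, qdot_scale_r, (qdot_sym _ (perp lam)), perp_orth.
  replace (qnorm2 (qscale m (perp lam))) with (m ^ 2 * qnorm2 (perp lam)) by (unfold qnorm2, qscale; simpl; ring).
  ring.
Qed.

Lemma facept_lower : exists c, 0 < c /\ forall N m n2 n3 n4, (1 <= N)%nat -> INR N <= Rabs m ->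
  let r := qn (facept m n2 n3 n4) in
  1 + INR N <= c * r /\ 1 + IZR (Z.abs n2) <= c * r /\ 1 + IZR (Z.abs n3) <= c * r /\ 1 + IZR (Z.abs n4) <= c * r.
Proof.
  destruct (qn_lpt_lower lam HD) as (c & Hc & Hl).
  assert (HW := hatlam0_pos). assert (HD' : 0 < D) by exact HD.
  assert (Hv : 0 < qnorm2 (perp lam)) by (rewrite perp_norm; apply Rdiv_lt_0_compat; auto; apply pow_lt; auto).
  set (s := qn (perp lam)). assert (Hs : 0 < s) by (apply sqrt_lt_R0; auto).
  assert (Hs2 : s ^ 2 = qnorm2 (perp lam)) by apply qn_sqr.
  assert (Is : 0 < / s) by (apply Rinv_0_lt_compat; auto). assert (Ic : 0 < / c) by (apply Rinv_0_lt_compat; auto).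
  exists (2 / s + / c). split; [unfold Rdiv; lra|]. intros N m n2 n3 n4 HN Hm r.
  apply le_INR in HN; simpl in HN.
  assert (Hr0 : 0 <= r) by apply qn_ge0.
  assert (Hr2 : r ^ 2 = (s * m) ^ 2 + qn (lpt lam 0 n2 n3 n4) ^ 2).
  { unfold r. rewrite qn_sqr, facept_norm, <- Hs2, qn_sqr. ring. }
  assert (Q1 := pow2_ge_0 (s * m)). assert (Q2 := pow2_ge_0 (qn (lpt lam 0 n2 n3 n4))).
  assert (B1 : Rabs (s * m) <= r) by (apply abs_le_sqrt; lra).
  assert (B2 : qn (lpt lam 0 n2 n3 n4) <= r).
  { rewrite <- (Rabs_pos_eq (qn _)) by apply qn_ge0. apply abs_le_sqrt; lra. }
  rewrite Rabs_mult, Rabs_pos_eq in B1 by lra.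
  assert (I1 : Rabs m <= / s * r) by (apply Rmult_le_reg_l with s; auto; replace (s * (/ s * r)) with r by (field; lra); lra).
  destruct (Hl 0%Z n2 n3 n4) as (_ & A2 & A3 & A4).
  assert (P : forall n, c * IZR (Z.abs n) <= qn (lpt lam 0 n2 n3 n4) -> IZR (Z.abs n) <= / c * r).
  { intros n H. apply Rmult_le_reg_l with c; auto. replace (c * (/ c * r)) with r by (field; lra). lra. }
  assert (0 <= / c * r) by (apply Rmult_le_pos; lra).
  specialize (P n2 A2) as P2. specialize (P n3 A3) as P3. specialize (P n4 A4) as P4.
  replace ((2 / s + / c) * r) with (2 * (/ s * r) + / c * r) by (field; lra).
  repeat split; lra.
Qed.

Lemma kern_far B : 0 <= B -> exists C R0, 0 < C /\ 0 < R0 /\ forall b m n2 n3 n4 R, qn b <= B -> R0 <= R ->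
  (R <= IZR (Z.abs n2) \/ R <= IZR (Z.abs n3) \/ R <= IZR (Z.abs n4)) -> 1 <= Rabs m ->
  qn (kern b m n2 n3 n4) <= C / R ^ 3.
Proof.
  intros HB. destruct facept_lower as (c & Hc & Hl).
  exists ((2 * c) ^ 3), (2 * c * B + 1). split; [apply pow_lt; lra|].
  assert (HcB : 0 <= c * B) by (apply Rmult_le_pos; lra). split; [lra|].
  intros b m n2 n3 n4 R Hb HR Hn Hm.
  destruct (Hl 1%nat m n2 n3 n4 ltac:(lia) Hm) as (_ & A2 & A3 & A4).
  set (r := qn (facept m n2 n3 n4)) in *.
  assert (Hr : R <= c * r) by (destruct Hn as [H|[H|H]]; lra).
  assert (Hlow : R / (2 * c) <= qn (qadd (facept m n2 n3 n4) b)).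
  { assert (H := qn_add_lower (facept m n2 n3 n4) b). fold r in H.
    apply Rmult_le_reg_l with (2 * c); [lra|]. replace (2 * c * (R / (2 * c))) with R by (field; lra).
    assert (c * (r - B) <= c * qn (qadd (facept m n2 n3 n4) b)) by (apply Rmult_le_compat_l; lra). lra. }
  assert (0 < R / (2 * c)) by (apply Rdiv_lt_0_compat; lra).
  unfold kern. rewrite qn_Gq by lra.
  replace ((2 * c) ^ 3 / R ^ 3) with (/ (R / (2 * c)) ^ 3) by (field; lra).
  apply Rinv_le_contravar; [apply pow_lt; auto|apply pow_incr; lra].
Qed.

(* A shift by O(N) moves only O(N) layers near the boundary of the box, where [kern] is tiny. *)
Lemma kern_shift B cz : 0 <= B -> 0 <= cz -> exists C N0, 0 <= C /\ forall N b m z2 z3 z4,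
  (N0 <= N)%nat -> qn b <= B -> INR N <= Rabs m ->
  IZR (Z.abs z2) <= cz * INR N -> IZR (Z.abs z3) <= cz * INR N -> IZR (Z.abs z4) <= cz * INR N ->
  qn (qsub (box3 (N ^ 5) (N ^ 6) (N ^ 7) (fun n2 n3 n4 => kern b m (n2 + z2) (n3 + z3) (n4 + z4)))
           (box3 (N ^ 5) (N ^ 6) (N ^ 7) (kern b m))) <= C / INR N.
Proof.
  intros HB Hcz. destruct (kern_far B HB) as (C & R0 & HC & HR0 & Hf).
  destruct (INR_unbounded (2 * cz + 2 * R0)) as [N0 HN0].
  exists (432 * cz * C), (S N0). split; [apply Rmult_le_pos; lra|].
  intros N b m z2 z3 z4 HN Hb Hm Hz2 Hz3 Hz4.
  assert (HN1 : 1 <= INR N) by (change 1 with (INR 1); apply le_INR; lia).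
  assert (HNN : 2 * cz + 2 * R0 <= INR N) by (assert (INR N0 <= INR N) by (apply le_INR; lia); lra).
  assert (Hm1 : 1 <= Rabs m) by lra.
  assert (Hhalf : forall k, (2 <= k)%nat -> R0 <= INR N ^ k / 2 /\ forall z j,
     IZR (Z.abs z) <= cz * INR N -> (Z.of_nat (N ^ k) - Z.abs z <= Z.abs j)%Z -> INR N ^ k / 2 <= IZR (Z.abs j)).
  { intros k Hk.
    assert (K : INR N * INR N <= INR N ^ k).
    { replace (INR N * INR N) with (INR N ^ 2) by ring. apply Rle_pow; auto. }
    split; [nra|]. intros z j Hz Hj. apply IZR_le in Hj. rewrite minus_IZR, <- INR_IZR_INZ, pow_INR in Hj. nra. }
  assert (Pk : forall k, 0 < INR N ^ k) by (intros; apply pow_lt; lra).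
  destruct (Hhalf 5%nat ltac:(lia)) as [R5 H5]. destruct (Hhalf 6%nat ltac:(lia)) as [R6 H6]. destruct (Hhalf 7%nat ltac:(lia)) as [R7 H7].
  assert (C5 := pow_count N 5 ltac:(lia)). assert (C6 := pow_count N 6 ltac:(lia)). assert (C7 := pow_count N 7 ltac:(lia)).
  assert (T : forall k, 0 <= C / (INR N ^ k / 2) ^ 3).
  { intros k. apply Rmult_le_pos; [lra|]. left. apply Rinv_0_lt_compat, pow_lt. specialize (Pk k). lra. }
  assert (Hz : forall z, 0 <= IZR (Z.abs z)) by (intros; apply IZR_le; lia).
  assert (HczN : 0 <= cz * INR N) by (apply Rmult_le_pos; lra).
  (* The indices are shifted one at a time, innermost first, at costs of order N^(-9), N^(-5) and
     N^(-1). *)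
  assert (E4 : qn (qsub (box3 (N ^ 5) (N ^ 6) (N ^ 7) (fun n2 n3 n4 => kern b m (n2 + z2) (n3 + z3) (n4 + z4)))
     (box3 (N ^ 5) (N ^ 6) (N ^ 7) (fun n2 n3 n4 => kern b m (n2 + z2) (n3 + z3) n4))) <= 144 * cz * C / INR N).
  { unfold box3. rewrite <- zsum_sub.
    apply Rle_trans with (3 * INR N ^ 5 * (3 * INR N ^ 6 * (2 * (cz * INR N) * (C / (INR N ^ 7 / 2) ^ 3)))).
    - eapply Rle_trans.
      + apply zsum_bound. intros n2 _. rewrite <- zsum_sub. apply zsum_bound. intros n3 _.
        apply zsum_shift with (B := C / (INR N ^ 7 / 2) ^ 3). intros k Hk. apply Hf; auto. right; right. apply (H7 z4); auto.
      + specialize (T 7%nat). specialize (Hz z4).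
        assert (2 * IZR (Z.abs z4) * (C / (INR N ^ 7 / 2) ^ 3) <= 2 * (cz * INR N) * (C / (INR N ^ 7 / 2) ^ 3)) by (apply Rmult_le_compat_r; lra).
        assert (0 <= 2 * IZR (Z.abs z4) * (C / (INR N ^ 7 / 2) ^ 3)) by (apply Rmult_le_pos; lra).
        apply Rmult_le_compat; try lra; [apply Rmult_le_pos; lra|]. apply Rmult_le_compat; lra.
    - replace (3 * INR N ^ 5 * (3 * INR N ^ 6 * (2 * (cz * INR N) * (C / (INR N ^ 7 / 2) ^ 3)))) with (144 * cz * C * / INR N ^ 9) by (field; lra).
      unfold Rdiv. apply Rmult_le_compat_l; [|apply inv_pow_shrink; auto]. apply Rmult_le_pos; lra. }
  assert (E3 : qn (qsub (box3 (N ^ 5) (N ^ 6) (N ^ 7) (fun n2 n3 n4 => kern b m (n2 + z2) (n3 + z3) n4))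
     (box3 (N ^ 5) (N ^ 6) (N ^ 7) (fun n2 n3 n4 => kern b m (n2 + z2) n3 n4))) <= 144 * cz * C / INR N).
  { unfold box3. rewrite <- zsum_sub.
    apply Rle_trans with (3 * INR N ^ 5 * (2 * (cz * INR N) * (3 * INR N ^ 7 * (C / (INR N ^ 6 / 2) ^ 3)))).
    - specialize (T 6%nat).
      assert (T2 : 0 <= 3 * INR N ^ 7 * (C / (INR N ^ 6 / 2) ^ 3)) by (apply Rmult_le_pos; [|lra]; specialize (Pk 7%nat); lra).
      eapply Rle_trans.
      + apply zsum_bound. intros n2 _.
        apply (zsum_shift (N ^ 6) (fun n3 => zsum (N ^ 7) (fun n4 => kern b m (n2 + z2) n3 n4)) z3) with (B := 3 * INR N ^ 7 * (C / (INR N ^ 6 / 2) ^ 3)).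
        intros k Hk. eapply Rle_trans; [apply zsum_bound with (c := C / (INR N ^ 6 / 2) ^ 3)|].
        * intros n4 _. apply Hf; auto. right; left. apply (H6 z3); auto.
        * apply Rmult_le_compat_r; lra.
      + specialize (Hz z3). apply Rmult_le_compat; try lra; [apply Rmult_le_pos; lra|]. apply Rmult_le_compat_r; lra.
    - replace (3 * INR N ^ 5 * (2 * (cz * INR N) * (3 * INR N ^ 7 * (C / (INR N ^ 6 / 2) ^ 3)))) with (144 * cz * C * / INR N ^ 5) by (field; lra).
      unfold Rdiv. apply Rmult_le_compat_l; [|apply inv_pow_shrink; auto]. apply Rmult_le_pos; lra. }
  assert (E2 : qn (qsub (box3 (N ^ 5) (N ^ 6) (N ^ 7) (fun n2 n3 n4 => kern b m (n2 + z2) n3 n4))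
     (box3 (N ^ 5) (N ^ 6) (N ^ 7) (kern b m))) <= 144 * cz * C / INR N).
  { unfold box3.
    apply Rle_trans with (2 * (cz * INR N) * (3 * INR N ^ 6 * (3 * INR N ^ 7 * (C / (INR N ^ 5 / 2) ^ 3)))).
    - specialize (T 5%nat).
      assert (T2 : 0 <= 3 * INR N ^ 7 * (C / (INR N ^ 5 / 2) ^ 3)) by (apply Rmult_le_pos; [|lra]; specialize (Pk 7%nat); lra).
      assert (T3 : 0 <= 3 * INR N ^ 6 * (3 * INR N ^ 7 * (C / (INR N ^ 5 / 2) ^ 3))) by (apply Rmult_le_pos; [|lra]; specialize (Pk 6%nat); lra).
      eapply Rle_trans.
      + apply (zsum_shift (N ^ 5) (fun n2 => zsum (N ^ 6) (fun n3 => zsum (N ^ 7) (fun n4 => kern b m n2 n3 n4))) z2) with (B := 3 * INR N ^ 6 * (3 * INR N ^ 7 * (C / (INR N ^ 5 / 2) ^ 3))).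
        intros k Hk. eapply Rle_trans; [apply zsum_bound with (c := 3 * INR N ^ 7 * (C / (INR N ^ 5 / 2) ^ 3))|].
        * intros n3 _. eapply Rle_trans; [apply zsum_bound with (c := C / (INR N ^ 5 / 2) ^ 3)|].
          -- intros n4 _. apply Hf; auto. left. apply (H5 z2); auto.
          -- apply Rmult_le_compat_r; lra.
        * apply Rmult_le_compat_r; lra.
      + apply Rmult_le_compat_r; lra.
    - replace (2 * (cz * INR N) * (3 * INR N ^ 6 * (3 * INR N ^ 7 * (C / (INR N ^ 5 / 2) ^ 3)))) with (144 * cz * C * / INR N) by (field; lra).
      unfold Rdiv. lra. }
  eapply Rle_trans; [eapply qn_sub_tri|]. eapply Rle_trans; [apply Rplus_le_compat_l; eapply qn_sub_tri|].
  replace (432 * cz * C / INR N) with (144 * cz * C / INR N + (144 * cz * C / INR N + 144 * cz * C / INR N)) by (field; lra).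
  apply Rplus_le_compat; [apply E4|]. apply Rplus_le_compat; [apply E3|apply E2].
Qed.

(** A bounded displacement changes [Gq] by a multiple of |p|^(-4); over three indices this is
    summable with one factor [/ rootN N] left. *)
Lemma kern_displacement B : 0 <= B -> exists C N0, 0 <= C /\ forall N b m, (N0 <= N)%nat -> qn b <= B -> INR N <= Rabs m ->
  qn (qsub (box3 (N ^ 5) (N ^ 6) (N ^ 7) (kern b m)) (box3 (N ^ 5) (N ^ 6) (N ^ 7) (fun n2 n3 n4 => Gq (facept m n2 n3 n4))))
   <= C / rootN N.
Proof.
  intros HB. destruct facept_lower as (c & Hc & Hl).
  destruct (INR_unbounded (2 * c * B)) as [N0 HN0].
  assert (Hc4 : 0 < c ^ 4) by (apply pow_lt; auto).
  assert (HA : 0 <= 355 * B * c ^ 4) by (apply Rmult_le_pos; lra).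
  exists (9 * (9 * (9 * (355 * B * c ^ 4)))), (S N0). split; [lra|]. intros N b m HN Hb Hm.
  assert (HNN : 2 * c * B <= INR N) by (assert (INR N0 <= INR N) by (apply le_INR; lia); lra).
  assert (Hr : 0 < / rootN N) by (apply Rinv_0_lt_compat; assert (H := rootN_ge1 N); lra).
  assert (W9 : forall M, wsum M <= 9) by apply wsum_bound.
  assert (W0 : forall M, 0 <= wsum M) by apply wsum_ge0.
  set (A := 355 * B * c ^ 4 * / rootN N). assert (HA' : 0 <= A) by (apply Rmult_le_pos; lra).
  rewrite <- box3_sub.
  apply Rle_trans with (wsum (N ^ 5) * (wsum (N ^ 6) * (wsum (N ^ 7) * A))).
  - unfold box3. apply zsum_wt_norm. intros n2.
    apply Rle_trans with (wsum (N ^ 6) * (wsum (N ^ 7) * (wt n2 * A))); [|right; ring].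
    apply zsum_wt_norm. intros n3.
    apply Rle_trans with (wsum (N ^ 7) * (wt n2 * (wt n3 * A))); [|right; ring].
    apply zsum_wt_norm. intros n4.
    destruct (Hl N m n2 n3 n4 ltac:(lia) Hm) as (A1 & A2 & A3 & A4).
    set (p := facept m n2 n3 n4) in *. unfold kern. fold p.
    assert (Hp : 0 < qn p) by (assert (H := pos_INR N); apply Rmult_lt_reg_l with c; lra).
    eapply Rle_trans; [apply Gq_lipschitz; auto|].
    { apply Rmult_le_reg_l with c; auto. assert (c * qn b <= c * B) by (apply Rmult_le_compat_l; lra). lra. }
    replace (wt n4 * (wt n2 * (wt n3 * A))) with (355 * B * c ^ 4 * (wt n2 * (wt n3 * (wt n4 * / rootN N)))) by (unfold A; ring).
    apply Rle_trans with (355 * B * c ^ 4 * / (c * qn p) ^ 4).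
    + replace (355 * B * c ^ 4 * / (c * qn p) ^ 4) with (355 * B * / qn p ^ 4) by (field; lra).
      unfold Rdiv. apply Rmult_le_compat_r; [left; apply Rinv_0_lt_compat, pow_lt; auto|]. lra.
    + apply Rmult_le_compat_l; [lra|]. apply inv_pow4_le_wt3; auto.
  - replace (9 * (9 * (9 * (355 * B * c ^ 4))) / rootN N) with (9 * (9 * (9 * A))) by (unfold A, Rdiv; ring).
    repeat (apply Rmult_le_compat; repeat apply Rmult_le_pos; auto; try lra).
Qed.

Lemma box3_reflect N2 N3 N4 f :
  box3 N2 N3 N4 (fun a b c => f (- a)%Z (- b)%Z (- c)%Z) = box3 N2 N3 N4 f.
Proof.
  unfold box3.
  rewrite (zsum_reflect N2 (fun a => zsum N3 (fun b => zsum N4 (fun c => f a (- b)%Z (- c)%Z)))).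
  apply zsum_ext; intros a _.
  rewrite (zsum_reflect N3 (fun b => zsum N4 (fun c => f a b (- c)%Z))).
  apply zsum_ext; intros b _. apply (zsum_reflect N4 (f a b)).
Qed.

Lemma box3_odd N2 N3 N4 f : (forall a b c, f (- a)%Z (- b)%Z (- c)%Z = qopp (f a b c)) ->
  box3 N2 N3 N4 f = qzero.
Proof.
  intros H. assert (E : box3 N2 N3 N4 f = qopp (box3 N2 N3 N4 f)).
  { rewrite <- box3_reflect at 1. 
    replace (qopp (box3 N2 N3 N4 f)) with (qsub qzero (box3 N2 N3 N4 f)) by qring.
    replace qzero with (qsub (box3 N2 N3 N4 f) (box3 N2 N3 N4 f)) by qring. rewrite <- !box3_sub.
    unfold box3. do 3 (apply zsum_ext; intros). rewrite H. qring. }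
  destruct (box3 N2 N3 N4 f) as [x0 x1 x2 x3]. unfold qopp in E; cbn [q0 q1 q2 q3] in E.
  injection E; intros. apply quat_ext; simpl; lra.
Qed.

Lemma box3_add N2 N3 N4 f g :
  box3 N2 N3 N4 (fun b c d => qadd (f b c d) (g b c d)) = qadd (box3 N2 N3 N4 f) (box3 N2 N3 N4 g).
Proof.
  unfold box3. rewrite <- zsum_add. apply zsum_ext; intros. rewrite <- zsum_add. apply zsum_ext; intros. apply zsum_add.
Qed.

(** Orthogonality of [perp lam] to the face makes the norm even in the three indices, so the
    tangential part is odd and sums to zero over the symmetric box. *)
Lemma face_symmetric_sum N2 N3 N4 m :
  box3 N2 N3 N4 (fun n2 n3 n4 => Gq (facept m n2 n3 n4)) =
  qscale (m * rsum N2 (fun n2 => rsum N3 (fun n3 => rsum N4 (fun n4 => / qnorm2 (facept m n2 n3 n4) ^ 2)))) (qconj (perp lam)).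
Proof.
  assert (E : forall n2 n3 n4, Gq (facept m n2 n3 n4) =
     qadd (qscale (/ qnorm2 (facept m n2 n3 n4) ^ 2) (qscale m (qconj (perp lam))))
          (qscale (/ qnorm2 (facept m n2 n3 n4) ^ 2) (qconj (lpt lam 0 n2 n3 n4)))).
  { intros. unfold Gq. generalize (/ qnorm2 (facept m n2 n3 n4) ^ 2). unfold facept.
    generalize (perp lam) (lpt lam 0 n2 n3 n4). qring. }
  transitivity (qadd (box3 N2 N3 N4 (fun n2 n3 n4 => qscale (/ qnorm2 (facept m n2 n3 n4) ^ 2) (qscale m (qconj (perp lam)))))
     (box3 N2 N3 N4 (fun n2 n3 n4 => qscale (/ qnorm2 (facept m n2 n3 n4) ^ 2) (qconj (lpt lam 0 n2 n3 n4))))).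
  - rewrite <- box3_add. unfold box3. do 3 (apply zsum_ext; intros). apply E.
  - rewrite (box3_odd N2 N3 N4 (fun n2 n3 n4 => qscale (/ qnorm2 (facept m n2 n3 n4) ^ 2) (qconj (lpt lam 0 n2 n3 n4)))).
    + replace (box3 N2 N3 N4 (fun n2 n3 n4 => qscale (/ qnorm2 (facept m n2 n3 n4) ^ 2) (qscale m (qconj (perp lam))))) with
       (qscale (rsum N2 (fun n2 => rsum N3 (fun n3 => rsum N4 (fun n4 => / qnorm2 (facept m n2 n3 n4) ^ 2)))) (qscale m (qconj (perp lam)))).
      * generalize (rsum N2 (fun n2 => rsum N3 (fun n3 => rsum N4 (fun n4 => / qnorm2 (facept m n2 n3 n4) ^ 2)))) (perp lam). qring.
      * unfold box3. rewrite <- zsum_rscale. apply zsum_ext; intros. rewrite <- zsum_rscale. apply zsum_ext; intros.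
        symmetry; apply zsum_rscale.
    + intros a b c. rewrite !facept_norm.
      replace (lpt lam 0 (- a) (- b) (- c)) with (qopp (lpt lam 0 a b c))
        by (unfold lpt, latpt; apply quat_ext; unfold qopp, qsum4, qadd, qscale; cbn [q0 q1 q2 q3]; rewrite !opp_IZR; ring).
      replace (qnorm2 (qopp (lpt lam 0 a b c))) with (qnorm2 (lpt lam 0 a b c)) by (unfold qnorm2, qopp; simpl; ring).
      generalize (/ (m ^ 2 * qnorm2 (perp lam) + qnorm2 (lpt lam 0 a b c)) ^ 2) (lpt lam 0 a b c). qring.
Qed.

(** Lagrange reduction of the Gram matrix of [lam 1], [lam 2], [lam 3], starting from [lam 3]. The
    squared scales are ratios of successive Gram minors, topped by the squared height [D ^ 2 / W];
    their product telescopes to [D ^ 2]. *)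
Lemma facept_complete_squares : exists s1 s2 s3 s4 be ga de,
  0 < s1 /\ 0 < s2 /\ 0 < s3 /\ 0 < s4 /\ s1 * s2 * s3 * s4 = D /\
  forall m x n2 n3 n4, m ^ 2 = x ^ 2 -> qnorm2 (facept m n2 n3 n4) = quadform4 s1 s2 s3 s4 be ga de x n2 n3 n4.
Proof.
  assert (HW := hatlam0_pos). assert (HD' : 0 < D) by exact HD.
  assert (Hgram := hatlam_norm_gram lam). fold W in Hgram.
  assert (P33 : 0 < qnorm2 (lam 3%nat)) by (apply (qdot_nonzero_pos (hatlam lam 3)); rewrite hatlam_dual by lia; simpl; lra).
  set (g11 := qdot (lam 1%nat) (lam 1%nat)) in *. set (g12 := qdot (lam 1%nat) (lam 2%nat)) in *.
  set (g13 := qdot (lam 1%nat) (lam 3%nat)) in *. set (g22 := qdot (lam 2%nat) (lam 2%nat)) in *.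
  set (g23 := qdot (lam 2%nat) (lam 3%nat)) in *. set (g33 := qdot (lam 3%nat) (lam 3%nat)) in *.
  assert (H33 : 0 < g33) by (unfold g33; rewrite <- qnorm2_dot; auto).
  set (w3 := g22 - g23 ^ 2 / g33).
  (* [w3] is the squared length of [lam 2] minus its projection onto [lam 3], and this vector is
     nonzero because it pairs to [D] with [hatlam lam 2]. *)
  assert (H3 : 0 < w3).
  { replace w3 with (qnorm2 (qadd (lam 2%nat) (qscale (- (g23 / g33)) (lam 3%nat)))).
    - apply (qdot_nonzero_pos (hatlam lam 2)). rewrite qdot_add_r, qdot_scale_r, !hatlam_dual by lia. simpl. fold D. lra.
    - rewrite qnorm2_add, qdot_scale_r. 
      replace (qnorm2 (qscale (- (g23 / g33)) (lam 3%nat))) with ((g23 / g33) ^ 2 * g33) by (unfold g33 at 2; unfold qdot, qnorm2, qscale; simpl; ring).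
      rewrite qnorm2_dot. fold g22 g23. unfold w3. field. lra. }
  set (w2 := W / (w3 * g33)).
  assert (H2 : 0 < w2) by (apply Rdiv_lt_0_compat; auto; apply Rmult_lt_0_compat; auto).
  set (w1 := D ^ 2 / W). assert (H1 : 0 < w1) by (apply Rdiv_lt_0_compat; auto; apply pow_lt; auto).
  assert (S1 : sqrt w1 ^ 2 = w1) by (apply pow2_sqrt; lra). assert (S2 : sqrt w2 ^ 2 = w2) by (apply pow2_sqrt; lra).
  assert (S3 : sqrt w3 ^ 2 = w3) by (apply pow2_sqrt; lra). assert (S4 : sqrt g33 ^ 2 = g33) by (apply pow2_sqrt; lra).
  assert (Q1 := sqrt_lt_R0 _ H1). assert (Q2 := sqrt_lt_R0 _ H2). assert (Q3 := sqrt_lt_R0 _ H3). assert (Q4 := sqrt_lt_R0 _ H33).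
  exists (sqrt w1), (sqrt w2), (sqrt w3), (sqrt g33), (g23 / g33), (g13 / g33), ((g12 - g13 * g23 / g33) / w3).
  repeat (split; [assumption|]). split.
  - apply Rsqr_inj; [repeat apply Rmult_le_pos; lra|lra|]. unfold Rsqr.
    transitivity (sqrt w1 ^ 2 * sqrt w2 ^ 2 * sqrt w3 ^ 2 * sqrt g33 ^ 2); [ring|].
    rewrite S1, S2, S3, S4. unfold w2, w1. field. repeat split; lra.
  - intros m x n2 n3 n4 Hmx. rewrite facept_norm, perp_norm. fold w1. rewrite Hmx.
    unfold quadform4, quadform3, quadform2. rewrite !Rpow_mult_distr, S1, S2, S3, S4.
    assert (El : qnorm2 (lpt lam 0 n2 n3 n4) = g11 * IZR n2 ^ 2 + g22 * IZR n3 ^ 2 + g33 * IZR n4 ^ 2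
      + 2 * g12 * IZR n2 * IZR n3 + 2 * g13 * IZR n2 * IZR n4 + 2 * g23 * IZR n3 * IZR n4).
    { unfold g11, g12, g13, g22, g23, g33, qnorm2, lpt, latpt, qsum4, qadd, qscale, qdot. simpl. ring. }
    assert (Ew : g11 = w2 + (g13 / g33) ^ 2 * g33 + ((g12 - g13 * g23 / g33) / w3) ^ 2 * w3).
    { unfold w2. rewrite Hgram.
      assert (g33 * w3 = g22 * g33 - g23 ^ 2) by (unfold w3; field; lra).
      apply Rmult_eq_reg_r with (w3 * g33 * g33); [|apply Rgt_not_eq; repeat apply Rmult_lt_0_compat; lra].
      replace (((g11 * (g22 * g33 - g23 ^ 2) - g12 * (g12 * g33 - g23 * g13) + g13 * (g12 * g23 - g22 * g13)) / (w3 * g33) +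
        (g13 / g33) ^ 2 * g33 + ((g12 - g13 * g23 / g33) / w3) ^ 2 * w3) * (w3 * g33 * g33)) with
       ((g11 * (g22 * g33 - g23 ^ 2) - g12 * (g12 * g33 - g23 * g13) + g13 * (g12 * g23 - g22 * g13)) * g33 + g13 ^ 2 * (g33 * w3)
         + (g12 * g33 - g13 * g23) ^ 2) by (field; lra).
      replace (g11 * (w3 * g33 * g33)) with (g11 * (g33 * w3) * g33) by ring. rewrite H. ring. }
    assert (E22 : g22 = w3 + g23 ^ 2 / g33) by (unfold w3; ring).
    rewrite El, Ew, E22. field. repeat split; lra.
Qed.

Lemma Int_part_frac r : 0 <= r - IZR (Int_part r) <= 1 /\ IZR (Z.abs (Int_part r)) <= Rabs r + 1.
Proof.
  destruct (base_Int_part r) as [A B]. split; [lra|]. rewrite <- Rabs_Zabs.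
  replace (IZR (Int_part r)) with (r + - (r - IZR (Int_part r))) by ring.
  eapply Rle_trans; [apply Rabs_triang|]. rewrite Rabs_Ropp, (Rabs_pos_eq (r - _)) by lra. lra.
Qed.

(** The range of x = |m| covers both faces at once: x = N + 1 with sign 1 and x = N with sign -1.
    The bound is uniform over it. *)
Lemma face_limit q : exists C N0, 0 <= C /\ forall N m sg x, (N0 <= N)%nat -> (sg = 1 \/ sg = -1) ->
  IZR m = sg * x -> INR N <= x <= INR N + 1 ->
  qn (qsub (qmul (hatlam lam 0) (box3 (N ^ 5) (N ^ 6) (N ^ 7) (gshift lam q m))) (qscale (sg * PI ^ 2) qone))
   <= C / rootN N + C / INR N.
Proof.
  destruct perp_decomposition as (a1 & a2 & a3 & Hdec).
  assert (HD' : 0 < D) by exact HD.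
  set (B := qn q + qn (lam 1%nat) + qn (lam 2%nat) + qn (lam 3%nat)).
  assert (HB : 0 <= B) by (unfold B; assert (H := qn_ge0 q); assert (Hi := fun i => qn_ge0 (lam i)); assert (G1 := Hi 1%nat); assert (G2 := Hi 2%nat); assert (G3 := Hi 3%nat); lra).
  (* The 2 comes from x <= N + 1 <= 2 N, the 1 from rounding the drift to an integer. *)
  set (cz := 2 * (Rabs a1 + Rabs a2 + Rabs a3) + 1).
  assert (A1 := Rabs_pos a1). assert (A2 := Rabs_pos a2). assert (A3 := Rabs_pos a3).
  assert (Hcz : 0 <= cz) by (unfold cz; lra).
  destruct (kern_shift B cz HB Hcz) as (Cs & Ns & HCs & Hs).
  destruct (kern_displacement B HB) as (Cd & Nd & HCd & Hd).
  destruct facept_complete_squares as (s1 & s2 & s3 & s4 & be & ga & de & P1 & P2 & P3 & P4 & Hprod & Hsq).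
  destruct (triple_sum s1 s2 s3 s4 be ga de P1 P2 P3 P4) as (Ct & Nt & HCt & Ht).
  set (H := qn (hatlam lam 0)). assert (HH : 0 <= H) by apply qn_ge0.
  exists (H * Cs + H * Cd + D * Ct), (S (Nat.max Ns (Nat.max Nd Nt))).
  assert (0 <= H * Cs) by (apply Rmult_le_pos; auto). assert (0 <= H * Cd) by (apply Rmult_le_pos; auto).
  assert (0 <= D * Ct) by (apply Rmult_le_pos; lra). split; [lra|].
  intros N m sg x HN Hsg Hm Hx.
  assert (HN1 : 1 <= INR N) by (change 1 with (INR 1); apply le_INR; lia).
  assert (Hmx : Rabs (IZR m) = x).
  { rewrite Hm. destruct Hsg as [-> | ->]; [rewrite Rmult_1_l, Rabs_pos_eq; lra|].
    replace (-1 * x) with (- x) by ring. rewrite Rabs_Ropp, Rabs_pos_eq; lra. }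
  assert (Hm2 : IZR m ^ 2 = x ^ 2) by (rewrite Hm; destruct Hsg as [-> | ->]; ring).
  set (z1 := Int_part (IZR m * a1)). set (z2 := Int_part (IZR m * a2)). set (z3 := Int_part (IZR m * a3)).
  set (t1 := IZR m * a1 - IZR z1). set (t2 := IZR m * a2 - IZR z2). set (t3 := IZR m * a3 - IZR z3).
  destruct (Int_part_frac (IZR m * a1)) as [F1 G1]. destruct (Int_part_frac (IZR m * a2)) as [F2 G2]. destruct (Int_part_frac (IZR m * a3)) as [F3 G3].
  fold z1 t1 in F1, G1. fold z2 t2 in F2, G2. fold z3 t3 in F3, G3.
  rewrite Rabs_mult, Hmx in G1, G2, G3.
  set (b := qadd (qadd (qadd q (qscale t1 (lam 1%nat))) (qscale t2 (lam 2%nat))) (qscale t3 (lam 3%nat))).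
  assert (Hb : qn b <= B).
  { assert (Hq : forall t i, 0 <= t <= 1 -> qn (qscale t (lam i)) <= qn (lam i)).
    { intros t i Hti. rewrite qn_scale, Rabs_pos_eq by lra. assert (K := qn_ge0 (lam i)). nra. }
    unfold b, B. eapply Rle_trans; [apply qn_add|]. apply Rplus_le_compat; [|auto].
    eapply Rle_trans; [apply qn_add|]. apply Rplus_le_compat; [|auto].
    eapply Rle_trans; [apply qn_add|]. apply Rplus_le_compat; [lra|auto]. }
  assert (Hz : forall a z, IZR (Z.abs z) <= x * Rabs a + 1 -> Rabs a <= Rabs a1 + Rabs a2 + Rabs a3 -> IZR (Z.abs z) <= cz * INR N).
  { intros a z Hz Ha. assert (K := Rabs_pos a). unfold cz.
    assert (x * Rabs a <= 2 * INR N * (Rabs a1 + Rabs a2 + Rabs a3)) by (apply Rmult_le_compat; lra). lra. }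
  (* An exact rewriting term by term: the whole tangential drift of [m] copies of [lam 0] is shared
     between the index shifts and [b]. *)
  assert (Hbox : box3 (N ^ 5) (N ^ 6) (N ^ 7) (gshift lam q m) =
    box3 (N ^ 5) (N ^ 6) (N ^ 7) (fun n2 n3 n4 => kern b (IZR m) (n2 + z1) (n3 + z2) (n4 + z3))).
  { unfold box3. do 3 (apply zsum_ext; intros). unfold gshift, kern. f_equal. unfold facept, b, t1, t2, t3.
    assert (K0 := f_equal q0 Hdec). assert (K1 := f_equal q1 Hdec). assert (K2 := f_equal q2 Hdec). assert (K3 := f_equal q3 Hdec).
    unfold qadd, qscale in K0, K1, K2, K3; cbn [q0 q1 q2 q3] in K0, K1, K2, K3.
    apply quat_ext; unfold lpt, latpt, qsum4, qadd, qscale; cbn [q0 q1 q2 q3];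
      rewrite !plus_IZR, ?K0, ?K1, ?K2, ?K3; ring. }
  specialize (Hs N b (IZR m) z1 z2 z3 ltac:(lia) Hb ltac:(lra) (Hz a1 z1 G1 ltac:(lra)) (Hz a2 z2 G2 ltac:(lra)) (Hz a3 z3 G3 ltac:(lra))).
  specialize (Hd N b (IZR m) ltac:(lia) Hb ltac:(lra)).
  specialize (Ht N x ltac:(lia) Hx).
  rewrite <- Hbox in Hs. rewrite face_symmetric_sum in Hd.
  rewrite (rsum_ext (N ^ 5) _ (fun n2 => rsum (N ^ 6) (fun n3 => rsum (N ^ 7) (fun n4 => / quadform4 s1 s2 s3 s4 be ga de x n2 n3 n4 ^ 2)))) in Hd
    by (intros; do 2 (apply rsum_ext; intros); rewrite (Hsq _ x); auto).
  set (S := rsum (N ^ 5) (fun n2 => rsum (N ^ 6) (fun n3 => rsum (N ^ 7) (fun n4 => / quadform4 s1 s2 s3 s4 be ga de x n2 n3 n4 ^ 2)))) in *.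
  set (F := box3 (N ^ 5) (N ^ 6) (N ^ 7) (gshift lam q m)) in *.
  set (K := box3 (N ^ 5) (N ^ 6) (N ^ 7) (kern b (IZR m))) in *.
  assert (Hk : qmul (hatlam lam 0) (qscale (IZR m * S) (qconj (perp lam))) = qscale (IZR m * S * D) qone).
  { replace (qmul (hatlam lam 0) (qscale (IZR m * S) (qconj (perp lam)))) with (qscale (IZR m * S) (qmul (hatlam lam 0) (qconj (perp lam))))
      by (generalize (IZR m * S) (hatlam lam 0) (perp lam); qring).
    rewrite hatlam_mul_perp. generalize (IZR m * S). qring. }
  assert (E : qsub (qmul (hatlam lam 0) F) (qscale (sg * PI ^ 2) qone) =
    qadd (qadd (qmul (hatlam lam 0) (qsub F K)) (qmul (hatlam lam 0) (qsub K (qscale (IZR m * S) (qconj (perp lam))))))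
      (qscale (sg * D * (x * S - PI ^ 2 / (s1 * s2 * s3 * s4))) qone)).
  { assert (E1 : forall h u w y z, qadd (qadd (qmul h (qsub u w)) (qmul h (qsub w y))) z = qadd (qsub (qmul h u) (qmul h y)) z) by qring.
    rewrite E1, Hk, Hprod, Hm.
    replace (sg * D * (x * S - PI ^ 2 / D)) with (sg * x * S * D - sg * PI ^ 2) by (field; lra).
    generalize (qmul (hatlam lam 0) F) (sg * x * S * D) (sg * PI ^ 2). qring. }
  rewrite E. eapply Rle_trans; [apply qn_add|]. eapply Rle_trans; [apply Rplus_le_compat_r, qn_add|].
  rewrite !qn_mul, qn_scale. fold H.
  replace (qn qone) with 1 by (unfold qn, qnorm2, qone; simpl; replace (1 * (1 * 1) + 0 * (0 * 1) + 0 * (0 * 1) + 0 * (0 * 1)) with 1 by ring; symmetry; apply sqrt_1).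
  rewrite !Rabs_mult, (Rabs_pos_eq D) by lra.
  replace (Rabs sg) with 1 by (destruct Hsg as [-> | ->]; [rewrite Rabs_pos_eq; lra|rewrite Rabs_left; lra]).
  apply (Rmult_le_compat_l H) in Hs; auto. apply (Rmult_le_compat_l H) in Hd; auto. apply (Rmult_le_compat_l D) in Ht; [|lra].
  assert (Hr : 0 < / rootN N) by (apply Rinv_0_lt_compat; assert (HQ := rootN_ge1 N); lra).
  assert (Hi : 0 < / INR N) by (apply Rinv_0_lt_compat; lra).
  assert (0 <= H * Cs * / rootN N) by (apply Rmult_le_pos; lra).
  assert (0 <= H * Cd * / INR N) by (apply Rmult_le_pos; lra).
  unfold Rdiv in *. lra.
Qed.

Lemma hatlam_eta q : qsum4 (fun h => qmul (hatlam lam h) (eta lam q h)) = qscale (2 * PI ^ 2) qone.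
Proof.
  apply (Qcv_unique (fun N => box4 N N N N (fterm lam q))); [apply eta_comb_cv; auto|].
  apply Qcv_small with (fun N => box4 N (N ^ 5) (N ^ 6) (N ^ 7) (fterm lam q)); [|apply box_change; auto].
  apply Qcv_small with (fun _ => qscale (2 * PI ^ 2) qone); [apply Qcv_const|].
  destruct (face_limit q) as (C & N0 & HC & Hf).
  eapply small_le; [apply (small_add _ _ (face_reduction lam q HD)
     (small_add _ _ (small_add _ _ (small_root C HC) (small_inv C HC)) (small_add _ _ (small_root C HC) (small_inv C HC))))|].
  exists N0. intros N HN.
  (* Telescoping leaves the layers N + 1 and -N. Their limits have opposite signs, so the difference
     of the two faces adds them. *)
  assert (H1 := Hf N (Z.of_nat N + 1)%Z 1 (INR N + 1) HN ltac:(auto) ltac:(rewrite plus_IZR, <- INR_IZR_INZ; ring) ltac:(lra)).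
  assert (H2 := Hf N (- Z.of_nat N)%Z (-1) (INR N) HN ltac:(auto) ltac:(rewrite opp_IZR, <- INR_IZR_INZ; ring) ltac:(lra)).
  rewrite qn_sub_sym. eapply Rle_trans; [eapply qn_sub_tri|]. apply Rplus_le_compat_l.
  set (F1 := box3 (N ^ 5) (N ^ 6) (N ^ 7) (gshift lam q (Z.of_nat N + 1))) in *.
  set (F2 := box3 (N ^ 5) (N ^ 6) (N ^ 7) (gshift lam q (- Z.of_nat N))) in *.
  replace (qsub (qmul (hatlam lam 0) (qsub F1 F2)) (qscale (2 * PI ^ 2) qone)) with
    (qsub (qsub (qmul (hatlam lam 0) F1) (qscale (1 * PI ^ 2) qone)) (qsub (qmul (hatlam lam 0) F2) (qscale (-1 * PI ^ 2) qone)))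
    by (generalize (hatlam lam 0) F1 F2 (PI ^ 2); qring).
  eapply Rle_trans; [apply qn_sub|]. apply Rplus_le_compat; auto.
Qed.
End Faces.

(** * From a = 1 to arbitrary a *)

Theorem mainTheorem16 :
  forall (D O L : quat -> Prop) (lam : nat -> quat),
    is_definite_quat_alg D ->
    is_maximal_order D O ->
    (* L subset D is a left ideal of O ... *)
    (forall x, L x -> D x) ->
    (forall a x, O a -> L x -> L (qmul a x)) ->
    (* ... and a full-rank lattice in H with Z-basis lam_1..lam_4 *)
    R_indep lam ->
    (forall x, L x <-> in_Zspan lam x) ->
    0 < det4 (Lam lam) ->
    forall (a : quat) (U : nat -> nat -> Z),
      O a ->
      (* a lam = U_a lam *)
      (forall h, (h < 4)%nat ->
         qmul a (lam h) = qsum4 (fun j => qscale (IZR (U h j)) (lam j))) ->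
      forall q : quat, ~ L q ->
        qsum4 (fun i => qsum4 (fun j =>
           qscale (IZR (U i j)) (qmul (hatlam lam i) (eta lam q j))))
        = qscale (2 * PI ^ 2) (qconj a).
Proof.
  intros D O L lam _ _ _ _ _ _ HD a U _ HU q _.
  assert (HT := fun j Hj => hatlam_transpose lam a U j ltac:(lra) Hj HU).
  assert (HE := hatlam_eta lam HD q).
  (* Summing over the row index first lets the transposed matrix act on [hatlam]; [qconj a] then
     appears on the left of every term and factors out. *)
  transitivity (qsum4 (fun j => qmul (qsum4 (fun i => qscale (IZR (U i j)) (hatlam lam i))) (eta lam q j))).
  - assert (K : forall r x y, qscale r (qmul x y) = qmul (qscale r x) y) by qring.
    assert (K4 : forall x y z w t, qmul (qadd (qadd (qadd x y) z) w) t = qadd (qadd (qadd (qmul x t) (qmul y t)) (qmul z t)) (qmul w t)) by qring.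
    assert (KT : forall f : nat -> nat -> quat, qsum4 (fun i => qsum4 (fun j => f i j)) = qsum4 (fun j => qsum4 (fun i => f i j))) by (intros f; qring).
    rewrite KT. unfold qsum4. rewrite !K4, !K. reflexivity.
  - unfold qsum4 at 1. rewrite !HT by lia.
    transitivity (qmul (qconj a) (qsum4 (fun h => qmul (hatlam lam h) (eta lam q h)))).
    + assert (K : forall x y z, qmul (qmul x y) z = qmul x (qmul y z)) by qring.
      assert (K4 : forall x y z w t, qmul t (qadd (qadd (qadd x y) z) w) = qadd (qadd (qadd (qmul t x) (qmul t y)) (qmul t z)) (qmul t w)) by qring.
      unfold qsum4. rewrite K4, !K. reflexivity.
    + rewrite HE. generalize (2 * PI ^ 2). qring.
Qed.
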